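(* Let $(M,\Delta,g)$ be a connected sub-Riemannian manifold whose generic degree of non-holonomy is not smaller than $2$, and let $d$ be its Carnot-Carathéodory distance. Then $(M,d)$ cannot be bi-Lipschitzly embedded into any Banach space with the Radon-Nikodym property; that is, for every Banach space $(V,\|\cdot\|)$ with the Radon-Nikodym property there are no constant $L\ge1$ and map $f:M\to V$ with $$\frac1L d(x,y)\le\|f(x)-f(y)\|\le L\,d(x,y)\qquad\text{for all }x,y\in M.$$
   Context: **Sub-Riemannian manifold.** A triple $(M,\Delta,g)$ with $M$ a smooth manifold, $\Delta$ a smooth bracket-generating distribution and $g$ an inner product on $\Delta$. The rank of $\Delta$ need not be constant (the paper's examples include the Grushin plane, spanned by $\partial_x$ and $x\partial_y$): locally $\Delta$ is spanned by finitely many smooth vector fields $X_1,\dots,X_r$ with $g_p(v,v)=\min\{\sum u_i^2: v=\sum u_iX_i(p)\}$; when the rank is constant this is just a smooth inner product on the bundle $\Delta$. Put $\Delta^1=\Delta$, $\Delta^{i+1}=\Delta^i+[\Delta,\Delta^i]$; bracket-generating means that for every $p$ there is $k$ with $\Delta^k_p=T_pM$; the smallest such $k=k(p)$ is the degree of non-holonomy at $p$. A point $p$ is regular if, for each $i\le k(p)$, $\dim\Delta^i$ is constant near $p$; the set of regular points is open and dense in $M$. The generic degree of non-holonomy is the degree of non-holonomy at regular points; that it is not smaller than $2$ means $k(p)\ge2$ at the regular points $p$. An absolutely continuous curve $\gamma:[a,b]\to M$ is horizontal if it is a.e. tangent to $\Delta$; its length is $\int_a^b\sqrt{g(\dot\gamma,\dot\gamma)}\,dt$.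 The Carnot-Carathéodory distance $d(x,y)$ is the infimum of lengths of horizontal curves joining $x$ to $y$. **Radon-Nikodym property.** A Banach space $V$ has the Radon-Nikodym property if every Lipschitz function $f:\mathbb{R}^k\to V$ is differentiable almost everywhere. *)

(* Defs.v *)
From mathcomp Require Import all_boot all_order all_algebra.
From mathcomp Require Import all_classical all_reals all_analysis.

Set Implicit Arguments.
Unset Strict Implicit.
Unset Printing Implicit Defensive.

Import Order.TTheory GRing.Theory Num.Theory.
Import numFieldNormedType.Exports.

Local Open Scope classical_set_scope.
Local Open Scope ring_scope.

(* [U] is meant to be open, and [V] finite-dimensional. *)
Fixpoint Ck_on (R : realType) (V W : normedModType R) (k : nat) (U : set V)
    (f : V -> W) : Prop :=
  match k with
  | 0 => forall x, U x -> {for x, continuous f}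
  | k'.+1 => (forall x, U x -> differentiable f x) /\
             forall v : V, Ck_on k' U (fun x => 'd f x v)
  end.

Definition smooth_on (R : realType) (V W : normedModType R) (U : set V)
    (f : V -> W) : Prop :=
  forall k, Ck_on k U f.

(* A chart is a pair of mutually inverse homeomorphisms between [chart_dom] and
   an open subset of R^n; the two total functions carry no information outside
   of these sets. *)
Record chart (R : realType) (n : nat) (M : topologicalType) := Chart {
  chart_dom : set M ;
  chart_fun :> M -> 'rV[R]_n ;
  chart_inv : 'rV[R]_n -> M ;
  chart_dom_open : open chart_dom ;
  chart_img_open : open (chart_fun @` chart_dom) ;
  chart_funK : forall p, chart_dom p -> chart_inv (chart_fun p) = p ;
  chart_fun_continuous : {within chart_dom, continuous chart_fun} ;
  chart_inv_continuous :
    {within chart_fun @` chart_dom, continuous chart_inv} }.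

(* [chart_at p] is an arbitrary chart at [p].  It is used to represent the
   tangent space at [p] by 'rV[R]_n: the row vector [v] stands for the tangent
   vector whose coordinates in the chart [chart_at p] are [v]. *)
Record smoothManifold (R : realType) (n : nat) := SmoothManifold {
  carrier :> topologicalType ;
  manifold_hausdorff : hausdorff_space carrier ;
  manifold_second_countable : @second_countable carrier ;
  atlas : set (chart R n carrier) ;
  atlas_compatible : forall c c', atlas c -> atlas c' ->
    smooth_on (c @` (chart_dom c `&` chart_dom c')) (c' \o chart_inv c) ;
  chart_at : carrier -> chart R n carrier ;
  chart_at_atlas : forall p, atlas (chart_at p) ;
  chart_at_dom : forall p, chart_dom (chart_at p) p }.

Section VectorFields.
Context {R : realType} {n : nat} {M : smoothManifold R n}.
Implicit Types (X Y Z : M -> 'rV[R]_n) (U : set M) (c : chart R n M).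

(* The coordinate expression of the vector field X in the chart c: the vector
   X p, given in the chart [chart_at p], is transported to the chart c by the
   differential of the change of charts. *)
Definition local_rep c X (x : 'rV[R]_n) : 'rV[R]_n :=
  let p := chart_inv c x in
  'd (c \o chart_inv (chart_at p)) (chart_at p p) (X p).

Definition smooth_field U X : Prop :=
  forall c, atlas c -> smooth_on (c @` (U `&` chart_dom c)) (local_rep c X).

Definition lie_bracket X Y (p : M) : 'rV[R]_n :=
  let c := chart_at p in
  'd (local_rep c Y) (c p) (local_rep c X (c p)) -
  'd (local_rep c X) (c p) (local_rep c Y (c p)).

Variable Delta : M -> {vspace 'rV[R]_n}.

Definition sections U : set (M -> 'rV[R]_n) :=
  [set X | smooth_field U X /\ forall p, U p -> X p \in Delta p].

(* F + [Delta, F] *)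
Definition bracket_step U (F : set (M -> 'rV[R]_n)) : set (M -> 'rV[R]_n) :=
  [set W | exists X m (Y Z : 'I_m -> M -> 'rV[R]_n),
    [/\ F X,
        forall j, sections U (Y j),
        forall j, F (Z j) &
        forall p, U p -> W p = X p + \sum_(j < m) lie_bracket (Y j) (Z j) p]].

(* Delta^i, as a set of vector fields over the open set U, for i >= 1. *)
Definition flag (i : nat) U : set (M -> 'rV[R]_n) :=
  iter i.-1 (bracket_step U) (sections U).

Definition flag_at (i : nat) (p : M) : set 'rV[R]_n :=
  [set v | exists U X, [/\ open U, U p, flag i U X & X p = v]].

Definition bracket_generating : Prop :=
  forall p, exists2 k, (1 <= k)%N & flag_at k p = setT.

Definition nonholonomy_degree (p : M) (k : nat) : Prop :=
  [/\ (1 <= k)%N, flag_at k p = setT &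
      forall j, (1 <= j < k)%N -> flag_at j p <> setT].

Definition regular_point (p : M) : Prop :=
  exists2 k, nonholonomy_degree p k &
    forall i, (1 <= i <= k)%N -> exists m : nat, \forall q \near p,
      exists2 E : {vspace 'rV[R]_n}, \dim E = m & flag_at i q = [set` E].

Definition generic_degree_ge (m : nat) : Prop :=
  forall p k, regular_point p -> nonholonomy_degree p k -> (m <= k)%N.

End VectorFields.

Definition inner_product_on (R : realType) (E : vectType R) (D : {vspace E})
    (g : E -> E -> R) : Prop :=
  [/\ {in D &, forall v w, g v w = g w v},
      {in D & &, forall u v w, forall a : R, g (a *: u + v) w = a * g u w + g v w} &
      {in D, forall v, v != 0 -> 0 < g v v}].

(* On U, Delta is spanned by X_1, ..., X_r, and
   g_q(v, v) = min { sum_i u_i^2 : v = sum_i u_i X_i(q) }. *)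
Definition generates (R : realType) (n : nat) (M : smoothManifold R n)
    (Delta : M -> {vspace 'rV[R]_n}) (g : M -> 'rV[R]_n -> 'rV[R]_n -> R)
    (U : set M) (r : nat) (X : 'I_r -> M -> 'rV[R]_n) : Prop :=
  (forall i, smooth_field U (X i)) /\
  forall q, U q ->
    Delta q = (\sum_(i < r) <[X i q]>)%VS /\
    forall v, v \in Delta q ->
      (exists2 u : 'I_r -> R, v = \sum_(i < r) u i *: X i q &
                              g q v v = \sum_(i < r) u i ^+ 2) /\
      (forall u : 'I_r -> R, v = \sum_(i < r) u i *: X i q ->
                             g q v v <= \sum_(i < r) u i ^+ 2).

Record subRiemannian (R : realType) (n : nat) (M : smoothManifold R n) :=
  SubRiemannian {
  sr_distribution : M -> {vspace 'rV[R]_n} ;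
  sr_metric : M -> 'rV[R]_n -> 'rV[R]_n -> R ;
  sr_metric_inner : forall p, inner_product_on (sr_distribution p) (sr_metric p) ;
  locally_generated : forall p, exists U r (X : 'I_r -> M -> 'rV[R]_n),
    [/\ open U, U p & generates sr_distribution sr_metric U X] ;
  sr_distribution_bracket_generating : bracket_generating sr_distribution }.

Definition abs_continuous (R : realType) (W : normedModType R) (f : R -> W)
    (a b : R) : Prop :=
  forall e : R, 0 < e -> exists2 d : R, 0 < d &
    forall m (u v : 'I_m -> R),
      (forall i, [/\ a <= u i, u i <= v i & v i <= b]) ->
      (forall i j, i != j -> v i <= u j \/ v j <= u i) ->
      \sum_(i < m) (v i - u i) < d ->
      \sum_(i < m) `|f (v i) - f (u i)| < e.

Section Curves.
Context {R : realType} {n : nat} {M : smoothManifold R n}.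
Variable S : subRiemannian M.
Implicit Types (gam : R -> M) (a b : R).

Definition abs_continuous_curve gam a b : Prop :=
  {within `[a, b], continuous gam} /\
  forall c, atlas c -> forall s t, a <= s -> s <= t -> t <= b ->
    gam @` `[s, t] `<=` chart_dom c -> abs_continuous (c \o gam) s t.

(* The velocity, as an element of the tangent space at [gam t]. *)
Definition velocity gam (t : R) : 'rV[R]_n :=
  derive1 (chart_at (gam t) \o gam) t.

Definition horizontal gam a b : Prop :=
  abs_continuous_curve gam a b /\
  {ae @lebesgue_measure R, forall t, t \in `[a, b] ->
     derivable (chart_at (gam t) \o gam) t 1 /\
     velocity gam t \in sr_distribution S (gam t)}.

Definition curve_length gam a b : \bar R :=
  (\int[@lebesgue_measure R]_(t in `[a, b])
    (Num.sqrt (sr_metric S (gam t) (velocity gam t) (velocity gam t)))%:E)%E.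

Definition cc_dist (x y : M) : \bar R :=
  ereal_inf [set l | exists a b gam,
    [/\ a <= b, horizontal gam a b, gam a = x, gam b = y &
        l = curve_length gam a b]].

End Curves.

(* Lebesgue-null subsets of R^k, via countable (possibly finite or empty, whence
   the index set I) covers by boxes; the box of R^0 has volume 1. *)
Definition lebesgue_null (R : realType) (k : nat) (A : set 'rV[R]_k) : Prop :=
  forall e : R, 0 < e -> exists (I : pred nat) (a b : nat -> 'rV[R]_k),
    [/\ forall i j, a i ord0 j <= b i ord0 j,
        A `<=` \bigcup_(i in [set i | I i])
                 [set x | forall j, a i ord0 j <= x ord0 j <= b i ord0 j] &
        (\sum_(i <oo | I i) (\prod_(j < k) (b i ord0 j - a i ord0 j))%:E
           <= e%:E)%E].

Definition radon_nikodym_property (R : realType) (V : completeNormedModType R)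
    : Prop :=
  forall (k : nat) (f : 'rV[R]_k -> V), lipschitz f ->
    lebesgue_null [set x | ~ differentiable f x].

Definition bilipschitz_embedding (R : realType) (T : Type) (d : T -> T -> \bar R)
    (V : normedModType R) (L : R) (f : T -> V) : Prop :=
  forall x y, (((L^-1)%:E * d x y <= (`|f x - f y|)%:E) /\
               ((`|f x - f y|)%:E <= L%:E * d x y))%E.

(* Main.v *)
(** The embedding f is Lipschitz along horizontal flows, so by the Radon-Nikodym property its
    difference quotients (f(e^(hX) q) - f(q)) / h converge as h tends to 0 for almost every q on each
    integral curve of X.  Averaging over starting points q, one finds points q and q' = e^(sY) q, with
    s = eps h, at which the quotients at scale h are both close to those at a much larger scale H, and
    the latter nearly agree because s is much smaller than H.  Hence the points a = e^(hX) q and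
    b = e^(hX) q' satisfy |f(b) - f(a)| <= K eps h + o(h).  But b - a is sY(a) plus about s h [Y, X],
    transverse to the distribution, so d(a, b) is at least c sqrt(s h) = c sqrt(eps) h, a contradiction
    when eps is small.

    A suitable X, Y exist near any point where the rank of the distribution is maximal: it is then
    locally constant, and it is not full since the point would be regular of degree 1; were all brackets
    of sections tangent there, the flag would not grow.  That f is continuous in the
    manifold topology is not assumed: it follows from moving along iterated commutators of flows,
    as in Chow's theorem. *)

Require Import Defs.
From HB Require Import structures.
From mathcomp Require Import all_boot all_order all_algebra.
From mathcomp Require Import all_classical all_reals all_analysis measurable_realfun.
From mathcomp Require Import ring lra zify.

Import Order.TTheory GRing.Theory Num.Theory.
Import numFieldNormedType.Exports.

Local Open Scope classical_set_scope.
Local Open Scope ring_scope.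

(** * Trajectories of Lipschitz vector fields *)

(** Differentiability almost everywhere on each integral curve of X does not compare a curve with
    its translate by Y, and the translation s = eps h depends on the scale h. So a good pair is
    found by averaging the defect between the quotients at scales h and H: over the flow time by
    dominated convergence, then over a cube of initial points. A pigeonhole over a fine grid stands
    for the change of variables: read in flow coordinates, the translation is so near the identity
    that, up to rounding, it identifies at most 9^n grid points. The scale h is chosen after H, so
    small that translating by eps h hardly affects F at scale H.

    The square root comes from a covector th(a) that kills the distribution at a. Along a horizontal
    curve of length l from a, its values on velocities are O(l) times the speed, so the curve moves
    O(l^2) against th(a). Locally constant rank serves both this covector and the upper bounds:
    where the rank jumps, a smooth section can have unbounded speed.

    Measurability of the speed of a horizontal curve is bypassed: its length acts as a lower
    integral. *)

Section EpsilonDelta.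
Context {R : realType}.

Lemma nbhs_eps (V : normedModType R) (x : V) (P : set V) :
  nbhs x P <-> exists2 d : R, 0 < d & forall y, `|y - x| < d -> P y.
Proof.
split=> [/nbhs_normP[d d0 h]|[d d0 h]].
  by exists d => // y yx; apply: h; rewrite /= distrC.
by apply/nbhs_normP; exists d => // y /= yx; apply: h; rewrite distrC.
Qed.

Lemma continuous_eps (V W : normedModType R) (f : V -> W) (x : V) :
  {for x, continuous f} <-> forall e : R, 0 < e ->
    exists2 d : R, 0 < d & forall y, `|y - x| < d -> `|f y - f x| < e.
Proof.
split=> [/cvgrPdist_lt h e e0|h].
  have /nbhs_eps[d d0 hd] := h _ e0.
  by exists d => // y yx; rewrite distrC; apply: hd.
apply/cvgrPdist_lt => e e0; have [d d0 hd] := h _ e0.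
by apply/nbhs_eps; exists d => // y yx; rewrite distrC; apply: hd.
Qed.

Lemma open_eps (V : normedModType R) (U : set V) (x : V) : open U -> U x ->
  exists2 d : R, 0 < d & forall y, `|y - x| < d -> U y.
Proof. by move=> oU Ux; apply/nbhs_eps; apply: open_nbhs_nbhs. Qed.

End EpsilonDelta.

Section RowVectors.
Context {R : realType} {n : nat}.
Implicit Types v w : 'rV[R]_n.

Lemma rV_norm_le v (e : R) : 0 <= e ->
  (`|v| <= e) <-> (forall j, `|v ord0 j| <= e).
Proof.
move=> e0; rewrite [`|v|]/Num.Def.normr/= mx_normrE; split=> [h j|h].
  by apply: le_trans h; apply: (le_bigmax _ (fun ij : 'I_1 * 'I_n => `|v ij.1 ij.2|) (ord0, j)).
by apply: bigmax_le => //= -[i j] _ /=; rewrite (ord1 i).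
Qed.

Lemma rV_norm_coord v j : `|v ord0 j| <= `|v|.
Proof. by apply: (rV_norm_le v `|v| (normr_ge0 _)).1. Qed.

End RowVectors.

Section MeanValue.
Context {R : realType} {n : nat}.

Lemma is_derive_coord (g : R -> 'rV[R]_n) (u : R) (d : 'rV[R]_n) j :
  is_derive u 1 g d -> is_derive u 1 (fun t => g t ord0 j) (d ord0 j).
Proof.
move=> [dg <-]; split; first by move/derivable_mxP: dg; apply.
by rewrite derive_mx// mxE.
Qed.

Lemma is_derive_rV (g : R -> 'rV[R]_n) (u : R) (d : 'rV[R]_n) :
  (forall j, is_derive u 1 (fun t => g t ord0 j) (d ord0 j)) -> is_derive u 1 g d.
Proof.
move=> dg.
have Dg : derivable g u 1.
  apply/derivable_mxP => i j; rewrite (ord1 i).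
  by have [] := dg j.
split=> //; rewrite derive_mx//; apply/rowP => j; rewrite mxE.
by have [_ <-] := dg j.
Qed.

Lemma mvt_real (g dg : R -> R) (s t w r : R) : s <= t ->
  (forall u, s <= u <= t -> is_derive u 1 g (dg u)) ->
  (forall u, s <= u <= t -> `|dg u - w| <= r) ->
  `|g t - g s - (t - s) * w| <= (t - s) * r.
Proof.
move=> st hg hr.
have [||c cst ->] := @MVT_segment R g dg s t st.
- by move=> x; rewrite in_itv/= => /andP[sx xt]; apply: hg; rewrite !ltW.
- apply: derivable_within_continuous => x; rewrite in_itv/= => xst.
  by have [] := hg _ xst.
have -> : dg c * (t - s) - (t - s) * w = (t - s) * (dg c - w) by ring.
rewrite normrM ger0_norm ?subr_ge0// ler_wpM2l ?subr_ge0//.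
by apply: hr; move: cst; rewrite in_itv.
Qed.

Lemma mvt_rV (g dg : R -> 'rV[R]_n) (s t : R) (w : 'rV[R]_n) (r : R) :
  s <= t -> 0 <= r ->
  (forall u, s <= u <= t -> is_derive u 1 g (dg u)) ->
  (forall u, s <= u <= t -> `|dg u - w| <= r) ->
  `|g t - g s - (t - s) *: w| <= (t - s) * r.
Proof.
move=> st r0 hg hr.
apply/rV_norm_le; first by rewrite mulr_ge0 ?subr_ge0.
move=> j; rewrite !mxE.
apply: (@mvt_real (fun u => g u ord0 j) (fun u => dg u ord0 j)) => // u ust.
  exact/is_derive_coord/hg.
have := (rV_norm_le _ r r0).1 (hr u ust) j.
by rewrite !mxE.
Qed.

Lemma derive_bound_rV (g dg : R -> 'rV[R]_n) (s t r : R) :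
  s <= t -> 0 <= r ->
  (forall u, s <= u <= t -> is_derive u 1 g (dg u)) ->
  (forall u, s <= u <= t -> `|dg u| <= r) ->
  `|g t - g s| <= (t - s) * r.
Proof.
move=> st r0 hg hr.
have := @mvt_rV g dg s t 0 r st r0 hg; rewrite scaler0 subr0; apply => u ust.
by rewrite subr0 hr.
Qed.

End MeanValue.

Section Antiderivative.
Context {R : realType}.

(** Integrating from -1 makes 0 an interior point, so that solutions built from this primitive have
    a two-sided derivative at time 0. *)
Lemma antiderivative (g : R -> R) : continuous g ->
  exists2 G : R -> R, G 0 = 0 & forall t : R, -1 < t -> is_derive t 1 G (g t).
Proof.
move=> cg.
pose G0 (x : R) := (\int[@lebesgue_measure R]_(t in `[(-1)%R, x]) g t)%R.
exists (fun x => G0 x - G0 0); first by rewrite subrr.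
move=> t t1.
have := @continuous_FTC1_closed R g (-1) t (t + 1).
case.
- by rewrite ltrDl.
- apply: continuous_compact_integrable => //; first exact: segment_compact.
  exact: continuous_subspaceT.
- by [].
- exact: cg.
move=> dG dGE.
have dG0 : is_derive t 1 G0 (g t).
  by apply: DeriveDef; [exact: dG|rewrite -derive1E; exact: dGE].
have := @is_deriveB R R R G0 (cst (G0 0)) t 1 (g t) 0 dG0 _.
by rewrite subr0; apply.
Qed.

Lemma antiderivative_rV n (g : R -> 'rV[R]_n) : continuous g ->
  exists2 G : R -> 'rV[R]_n, G 0 = 0 & forall t : R, -1 < t -> is_derive t 1 G (g t).
Proof.
move=> cg.
have /choice[G hG] : forall j, exists G : R -> R, G 0 = 0 /\
    forall t : R, -1 < t -> is_derive t 1 G (g t ord0 j).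
  move=> j; have [|G G0 dG] := antiderivative (fun t => g t ord0 j); last by exists G.
  move=> t; apply: (@continuous_comp _ _ _ g (fun v : 'rV[R]_n => v ord0 j)).
    exact: cg.
  exact: coord_continuous.
exists (fun t => \row_j G j t); first by apply/rowP => j; rewrite !mxE (hG j).1.
move=> t t1; apply: is_derive_rV => j.
have [_ /(_ _ t1)] := hG j.
by under [in X in _ -> is_derive _ _ X _]eq_fun do rewrite mxE.
Qed.

End Antiderivative.

Lemma geometric_cauchy_real {R : realType} (u : nat -> R) (C : R) :
  (forall k, `|u k.+1 - u k| <= C * 2^-1 ^+ k) ->
  exists l, forall k, `|u k - l| <= 2 * C * 2^-1 ^+ k.
Proof.
move=> hu.
have C0 : 0 <= C by have := hu 0%N; rewrite expr0 mulr1; apply: le_trans.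
(* The factor [1 - 2^-1 ^+ m], the partial sum of the geometric series, is what makes the induction
   close. *)
have mono k m : `|u (k + m)%N - u k| <= 2 * C * 2^-1 ^+ k * (1 - 2^-1 ^+ m).
  elim: m => [|m IH]; first by rewrite addn0 subrr normr0 expr0 subrr mulr0.
  rewrite addnS -(subrKA (u (k + m)%N)).
  apply: le_trans (ler_normD _ _) _.
  apply: le_trans (lerD (hu _) IH) _.
  rewrite exprD exprS.
  by rewrite le_eqVlt; apply/orP; left; apply/eqP; field.
have bnd k m : `|u (k + m)%N - u k| <= 2 * C * 2^-1 ^+ k.
  apply: le_trans (mono k m) _.
  have h1 : 0 <= 2 * C * 2^-1 ^+ k by rewrite !mulr_ge0// exprn_ge0.
  have h2 : 0 <= 2^-1 ^+ m :> R by rewrite exprn_ge0.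
  nra.
have cvgu : cvgn u.
  apply: cauchy_cvg; apply: cauchy_exP => e e0.
  have h0 : (fun k => 4 * C * 2^-1 ^+ k) @ \oo --> (0 : R).
    rewrite -(mulr0 (4 * C)).
    apply: cvgM; first exact: cvg_cst.
    apply: cvg_expr; rewrite ger0_norm ?invr_ge0// invf_lt1//; lra.
  have /cvgrPdist_lt/(_ _ e0)[N _ hN] := h0.
  have hNN := hN N (leqnn _); rewrite sub0r normrN ger0_norm in hNN; last first.
    by rewrite !mulr_ge0// exprn_ge0.
  exists (u N); exists N => // m /= Nm.
  rewrite -ball_normE /ball_/= distrC.
  apply: le_lt_trans hNN.
  have := bnd N (m - N)%N; rewrite subnKC//.
  have : 0 <= C * 2^-1 ^+ N by rewrite mulr_ge0// exprn_ge0.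
  lra.
exists (limn u) => k.
apply/ler_addgt0Pr => e e0.
have /cvgrPdist_lt/(_ _ e0)[N _ hN] := cvgu.
have := hN (k + N)%N (leq_addl _ _); have := bnd k N.
move=> h1 h2; rewrite -(subrKA (u (k + N)%N)).
apply: le_trans (ler_normD _ _) _.
by rewrite (distrC (u k)) (distrC _ (limn u)) lerD// ltW.
Qed.

Lemma geometric_cauchy {R : realType} {n : nat} (u : nat -> 'rV[R]_n) (C : R) :
  (forall k, `|u k.+1 - u k| <= C * 2^-1 ^+ k) ->
  exists l, forall k, `|u k - l| <= 2 * C * 2^-1 ^+ k.
Proof.
move=> hu.
have C0 : 0 <= C by have := hu 0%N; rewrite expr0 mulr1; apply: le_trans.
have /choice[l hl] : forall j, exists l : R, forall k,
    `|u k ord0 j - l| <= 2 * C * 2^-1 ^+ k.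
  move=> j; apply: geometric_cauchy_real => k; apply: le_trans (hu k).
  by have := rV_norm_coord (u k.+1 - u k) j; rewrite !mxE.
exists (\row_j l j) => k; apply/rV_norm_le.
  by rewrite !mulr_ge0// exprn_ge0.
by move=> j; rewrite !mxE.
Qed.

Lemma le0_of_geometric {R : realType} (x C : R) :
  (forall k, x <= C * 2^-1 ^+ k) -> x <= 0.
Proof.
move=> h; apply/ler_addgt0Pr => e e0; rewrite add0r.
have h0 : (fun k => C * 2^-1 ^+ k) @ \oo --> (0 : R).
  rewrite -(mulr0 C); apply: cvgM; first exact: cvg_cst.
  apply: cvg_expr; rewrite ger0_norm ?invr_ge0// invf_lt1//; lra.
have /cvgrPdist_lt/(_ _ e0)[N _ hN] := h0.
have := hN N (leqnn _); rewrite sub0r normrN => /ltW; apply: le_trans.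
by apply: le_trans (h N) (ler_norm _).
Qed.

(** * Existence of solutions by Picard iteration *)

Section Picard.
Context {R : realType} {n : nat}.
Implicit Types (F : 'rV[R]_n -> 'rV[R]_n) (sg : R -> 'rV[R]_n).

Lemma continuous_uniform_limit (s : nat -> R -> 'rV[R]_n) (l : R -> 'rV[R]_n) (C : R) :
  (forall k, continuous (s k)) -> (forall k t, `|s k t - l t| <= C * 2^-1 ^+ k) ->
  continuous l.
Proof.
move=> cs sl t; apply/cvgrPdist_le => e e0.
have [k hk] : exists k, C * 2^-1 ^+ k <= e / 3.
  apply: contrapT => /forallNP h.
  have /le0_of_geometric : forall k, e / 3 <= C * 2^-1 ^+ k.
    by move=> k; rewrite leNgt; apply/negP => /ltW; exact: h.
  lra.
have e3 : 0 < e / 3 by lra.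
have /cvgrPdist_le/(_ _ e3) := cs k t.
apply: filterS => u hu.
have h1 := sl k t; have h2 := sl k u.
have -> : l t - l u = (l t - s k t) + (s k t - s k u) + (s k u - l u).
  by rewrite !addrA !subrK.
apply: le_trans (ler_normD _ _) _; apply: le_trans (lerD (ler_normD _ _) (lexx _)) _.
rewrite (distrC (l t)); lra.
Qed.

(** With L * T at most 1/2 the integral operator [Phi] halves uniform distances, so the iterates
    converge geometrically; no smallness of the field itself enters because F is globally
    Lipschitz. *)
Lemma picard F (L T : R) (y : 'rV[R]_n) : 0 <= L ->
  (forall x x', `|F x - F x'| <= L * `|x - x'|) -> 0 <= T -> L * T <= 2^-1 ->
  exists2 sg, sg 0 = y & forall t, 0 <= t <= T -> is_derive t 1 sg (F (sg t)).
Proof.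
move=> L0 FL T0 LT.
(* Time is clamped to [0, T]: the iterates become continuous on the whole line, and their integrals
   are differentiable from both sides at 0 and at T. *)
pose c (t : R) := Num.max 0 (Num.min t T).
have c0T t : 0 <= c t <= T.
  by rewrite /c le_max lexx/= ge_max T0/= ge_min lexx orbT.
have cid t : 0 <= t <= T -> c t = t.
  by move=> /andP[t0 tT]; rewrite /c (min_idPl tT) (max_idPr t0).
have cc : continuous c.
  move=> t; have h1 : {for t, continuous (id \min cst T : R -> R^o)}.
    by apply: (@continuous_min R R id (cst T)); [exact: cvg_id|exact: cvg_cst].
  by apply: (@continuous_max R R (cst 0) _ t _ h1); exact: cvg_cst.
have cF : continuous F.
  move=> x; apply/continuous_eps => e e0.
  have L1 : 0 < L + 1 by rewrite ltr_wpDl.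
  exists (e / (L + 1)); first by rewrite divr_gt0.
  move=> z; rewrite ltr_pdivlMr// => h.
  apply: le_lt_trans (FL _ _) _; apply: le_lt_trans h.
  by rewrite mulrC ler_wpM2l// lerDl.
have /choice[Phi hPhi] : forall sg : R -> 'rV[R]_n, exists sg' : R -> 'rV[R]_n,
    continuous sg -> sg' 0 = y /\
    forall t : R, -1 < t -> is_derive t 1 sg' (F (sg (c t))).
  move=> sg; have [csg|] := pselect (continuous sg); last by exists sg.
  have [|G G0 dG] := @antiderivative_rV R n (fun t => F (sg (c t))).
    move=> t; apply: (@continuous_comp _ _ _ (sg \o c) F); last exact: cF.
    by apply: continuous_comp; [exact: cc|exact: csg].
  exists (fun t => y + G t) => _; split; first by rewrite G0 addr0.
  move=> t t1; have := dG t t1 => dGt.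
  have := @is_deriveD R R _ (cst y) G t 1 0 _ _ dGt.
  by rewrite add0r; apply.
have Nc t : -1 < c t by have /andP[] := c0T t; lra.
have cPhi sg : continuous sg -> continuous (Phi sg \o c).
  move=> csg t; apply: continuous_comp; first exact: cc.
  have [_ /(_ (c t) (Nc t)) [+ _]] := hPhi sg csg.
  by move/derivable1_diffP/differentiable_continuous.
pose s := fix s k := if k is k'.+1 then Phi (s k') \o c else cst y.
have cs k : continuous (s k).
  by elim: k => [|k IH]; [move=> t; exact: cvg_cst|exact: cPhi].
have Phi_contr sg sg' C : continuous sg -> continuous sg' ->
    (forall t, `|sg t - sg' t| <= C) ->
    forall t, `|Phi sg (c t) - Phi sg' (c t)| <= 2^-1 * C.
  move=> csg csg' h t.
  have C0 : 0 <= C by apply: le_trans (h 0).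
  have [P0 dP] := hPhi _ csg; have [P0' dP'] := hPhi _ csg'.
  have /andP[ct0 ctT] := c0T t.
  have := @derive_bound_rV R n (Phi sg - Phi sg')
    (fun u => F (sg (c u)) - F (sg' (c u))) 0 (c t) (L * C) ct0 (mulr_ge0 L0 C0).
  have -> : (Phi sg - Phi sg') 0 = 0 by rewrite !fctE P0 P0' subrr.
  rewrite !subr0 => hb; apply: (le_trans (hb _ _)).
  - move=> u /andP[u0 _]; apply: is_deriveB; [apply: dP|apply: dP']; lra.
  - by move=> u _; apply: le_trans (FL _ _) _; rewrite ler_wpM2l.
  - have : c t * L <= 2^-1.
      apply: le_trans LT; rewrite mulrC ler_wpM2l//.
    by move=> hh; rewrite mulrA ler_wpM2r.
have s01 t : `|s 1%N t - s 0%N t| <= T * `|F y|.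
  have [P0 dP] := hPhi _ (cs 0%N).
  have /andP[ct0 ctT] := c0T t.
  have := @derive_bound_rV R n (Phi (s 0%N)) (fun u => F y) 0 (c t) `|F y| ct0 (normr_ge0 _).
  rewrite P0 subr0 => hb; apply: (le_trans (hb _ _)).
  - by move=> u /andP[u0 _]; apply: dP; lra.
  - by [].
  - by rewrite ler_wpM2r.
have sk k t : `|s k.+1 t - s k t| <= T * `|F y| * 2^-1 ^+ k.
  elim: k t => [t|k IH t]; first by rewrite expr0 mulr1; apply: s01.
  rewrite exprS mulrCA; exact: (Phi_contr (s k.+1) (s k) _ (cs _) (cs _) IH t).
have /choice[l hl] : forall t, exists l, forall k, `|s k t - l| <= 2 * (T * `|F y|) * 2^-1 ^+ k.
  move=> t; exact: geometric_cauchy (s ^~ t) (T * `|F y|) (fun k => sk k t).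
have cl : continuous l by apply: (continuous_uniform_limit s l _ cs) => k t; exact: hl.
have [P0 dP] := hPhi _ cl.
(* The limit [l] is constant outside [0, T] and may have corners at 0 and T. Its image [Phi l]
   agrees with it on [0, T] and has two-sided derivatives there. *)
exists (Phi l) => // t t0T.
have := dP t; rewrite cid// => h.
suff -> : Phi l t = l t by apply: h; move: t0T => /andP[]; lra.
apply/eqP; rewrite -subr_eq0 -normr_le0.
apply: (@le0_of_geometric _ _ (2 * (2 * (T * `|F y|)))) => k.
have h1 := Phi_contr l (s k) _ cl (cs k) (fun u => _ : `|l u - s k u| <= 2 * (T * `|F y|) * 2^-1 ^+ k).
have {}h1 : `|Phi l t - s k.+1 t| <= 2^-1 * (2 * (T * `|F y|) * 2^-1 ^+ k).
  have := h1 _ t; rewrite /= (cid t)//; apply => u; rewrite distrC; exact: hl.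
have h2 := hl t k.+1.
rewrite -(subrKA (s k.+1 t)); apply: le_trans (ler_normD _ _) _.
apply: le_trans (lerD h1 h2) _; rewrite exprS.
have : 0 <= 2^-1 ^+ k :> R by rewrite exprn_ge0.
have : 0 <= T * `|F y| by rewrite mulr_ge0.
nra.
Qed.

End Picard.

Section Clamp.
Context {R : realType}.
Implicit Types a r x y : R.

Lemma clamp_dist a r x : 0 <= r -> `|Num.max (a - r) (Num.min (a + r) x) - a| <= r.
Proof.
move=> r0; rewrite ler_norml; apply/andP.
by case: (leP (a + r) x) => h1; case: (leP (a - r) _) => h2; split; lra.
Qed.

Lemma clamp_id a r x : `|x - a| <= r -> Num.max (a - r) (Num.min (a + r) x) = x.
Proof.
rewrite ler_norml => /andP[h1 h2].
by case: (leP (a + r) x) => h3; case: (leP (a - r) _) => h4; lra.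
Qed.

Lemma clamp_lipschitz a r x y :
  `|Num.max (a - r) (Num.min (a + r) x) - Num.max (a - r) (Num.min (a + r) y)| <= `|x - y|.
Proof.
have := ler_norm (x - y); have := ler_norm (- (x - y)); rewrite normrN ler_norml => h7 h8.
apply/andP.
by case: (leP (a + r) x) => h3; case: (leP (a - r) _) => h4;
  case: (leP (a + r) y) => h5; case: (leP (a - r) _) => h6; split; lra.
Qed.

End Clamp.

(** The confinement to the ball is part of the notion because the fields are controlled only there.
    The derivative is two-sided at both ends, which makes reversal and shift of time harmless. *)
Definition ltraj {R : realType} {n : nat} (xi : 'rV[R]_n -> 'rV[R]_n) (q : 'rV[R]_n)
    (rho : R) (sg : R -> 'rV[R]_n) (T : R) : Prop :=
  forall t, 0 <= t <= T -> `|sg t - q| <= rho /\ is_derive t 1 sg (xi (sg t)).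

(** * Dependence of trajectories on time and starting point *)

Section LocalFlow.
Context {R : realType} {n : nat}.
Variables (xi : 'rV[R]_n -> 'rV[R]_n) (q : 'rV[R]_n) (rho L M : R).
Hypotheses (L0 : 0 <= L) (rho0 : 0 < rho) (M0 : 0 <= M).
Hypothesis xiL : forall x x', `|x - q| <= rho -> `|x' - q| <= rho ->
  `|xi x - xi x'| <= L * `|x - x'|.
Hypothesis xiM : forall x, `|x - q| <= rho -> `|xi x| <= M.

Lemma ltrajW sg T T' : T' <= T -> ltraj xi q rho sg T -> ltraj xi q rho sg T'.
Proof.
by move=> TT h t /andP[t0 tT]; apply: h; rewrite t0 (le_trans tT TT).
Qed.

Lemma ltraj_speed sg T s t : ltraj xi q rho sg T -> 0 <= s -> s <= t -> t <= T ->
  `|sg t - sg s| <= (t - s) * M.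
Proof.
move=> h s0 st tT.
apply: (@derive_bound_rV R n sg (xi \o sg)) => // u /andP[su ut].
  by apply: (h u _).2; rewrite (le_trans s0 su) (le_trans ut tT).
by apply: xiM; apply: (h u _).1; rewrite (le_trans s0 su) (le_trans ut tT).
Qed.

(** Instead of Gronwall's inequality: at a time c where the distance D is maximal, D c is at most D
    0 + c * L * D c, and c * L is at most 1/2. *)
Lemma ltraj_dist sg sg' T t : L * T <= 2^-1 ->
  ltraj xi q rho sg T -> ltraj xi q rho sg' T -> 0 <= t <= T ->
  `|sg t - sg' t| <= 2 * `|sg 0 - sg' 0|.
Proof using L0 xiL.
move=> LT h h' tT.
have T0 : 0 <= T by move: tT => /andP[]; apply: le_trans.
pose D u := `|sg u - sg' u|.
have cD : {within `[0, T], continuous D}.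
  have cg f : ltraj xi q rho f T -> {within `[0, T], continuous f}.
    move=> hf; apply: derivable_within_continuous => x; rewrite in_itv/= => xT.
    by have [_ []] := hf _ xT.
  by move=> x; apply: cvg_norm; apply: cvgB; [exact: cg|exact: cg].
have [c cT hc] := EVT_max T0 cD.
have {}cT : 0 <= c <= T by move: cT; rewrite in_itv.
have hc' : D t <= D c by apply: hc; rewrite in_itv.
apply: le_trans hc' _.
have /andP[c0 cT'] := cT.
have := @derive_bound_rV R n (sg - sg') (fun u => xi (sg u) - xi (sg' u)) 0 c (L * D c) c0.
rewrite subr0 => hb.
have {}hb : `|(sg - sg') c - (sg - sg') 0| <= c * (L * D c).
  apply: hb.
  - exact: mulr_ge0 L0 (normr_ge0 _).
  - move=> u /andP[u0 uc].
    by apply: is_deriveB; [apply: (h _ _).2|apply: (h' _ _).2];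
      rewrite u0 (le_trans uc cT').
  - move=> u /andP[u0 uc].
    have uT : 0 <= u <= T by rewrite u0 (le_trans uc cT').
    apply: le_trans (xiL _ _ (h _ uT).1 (h' _ uT).1) _.
    by rewrite ler_wpM2l//; apply: hc; rewrite in_itv.
have : D c <= D 0 + c * (L * D c).
  have e : D c = `|(sg - sg') c - (sg - sg') 0 + (sg 0 - sg' 0)|.
    by rewrite !fctE subrK.
  rewrite [leLHS]e [leRHS]addrC; apply: le_trans (ler_normD _ _) _.
  exact: lerD hb (lexx _).
have : c * (L * D c) <= 2^-1 * D c.
  rewrite mulrA ler_wpM2r ?normr_ge0//.
  by apply: (le_trans _ LT); rewrite mulrC ler_wpM2l.
rewrite /D; lra.
Qed.

Lemma ltraj_unique sg sg' T t : L * T <= 2^-1 ->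
  ltraj xi q rho sg T -> ltraj xi q rho sg' T -> sg 0 = sg' 0 -> 0 <= t <= T ->
  sg t = sg' t.
Proof using L0 xiL.
move=> LT h h' s0 tT; have := ltraj_dist sg sg' T t LT h h' tT.
by rewrite s0 subrr normr0 mulr0 normr_le0 subr_eq0 => /eqP.
Qed.

(** The difference of two trajectories has derivative close to A applied to the difference itself,
    with error 2k by [hA] and [ltraj_dist]; replacing that difference by its initial value costs 2 a
    L t, since it drifts at rate at most 2 L times its initial size. *)
Lemma ltraj_linear (A : {linear 'rV[R]_n -> 'rV[R]_n}) (a k : R) sg sg' T t :
  0 <= a -> 0 <= k -> (forall x, `|A x| <= a * `|x|) ->
  (forall x x', `|x - q| <= rho -> `|x' - q| <= rho ->
    `|xi x - xi x' - A (x - x')| <= k * `|x - x'|) ->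
  L * T <= 2^-1 ->
  ltraj xi q rho sg T -> ltraj xi q rho sg' T -> 0 <= t <= T ->
  `|sg t - sg' t - (sg 0 - sg' 0) - t *: A (sg 0 - sg' 0)| <=
    t * ((2 * k + 2 * a * L * t) * `|sg 0 - sg' 0|).
Proof using L0 xiL.
move=> a0 k0 Aa hA LT h h' /andP[t0 tT].
have hd u : 0 <= u <= t -> `|sg u - sg' u| <= 2 * `|sg 0 - sg' 0|.
  move=> /andP[u0 ut]; apply: (ltraj_dist _ _ T) => //.
  by rewrite u0 (le_trans ut tT).
have hD u : 0 <= u <= t -> is_derive u 1 (sg - sg') (xi (sg u) - xi (sg' u)).
  move=> /andP[u0 ut].
  by apply: is_deriveB; [apply: (h _ _).2|apply: (h' _ _).2];
    rewrite u0 (le_trans ut tT).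
have hB u : 0 <= u <= t -> `|(sg u - sg' u) - (sg 0 - sg' 0)| <= u * (L * (2 * `|sg 0 - sg' 0|)).
  move=> /andP[u0 ut].
  have := @derive_bound_rV R n (sg - sg') (fun u => xi (sg u) - xi (sg' u)) 0 u
    (L * (2 * `|sg 0 - sg' 0|)) u0.
  rewrite !fctE subr0; apply; first by rewrite !mulr_ge0.
  - by move=> v /andP[v0 vu]; apply: hD; rewrite v0 (le_trans vu ut).
  - move=> v /andP[v0 vu].
    have vt : 0 <= v <= t by rewrite v0 (le_trans vu ut).
    have vT : 0 <= v <= T by rewrite v0 (le_trans (le_trans vu ut) tT).
    apply: le_trans (xiL _ _ (h _ vT).1 (h' _ vT).1) _.
    by rewrite ler_wpM2l// hd.
have := @mvt_rV R n (sg - sg') (fun u => xi (sg u) - xi (sg' u)) 0 t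
  (A (sg 0 - sg' 0)) ((2 * k + 2 * a * L * t) * `|sg 0 - sg' 0|) t0.
rewrite !fctE subr0; apply.
- by rewrite mulr_ge0// addr_ge0 ?mulr_ge0.
- move=> u /[dup] ut /andP[u0 ut'].
  have uT : 0 <= u <= T by rewrite u0 (le_trans ut' tT).
  have h1 := hA _ _ (h _ uT).1 (h' _ uT).1.
  have h2 := Aa ((sg u - sg' u) - (sg 0 - sg' 0)).
  have -> : xi (sg u) - xi (sg' u) - A (sg 0 - sg' 0) =
    (xi (sg u) - xi (sg' u) - A (sg u - sg' u)) + A ((sg u - sg' u) - (sg 0 - sg' 0)).
    by rewrite [A (sg u - sg' u - _)]linearB addrA subrK.
  apply: le_trans (ler_normD _ _) _.
  apply: le_trans (lerD h1 h2) _.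
  have h3 := hd _ ut; have h4 := hB _ ut.
  rewrite mulrDl; apply: lerD.
    have -> : 2 * k * `|sg 0 - sg' 0| = k * (2 * `|sg 0 - sg' 0|) by ring.
    by rewrite ler_wpM2l.
  apply: le_trans (ler_wpM2l a0 h4) _.
  have -> : 2 * a * L * t * `|sg 0 - sg' 0| = a * (t * (L * (2 * `|sg 0 - sg' 0|))) by ring.
  by rewrite ler_wpM2l// ler_wpM2r// !mulr_ge0.
Qed.

Lemma ltraj_taylor sg T t : ltraj xi q rho sg T -> 0 <= t <= T ->
  `|sg t - sg 0 - t *: xi (sg 0)| <= t * (L * (t * M)).
Proof.
move=> h /andP[t0 tT].
have := @mvt_rV R n sg (xi \o sg) 0 t (xi (sg 0)) (L * (t * M)) t0.
rewrite subr0; apply; first by rewrite !mulr_ge0.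
- by move=> u /andP[u0 ut]; apply: (h _ _).2; rewrite u0 (le_trans ut tT).
- move=> u /andP[u0 ut].
  have uT : 0 <= u <= T by rewrite u0 (le_trans ut tT).
  have T0 : 0 <= T by apply: le_trans t0 tT.
  have zT : 0 <= (0 : R) <= T by rewrite lexx T0.
  apply: le_trans (xiL _ _ (h _ uT).1 (h _ zT).1) _.
  rewrite ler_wpM2l//; have := ltraj_speed sg T 0 u h (lexx _) u0 (le_trans ut tT).
  by rewrite subr0 => hh; apply: le_trans hh _; rewrite ler_wpM2r.
Qed.

Lemma local_flow (T : R) : 0 <= T -> L * T <= 2^-1 -> M * T <= rho / 2 ->
  exists Phi : R -> 'rV[R]_n -> 'rV[R]_n, forall y, `|y - q| <= rho / 2 ->
    Phi 0 y = y /\ ltraj xi q rho (Phi ^~ y) T.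
Proof.
move=> T0 LT MT.
have r2 : 0 <= rho by exact: ltW.
(* Composing with the retraction onto the ball makes the field globally Lipschitz. *)
pose c (x : 'rV[R]_n) := \row_j Num.max (q ord0 j - rho) (Num.min (q ord0 j + rho) (x ord0 j)).
have cB x : `|c x - q| <= rho.
  by apply/rV_norm_le => // j; rewrite !mxE; apply: clamp_dist.
have cid x : `|x - q| <= rho -> c x = x.
  move=> h; apply/rowP => j; have := (rV_norm_le _ _ r2).1 h j.
  by rewrite !mxE; apply: clamp_id.
have cL x x' : `|c x - c x'| <= `|x - x'|.
  apply/rV_norm_le => // j; have := rV_norm_coord (x - x') j.
  by rewrite !mxE; apply: le_trans; apply: clamp_lipschitz.
have FL x x' : `|xi (c x) - xi (c x')| <= L * `|x - x'|.
  apply: le_trans (xiL _ _ (cB _) (cB _)) _.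
  by rewrite ler_wpM2l.
have /choice[Phi hPhi] : forall y, exists sg : R -> 'rV[R]_n, sg 0 = y /\
    forall t, 0 <= t <= T -> is_derive t 1 sg (xi (c (sg t))).
  by move=> y; have [sg s0 hs] := picard (xi \o c) L T y L0 FL T0 LT; exists sg.
exists (fun t y => Phi y t) => y yq; have [P0 dP] := hPhi y.
split=> // t /[dup] tT /andP[t0 tT'].
have h : `|Phi y t - q| <= rho.
  have := @derive_bound_rV R n (Phi y) (fun u => xi (c (Phi y u))) 0 t M t0 M0.
  rewrite P0 subr0 => hb.
  have {}hb : `|Phi y t - y| <= t * M.
    apply: hb; last by move=> u _; apply: xiM.
    by move=> u /andP[u0 ut]; apply: dP; rewrite u0 (le_trans ut tT').
  have : t * M <= rho / 2.
    by apply: le_trans MT; rewrite mulrC ler_wpM2l.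
  rewrite -(subrKA y) => h; apply: le_trans (ler_normD _ _) _; lra.
split=> //.
by have := dP _ tT; rewrite cid.
Qed.

End LocalFlow.

Lemma ltraj_rev {R : realType} {n : nat} (xi : 'rV[R]_n -> 'rV[R]_n) q rho sg T :
  ltraj xi q rho sg T -> ltraj (fun x => - xi x) q rho (fun t => sg (T - t)) T.
Proof.
move=> h t /andP[t0 tT].
have hT : 0 <= T - t <= T by apply/andP; split; lra.
have [h1 h2] := h _ hT; split=> //.
apply: is_derive_rV => j.
have h3 := is_derive_coord _ _ _ j h2.
have hB : is_derive t 1 (fun u : R => T - u) (-1).
  have := @is_deriveB R R R (cst T) id t 1 0 1 _ _.
  by rewrite sub0r; apply.
have := @is_derive1_comp R (fun u => sg u ord0 j) (fun u => T - u) t _ _ h3 hB.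
by rewrite mulrN1 mxE.
Qed.

Lemma local_flow_inverse {R : realType} {n : nat} (xi : 'rV[R]_n -> 'rV[R]_n) q rho L sg sg' T :
  0 <= L -> (forall x x', `|x - q| <= rho -> `|x' - q| <= rho ->
    `|xi x - xi x'| <= L * `|x - x'|) -> 0 <= T -> L * T <= 2^-1 ->
  ltraj xi q rho sg T -> ltraj (fun x => - xi x) q rho sg' T -> sg' 0 = sg T ->
  sg' T = sg 0.
Proof.
move=> L0 xL T0 LT h h' e.
have xL' x x' : `|x - q| <= rho -> `|x' - q| <= rho ->
    `|- xi x - - xi x'| <= L * `|x - x'|.
  by move=> hx hx'; rewrite -opprD normrN; apply: xL.
have := ltraj_unique _ _ _ _ L0 xL' sg' (fun t => sg (T - t)) T T LT h' (ltraj_rev _ _ _ _ _ h).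
by rewrite subr0 subrr; apply => //; rewrite T0 lexx.
Qed.

(** * Differentiable maps *)

Lemma zmod_product_rule (V : zmodType) (p q r s t w : V) :
  p - t - (s + w) = p - q - r + (r - s) + (q - t - w).
Proof.
rewrite [p - q - r + _]addrA subrK (addrAC p (- q)) -[RHS]addrA !(addrA (- q)) addNr.
by rewrite add0r opprD !addrA (addrAC p (- t)).
Qed.

Lemma zmod_second_difference (V : zmodType) (u v w b c : V) :
  u - v - b = u - w - (b + c) - (v - w - c).
Proof.
rewrite [v - w - c]addrAC !opprB opprD !addrA.
by rewrite (addrAC _ w c) subrK (addrAC (u - w) (- b) w) subrK addrAC.
Qed.

Section Differentials.
Context {R : realType}.
Implicit Types V W Z : normedModType R.

Lemma diff_eps V W (f : V -> W) (x : V) : differentiable f x ->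
  forall e : R, 0 < e -> exists2 d : R, 0 < d & forall y, `|y - x| < d ->
    `|f y - f x - 'd f x (y - x)| <= e * `|y - x|.
Proof.
move=> /diff_locally/eqaddoP h e e0.
have /nbhs_eps[d d0 hd] := h e e0.
exists d => // y yx; have := hd (y - x); rewrite subr0 => /(_ yx).
by rewrite /= !fctE /= subrK opprD addrA.
Qed.

Lemma eps_diff V W (f : V -> W) (A : {linear V -> W}) (x : V) : continuous A ->
  (forall e : R, 0 < e -> exists2 d : R, 0 < d & forall y, `|y - x| < d ->
    `|f y - f x - A (y - x)| <= e * `|y - x|) ->
  differentiable f x /\ 'd f x = A :> (V -> W).
Proof.
move=> cA h.
have e : f \o shift x = cst (f x) + A +o_ 0 id.
  apply/eqaddoP => e e0; have [d d0 hd] := h e e0.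
  apply/nbhs_eps; exists d => // y; rewrite subr0 => yd.
  have := hd (y + x); rewrite addrK => /(_ yd).
  by rewrite /= !fctE /= opprD addrA.
have dE := diff_unique cA e.
by split => //; apply/diff_locallyP; rewrite dE.
Qed.

Lemma near_eq_diff V W (f g : V -> W) (x : V) : (\forall y \near x, f y = g y) ->
  differentiable f x -> differentiable g x /\ 'd g x = 'd f x :> (V -> W).
Proof.
move=> /nbhs_eps[r r0 fg] df.
apply: eps_diff; first exact: diff_continuous.
move=> e e0; have [d d0 hd] := diff_eps V W f x df e e0.
exists (Num.min r d); first by rewrite lt_min r0.
move=> y; rewrite lt_min => /andP[yr yd].
by rewrite -(fg y)// -(fg x) ?subrr ?normr0//; apply: hd.
Qed.

Lemma diff_bound V W (f : V -> W) (x : V) : differentiable f x ->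
  exists2 k : R, 0 < k & forall v, `|'d f x v| <= k * `|v|.
Proof.
by move=> df; have [k k0 hk] := linear_lipschitz (diff_continuous df); exists k.
Qed.

Lemma diffDE V W (f g : V -> W) (x v : V) : differentiable f x ->
  differentiable g x -> 'd (fun y => f y + g y) x v = 'd f x v + 'd g x v.
Proof. by move=> df dg; rewrite (diffD df dg). Qed.

Lemma diff_scale V W (a : V -> R) (f : V -> W) (x : V) :
  differentiable a x -> differentiable f x ->
  differentiable (fun y => a y *: f y) x /\
  forall v, 'd (fun y => a y *: f y) x v = a x *: 'd f x v + 'd a x v *: f x.
Proof.
move=> da df.
have [ka ka0 hka] := diff_bound _ _ a x da.
have [kf kf0 hkf] := diff_bound _ _ f x df.
pose A v := a x *: 'd f x v + 'd a x v *: f x.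
have linA : linear A.
  move=> k u v; rewrite /A.
  have -> : 'd f x (k *: u + v) = k *: 'd f x u + 'd f x v by exact: linearP.
  have -> : 'd a x (k *: u + v) = k * 'd a x u + 'd a x v by exact: linearP.
  by rewrite !scalerDr scalerDl !scalerA (mulrC (a x)) addrACA.
pose Al : {linear V -> W} := HB.pack A (GRing.isLinear.Build R V W *:%R A linA).
have bndA v : `|A v| <= (`|a x| * kf + ka * `|f x|) * `|v|.
  rewrite mulrDl; apply: le_trans (ler_normD _ _) _; rewrite !normrZ.
  apply: lerD; first by rewrite -mulrA ler_wpM2l.
  by rewrite mulrAC ler_wpM2r.
have cA : continuous Al.
  move=> v; apply/continuous_eps => e e0.
  have k1 : 0 < `|a x| * kf + ka * `|f x| + 1.
    by rewrite ltr_wpDl// addr_ge0// mulr_ge0// ltW.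
  exists (e / (`|a x| * kf + ka * `|f x| + 1)); first by rewrite divr_gt0.
  move=> y; rewrite ltr_pdivlMr// => hy; rewrite -linearB.
  apply: le_lt_trans (bndA _) _; apply: le_lt_trans hy.
  by rewrite mulrC ler_wpM2l// lerDl.
suff [] : differentiable (fun y => a y *: f y) x /\ 'd (fun y => a y *: f y) x = Al :> (V -> W).
  by move=> ? ->.
apply: eps_diff => // e e0.
(* For increments of norm at most 1, C dominates both [|a y|] and [|f x|]. Each of the three terms
   of the product rule receives e / 3; the product of the two increments is quadratic in the
   displacement and fixes the second radius. *)
pose C : R := `|a x| + ka + 1 + `|f x|.
have na := normr_ge0 (a x); have nf := normr_ge0 (f x).
have C0 : 0 < C by rewrite /C; lra.
pose e1 := Num.min 1 (e / (3 * C)).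
have e10 : 0 < e1 by rewrite lt_min ltr01 divr_gt0// mulr_gt0.
have [d1 d10 hd1] := diff_eps _ _ a x da _ e10.
have [d2 d20 hd2] := diff_eps _ _ f x df _ e10.
have e1C : e1 * C <= e / 3.
  have : e1 <= e / (3 * C) by rewrite /e1 ge_min lexx orbT.
  rewrite ler_pdivlMr ?mulr_gt0//; lra.
have e11 : e1 <= 1 by rewrite /e1 ge_min lexx.
have d30 : 0 < e / (3 * ((ka + 1) * kf)) by rewrite divr_gt0// !mulr_gt0// ltr_wpDl// ltW.
exists (Num.min 1 (Num.min (e / (3 * ((ka + 1) * kf))) (Num.min d1 d2))).
  by rewrite !lt_min ltr01 d30 d10.
move=> y; rewrite !lt_min => /and4P[y1 y3 yd1 yd2].
set h := y - x in y1 y3 yd1 yd2 *.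
have E1 := hd1 _ yd1; have E2 := hd2 _ yd2; rewrite -/h in E1 E2.
have B1 : `|a y - a x| <= (ka + 1) * `|h|.
  rewrite -(subrK ('d a x h) (a y - a x)); apply: le_trans (ler_normD _ _) _.
  rewrite mulrDl mul1r addrC; apply: lerD; first exact: hka.
  by apply: le_trans E1 _; rewrite ler_piMl.
have -> : a y *: f y - a x *: f x - Al h = a y *: (f y - f x - 'd f x h)
    + (a y - a x) *: 'd f x h + (a y - a x - 'd a x h) *: f x.
  rewrite /= /A !scalerBl !scalerBr.
  exact: zmod_product_rule.
have ay : `|a y| <= `|a x| + (ka + 1).
  rewrite -(subrK (a x) (a y)); apply: le_trans (ler_normD _ _) _.
  rewrite addrC lerD2l; apply: le_trans B1 _.
  by rewrite ler_piMr// ?ltW// ltr_wpDl// ltW.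
apply: le_trans (ler_normD _ _) _; apply: le_trans (lerD (ler_normD _ _) (lexx _)) _.
rewrite !normrZ.
have T1 : `|a y| * `|f y - f x - 'd f x h| <= e / 3 * `|h|.
  apply: le_trans (ler_pM _ _ ay E2) _ => //.
  rewrite mulrA ler_wpM2r//; apply: le_trans e1C.
  rewrite [leLHS]mulrC; apply: ler_wpM2l; [exact: ltW|rewrite /C; lra].
have T2 : `|a y - a x| * `|'d f x h| <= e / 3 * `|h|.
  apply: le_trans (ler_pM _ _ B1 (hkf _)) _ => //.
  have -> : (ka + 1) * `|h| * (kf * `|h|) = ((ka + 1) * kf * `|h|) * `|h| by ring.
  rewrite ler_wpM2r//.
  have K0 : 0 < (ka + 1) * kf by rewrite mulr_gt0// ltr_wpDl// ltW.
  have y3' : `|h| * (3 * ((ka + 1) * kf)) < e by rewrite -ltr_pdivlMr// mulr_gt0.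
  clear -y3'; lra.
have T3 : `|a y - a x - 'd a x h| * `|f x| <= e / 3 * `|h|.
  apply: le_trans (ler_wpM2r _ E1) _ => //.
  rewrite mulrAC ler_wpM2r//; apply: le_trans e1C.
  by apply: ler_wpM2l; [exact: ltW|rewrite /C; lra].
clear -T1 T2 T3; lra.
Qed.

Lemma diff_sum m V W (f : 'I_m -> V -> W) (x : V) :
  (forall i, differentiable (f i) x) ->
  differentiable (fun y => \sum_(i < m) f i y) x /\
  forall v, 'd (fun y => \sum_(i < m) f i y) x v = \sum_(i < m) 'd (f i) x v.
Proof.
elim: m f => [|m IH] f df.
  have -> : (fun y => \sum_(i < 0) f i y) = cst 0.
    by apply/funext => y; rewrite big_ord0.
  by split => [|v]; [exact: differentiable_cst|rewrite diff_cst big_ord0].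
have [dS ES] := IH (fun i => f (lift ord0 i)) (fun i => df _).
have -> : (fun y => \sum_(i < m.+1) f i y) =
    f ord0 + (fun y => \sum_(i < m) f (lift ord0 i) y).
  by apply/funext => y; rewrite big_ord_recl.
split=> [|v]; first exact: differentiableD.
by rewrite big_ord_recl -ES; apply: diffDE.
Qed.

Lemma diff_linear_comp V W Z (A : {linear W -> Z}) (f : V -> W) (x : V) :
  continuous A -> differentiable f x ->
  differentiable (fun y => A (f y)) x /\
  forall v, 'd (fun y => A (f y)) x v = A ('d f x v).
Proof.
move=> cA df; have dA : differentiable A (f x) by exact: linear_differentiable.
split=> [|v]; first exact: (differentiable_comp df dA).
by rewrite (diff_comp df dA)/= diff_lin.
Qed.

End Differentials.

(** * Functions of class C^k *)

Section CkOn.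
Context {R : realType}.
Implicit Types V W Z : normedModType R.

Lemma Ck_on_ext V W k (U : set V) (f g : V -> W) : open U ->
  (forall x, U x -> f x = g x) -> Ck_on k U f -> Ck_on k U g.
Proof.
move=> oU; elim: k f g => [|k IH] f g fg /=.
  move=> cf x Ux; have := cf x Ux => /continuous_eps h.
  apply/continuous_eps => e e0; have [d d0 hd] := h e e0.
  have [r r0 hr] := open_eps _ _ _ oU Ux.
  exists (Num.min d r); first by rewrite lt_min d0.
  by move=> y; rewrite lt_min => /andP[yd yr]; rewrite -!fg//; [apply: hd|apply: hr].
have near x : U x -> \forall y \near x, f y = g y.
  move=> Ux; apply/nbhs_eps; have [r r0 hr] := open_eps _ _ _ oU Ux.
  by exists r => // y yr; apply: fg; apply: hr.
move=> [df hf]; split=> [x Ux|v].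
  exact: (near_eq_diff _ _ f g x (near x Ux) (df x Ux)).1.
apply: IH (hf v) => x Ux.
by rewrite (near_eq_diff _ _ f g x (near x Ux) (df x Ux)).2.
Qed.

Lemma Ck_on_sub V W k (U U' : set V) (f : V -> W) : U' `<=` U ->
  Ck_on k U f -> Ck_on k U' f.
Proof.
move=> s; elim: k f => [|k IH] f /=; first by move=> h x /s; apply: h.
by move=> [df hf]; split=> [x /s|v]; [apply: df|apply: IH].
Qed.

Lemma Ck_onS V W k (U : set V) (f : V -> W) : Ck_on k.+1 U f -> Ck_on k U f.
Proof.
elim: k f => [|k IH] f /= [df hf].
  by move=> x Ux; apply: differentiable_continuous; exact: df.
by split=> // v; apply: IH; apply: hf.
Qed.

Lemma Ck_on_cst V W k (U : set V) (c : W) : Ck_on k U (cst c : V -> W).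
Proof.
elim: k c => [|k IH] c /=; first by move=> x _; exact: cvg_cst.
split=> [x _|v]; first exact: differentiable_cst.
have -> : (fun x => 'd (cst c : V -> W) x v) = cst 0.
  by apply/funext => x; rewrite diff_cst.
exact: IH.
Qed.

Lemma Ck_onD V W k (U : set V) (f g : V -> W) : open U ->
  Ck_on k U f -> Ck_on k U g -> Ck_on k U (fun x => f x + g x).
Proof.
move=> oU; elim: k f g => [|k IH] f g /=.
  by move=> cf cg x Ux; apply: cvgD; [apply: cf|apply: cg].
move=> [df hf] [dg hg]; split=> [x Ux|v].
  exact: differentiableD (df x Ux) (dg x Ux).
apply: Ck_on_ext (IH _ _ (hf v) (hg v)) => // x Ux.
by rewrite diffDE//; [apply: df|apply: dg].
Qed.

Lemma Ck_on_linear V W Z k (U : set V) (A : {linear W -> Z}) (f : V -> W) : open U ->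
  continuous A -> Ck_on k U f -> Ck_on k U (fun x => A (f x)).
Proof.
move=> oU cA; elim: k f => [|k IH] f /=.
  move=> cf x Ux; apply: (@continuous_comp _ _ _ f A); first exact: cf.
  exact: cA.
move=> [df hf]; split=> [x Ux|v].
  exact: (diff_linear_comp _ _ _ A f x cA (df x Ux)).1.
apply: Ck_on_ext (IH _ (hf v)) => // x Ux.
by rewrite (diff_linear_comp _ _ _ A f x cA (df x Ux)).2.
Qed.

Lemma Ck_on_scale V W k (U : set V) (a : V -> R) (f : V -> W) : open U ->
  Ck_on k U a -> Ck_on k U f -> Ck_on k U (fun x => a x *: f x).
Proof.
move=> oU; elim: k a f => [|k IH] a f.
  by move=> ca cf x Ux; apply: cvgZ; [apply: ca|apply: cf].
move=> Ca Cf; have ca := Ck_onS _ _ _ _ _ Ca; have cf := Ck_onS _ _ _ _ _ Cf.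
move: Ca Cf => /= [da ha] [df hf]; split=> [x Ux|v].
  exact: (diff_scale _ _ a f x (da x Ux) (df x Ux)).1.
have := Ck_onD _ _ _ _ _ _ oU (IH _ _ ca (hf v)) (IH _ _ (ha v) cf).
apply: Ck_on_ext => // x Ux.
by rewrite (diff_scale _ _ a f x (da x Ux) (df x Ux)).2.
Qed.

Lemma Ck_on_sum V W k m (U : set V) (f : 'I_m -> V -> W) : open U ->
  (forall i, Ck_on k U (f i)) -> Ck_on k U (fun x => \sum_(i < m) f i x).
Proof.
move=> oU; elim: m f => [|m IH] f hf.
  have -> : (fun y => \sum_(i < 0) f i y) = cst 0.
    by apply/funext => y; rewrite big_ord0.
  exact: Ck_on_cst.
have -> : (fun y => \sum_(i < m.+1) f i y) =
    (fun y => f ord0 y + (\sum_(i < m) f (lift ord0 i) y)).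
  by apply/funext => y; rewrite big_ord_recl.
by apply: Ck_onD => //; apply: IH.
Qed.

Lemma smooth_on_differentiable V W (U : set V) (f : V -> W) x :
  smooth_on U f -> U x -> differentiable f x.
Proof. by move=> /(_ 1%N)/= [h _]; apply: h. Qed.

End CkOn.

(** * Strict differentiability and symmetry of second derivatives *)

Section RowVectorCalculus.
Context {R : realType} {n m : nat}.
Implicit Types (U : set 'rV[R]_n) (f : 'rV[R]_n -> 'rV[R]_m).

Lemma rV_basis (v : 'rV[R]_n) : v = \sum_(j < n) v ord0 j *: delta_mx ord0 j.
Proof. exact: row_sum_delta. Qed.

Lemma linear_basis (W : lmodType R) (A : {linear 'rV[R]_n -> W}) v :
  A v = \sum_(j < n) v ord0 j *: A (delta_mx ord0 j).
Proof.
by rewrite {1}[v]rV_basis linear_sum; apply: eq_bigr => j _; rewrite linearZ.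
Qed.

(** Closeness on the basis vectors adds up over n coordinates; dividing by [n.+1] covers n = 0 as
    well. *)
Lemma linear_close (W : normedModType R) (A B : {linear 'rV[R]_n -> W}) (k : R) :
  0 <= k -> (forall j, `|A (delta_mx ord0 j) - B (delta_mx ord0 j)| <= k / n.+1%:R) ->
  forall v, `|A v - B v| <= k * `|v|.
Proof.
move=> k0 h v; rewrite (linear_basis _ A) (linear_basis _ B) -sumrB.
apply: le_trans (ler_norm_sum _ _ _) _.
apply: (@le_trans _ _ (\sum_(j < n) k / n.+1%:R * `|v|)).
  apply: ler_sum => j _; rewrite -scalerBr normrZ mulrC.
  by apply: ler_pM => //; apply: rV_norm_coord.
rewrite sumr_const card_ord -[leLHS]mulr_natl mulrA ler_wpM2r// mulrCA ler_piMr//.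
by rewrite ler_pdivrMr// mul1r ler_nat.
Qed.

Lemma linear_shift (A : {linear 'rV[R]_n -> 'rV[R]_m}) (x a b : 'rV[R]_n) (s t : R) :
  A (x + s *: b + t *: a - x) = s *: A b + A (x + t *: a - x).
Proof.
rewrite -linearZ -linearD; congr (A _); apply/rowP => j; rewrite !mxE; ring.
Qed.

Lemma segment_derive (x v : 'rV[R]_n) f (t : R) : differentiable f (x + t *: v) ->
  is_derive t 1 (fun s : R => f (x + s *: v)) ('d f (x + t *: v) v).
Proof.
move=> df.
have dl : is_diff t (fun s : R => x + s *: v) (fun s : R => s *: v).
  have := @is_diffD R R 'rV[R]_n (cst x) ( *:%R^~ v) 0 ( *:%R^~ v) t _ _.
  by rewrite add0r; apply.
have [dl1 dl2] := dl.
have dc := @differentiable_comp _ _ _ _ (fun s : R => x + s *: v) f t dl1 df.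
apply: DeriveDef; first exact/derivable1_diffP.
by rewrite deriveE// (@diff_comp _ _ _ _ (fun s : R => x + s *: v) f t dl1 df)/= dl2/= scale1r.
Qed.

(** The mean value inequality on the segment from y' to y, along which the differential stays within
    k of its value at x because the partial derivatives are continuous. *)
Lemma strict_diff U f x : open U -> Ck_on 1 U f -> U x ->
  forall k : R, 0 < k -> exists2 d : R, 0 < d & forall y y',
    `|y - x| < d -> `|y' - x| < d ->
    `|f y - f y' - 'd f x (y - y')| <= k * `|y - y'|.
Proof.
move=> oU [df cf] Ux k k0.
have [r r0 hr] := open_eps _ _ _ oU Ux.
have kn : 0 < k / n.+1%:R by rewrite divr_gt0.
have /choice[d hd] : forall j : 'I_n, exists d : R, 0 < d /\ forall y, `|y - x| < d ->
    `|'d f y (delta_mx ord0 j) - 'd f x (delta_mx ord0 j)| < k / n.+1%:R.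
  move=> j; have := cf (delta_mx ord0 j) x Ux => /continuous_eps/(_ _ kn)[d d0 h].
  by exists d.
pose D := \big[Num.min/r]_j d j.
have D0 : 0 < D by rewrite /D; apply: lt_bigmin => // j _; exact: (hd j).1.
exists D => // y y' yD yD'.
have seg t : 0 <= t <= 1 -> `|y' + t *: (y - y') - x| < D.
  move=> /andP[t0 t1].
  have -> : y' + t *: (y - y') - x = (1 - t) *: (y' - x) + t *: (y - x).
    apply/rowP => j; rewrite !mxE; ring.
  apply: le_lt_trans (ler_normD _ _) _; rewrite !normrZ !ger0_norm ?subr_ge0//.
  have [->|tn0] := eqVneq t 0; first by rewrite subr0 mul1r mul0r addr0.
  have tp : 0 < t by rewrite lt_def tn0.
  have : t * `|y - x| < t * D by rewrite ltr_pM2l.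
  have : (1 - t) * `|y' - x| <= (1 - t) * D by rewrite ler_wpM2l ?subr_ge0// ltW.
  lra.
have := @mvt_rV R m (fun t => f (y' + t *: (y - y'))) (fun t => 'd f (y' + t *: (y - y')) (y - y'))
  0 1 ('d f x (y - y')) (k * `|y - y'|) ler01.
rewrite subr0 !scale1r scale0r addr0 !mul1r (addrC y') subrK; apply.
- by rewrite mulr_ge0// ltW.
- move=> t t01; apply: segment_derive; apply: df; apply: hr.
  by apply: lt_le_trans (seg t t01) _; exact: bigmin_le_id.
- move=> t t01; apply: linear_close; first exact: ltW.
  move=> j; apply/ltW; apply: (hd j).2.
  by apply: lt_le_trans (seg t t01) _; exact: bigmin_le.
Qed.

(** The mean value inequality in t for f (x + s b + t a) - f (x + t a). Its derivative G (x + s b +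
    t a) - G (x + t a) is s A b up to the first-order error of G at x, so only the derivative in the
    direction a has to be differentiated. *)
Lemma second_difference f (G : 'rV[R]_n -> 'rV[R]_m) (A : {linear 'rV[R]_n -> 'rV[R]_m})
    (x a b : 'rV[R]_n) (d k s : R) : 0 < d -> 0 <= k -> 0 < s ->
  s * (1 + `|a| + `|b|) < d ->
  (forall y, `|y - x| < d -> differentiable f y) ->
  (forall y, `|y - x| < d -> 'd f y a = G y) ->
  (forall y, `|y - x| < d -> `|G y - G x - A (y - x)| <= k * `|y - x|) ->
  `|f (x + s *: a + s *: b) - f (x + s *: a) - f (x + s *: b) + f x
      - (s ^+ 2) *: A b| <= s ^+ 2 * (k * (2 * `|a| + `|b|)).
Proof.
move=> d0 k0 s0 sD df dG hd.
have sm t t' : 0 <= t <= s -> 0 <= t' <= s -> `|x + t *: a + t' *: b - x| < d.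
  move=> /andP[t0 ts] /andP[t0' ts'].
  rewrite addrC !addrA addNr add0r; apply: le_lt_trans (ler_normD _ _) _.
  rewrite !normrZ !ger0_norm//; apply: le_lt_trans sD.
  have : t * `|a| <= s * `|a| by rewrite ler_wpM2r.
  have : t' * `|b| <= s * `|b| by rewrite ler_wpM2r.
  lra.
have hs : 0 <= s <= s by rewrite lexx ltW.
have h0 : 0 <= (0 : R) <= s by rewrite lexx ltW.
have sm2 t : 0 <= t <= s -> `|x + t *: a - x| < d.
  by move=> ht; have := sm _ _ ht h0; rewrite scale0r addr0.
have sm3 t : 0 <= t <= s -> `|x + s *: b + t *: a - x| < d.
  by move=> ht; rewrite (addrAC x); apply: sm.
have := @mvt_rV R m (fun t => f ((x + s *: b) + t *: a) - f (x + t *: a))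
  (fun t => G ((x + s *: b) + t *: a) - G (x + t *: a)) 0 s
  (s *: A b) (s * (k * (2 * `|a| + `|b|))) (ltW s0).
rewrite !subr0 !scale0r !addr0 scalerA -expr2.
have -> : f (x + s *: b + s *: a) - f (x + s *: a) - (f (x + s *: b) - f x) =
   f (x + s *: a + s *: b) - f (x + s *: a) - f (x + s *: b) + f x.
  by rewrite (addrAC x (s *: b)) opprB addrA [LHS]addrAC.
have -> : s ^+ 2 * (k * (2 * `|a| + `|b|)) = s * (s * (k * (2 * `|a| + `|b|))).
  by ring.
apply.
- by apply: mulr_ge0; [exact: ltW|rewrite mulr_ge0// addr_ge0// mulr_ge0].
- move=> t ht.
  rewrite -(dG _ (sm2 _ ht)) -(dG _ (sm3 _ ht)).
  by apply: is_deriveB; apply: segment_derive; apply: df; [exact: sm3|exact: sm2].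
- move=> t ht.
  have E1 := hd _ (sm3 _ ht); have E2 := hd _ (sm2 _ ht).
  rewrite linear_shift in E1.
  rewrite (zmod_second_difference _ _ _ (G x) _ (A (x + t *: a - x))).
  apply: le_trans (ler_normB _ _) _; apply: le_trans (lerD E1 E2) _.
  have n1 : `|x + s *: b + t *: a - x| <= s * (`|a| + `|b|).
    have -> : x + s *: b + t *: a - x = s *: b + t *: a.
      by apply/rowP => j; rewrite !mxE; ring.
    move: ht => /andP[t0 ts].
    apply: le_trans (ler_normD _ _) _; rewrite !normrZ (ger0_norm t0) (gtr0_norm s0).
    have : t * `|a| <= s * `|a| by rewrite ler_wpM2r.
    lra.
  have n2 : `|x + t *: a - x| <= s * `|a|.
    have -> : x + t *: a - x = t *: a.
      by apply/rowP => j; rewrite !mxE; ring.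
    by move: ht => /andP[t0 ts]; rewrite normrZ ger0_norm// ler_wpM2r.
  have -> : s * (k * (2 * `|a| + `|b|)) = k * (s * (`|a| + `|b|)) + k * (s * `|a|) by ring.
  by apply: lerD; rewrite ler_wpM2l.
Qed.

Lemma second_difference_limit f (G : 'rV[R]_n -> 'rV[R]_m) U (x a b : 'rV[R]_n) (k : R) :
  open U -> U x -> (forall y, U y -> differentiable f y) ->
  (forall y, 'd f y a = G y) -> differentiable G x -> 0 < k ->
  exists2 d : R, 0 < d & forall s, 0 < s < d ->
    `|f (x + s *: a + s *: b) - f (x + s *: a) - f (x + s *: b) + f x
      - (s ^+ 2) *: 'd G x b| <= s ^+ 2 * (k * (2 * `|a| + `|b|)).
Proof.
move=> oU Ux df dG ddG k0.
have [r r0 hr] := open_eps _ _ _ oU Ux.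
have [d d0 hd] := diff_eps _ _ G x ddG k k0.
have C0 : 0 < 1 + `|a| + `|b| by rewrite -addrA ltr_pwDl// addr_ge0.
have m0 : 0 < Num.min d r by rewrite lt_min d0.
exists (Num.min d r / (1 + `|a| + `|b|)); first by rewrite divr_gt0.
move=> s /andP[s0]; rewrite ltr_pdivlMr// => sD.
apply: (second_difference f G ('d G x) x a b (Num.min d r) k s m0 (ltW k0) s0 sD).
- by move=> y; rewrite lt_min => /andP[_ /hr]; apply: df.
- by move=> y _; exact: dG.
- by move=> y; rewrite lt_min => /andP[+ _]; apply: hd.
Qed.

Lemma eq_second_order (X : R -> 'rV[R]_m) (A B : 'rV[R]_m) (a b : R) : 0 <= a -> 0 <= b ->
  (forall k : R, 0 < k -> exists2 d : R, 0 < d & forall s, 0 < s < d ->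
    `|X s - s ^+ 2 *: A| <= s ^+ 2 * (k * a)) ->
  (forall k : R, 0 < k -> exists2 d : R, 0 < d & forall s, 0 < s < d ->
    `|X s - s ^+ 2 *: B| <= s ^+ 2 * (k * b)) -> A = B.
Proof.
move=> a0 b0 hA hB.
apply/eqP; rewrite -subr_eq0 -normr_le0; apply/ler_addgt0Pr => e e0; rewrite add0r.
have C0 : 0 < a + b + 1 by rewrite ltr_wpDl// addr_ge0.
have k0 : 0 < e / (a + b + 1) by rewrite divr_gt0.
have [d1 d10 h1] := hA _ k0.
have [d2 d20 h2] := hB _ k0.
pose s := Num.min d1 d2 / 2.
have m0 : 0 < Num.min d1 d2 by rewrite lt_min d10.
have s0 : 0 < s by rewrite divr_gt0.
have sm : s < Num.min d1 d2 by rewrite /s; lra.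
move: (sm); rewrite lt_min => /andP[sd1 sd2].
have {}h1 := h1 s; have {}h2 := h2 s.
rewrite s0 sd1 in h1; rewrite s0 sd2 in h2; have {}h1 := h1 isT; have {}h2 := h2 isT.
have : `|s ^+ 2 *: (A - B)| <= s ^+ 2 * e.
  have -> : s ^+ 2 *: (A - B) = (X s - s ^+ 2 *: B) - (X s - s ^+ 2 *: A).
    by rewrite scalerBr opprB [RHS]addrC addrA subrK.
  apply: le_trans (ler_normB _ _) _; apply: le_trans (lerD h2 h1) _.
  rewrite -mulrDr ler_wpM2l ?sqr_ge0// -mulrDr.
  apply: (@le_trans _ _ (e / (a + b + 1) * (a + b + 1))); last by rewrite divfK// gt_eqF.
  by apply: ler_wpM2l; [exact: ltW|lra].
by rewrite normrZ ger0_norm ?sqr_ge0// ler_pM2l// exprn_gt0.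
Qed.

(* Both sides are limits of the same symmetric second difference. *)
Lemma second_difference_symmetric f (G H : 'rV[R]_n -> 'rV[R]_m) U (x u v : 'rV[R]_n) :
  open U -> U x -> (forall y, U y -> differentiable f y) ->
  (forall y, 'd f y u = G y) -> (forall y, 'd f y v = H y) ->
  differentiable G x -> differentiable H x -> 'd G x v = 'd H x u.
Proof.
move=> oU Ux df dG dH ddG ddH.
apply: (eq_second_order (fun s => f (x + s *: u + s *: v) - f (x + s *: u) - f (x + s *: v) + f x)
  _ _ (2 * `|u| + `|v|) (2 * `|v| + `|u|)).
- by rewrite addr_ge0// mulr_ge0.
- by rewrite addr_ge0// mulr_ge0.
- by move=> k; apply: (second_difference_limit f G U x u v k oU Ux df dG ddG).
- move=> k k0.
  have [d d0 hd] := second_difference_limit f H U x v u k oU Ux df dH ddH k0.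
  exists d => // s sd; have := hd s sd.
  by rewrite (addrAC x (s *: v)) (addrAC (f _) (- f (x + s *: v))).
Qed.

Lemma schwarz U f x (u v : 'rV[R]_n) : open U -> Ck_on 2 U f -> U x ->
  'd (fun y => 'd f y u) x v = 'd (fun y => 'd f y v) x u.
Proof.
move=> oU [df cf] Ux.
by apply: (second_difference_symmetric f _ _ U) => //; [exact: (cf u).1|exact: (cf v).1].
Qed.

End RowVectorCalculus.

(** * Flows and approximate moves *)

Lemma mx_bound {R : realType} {n m : nat} (A : 'M[R]_(n, m)) :
  exists2 a : R, 0 <= a & forall u : 'rV[R]_n, `|u *m A| <= a * `|u|.
Proof.
exists (\sum_(i < n) `|row i A|); first exact: sumr_ge0.
move=> u; rewrite mulmx_sum_row mulr_suml; apply: le_trans (ler_norm_sum _ _ _) _.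
apply: ler_sum => i _; rewrite normrZ mulrC.
by rewrite ler_wpM2l// rV_norm_coord.
Qed.

(** Strict differentiability at q, the Jacobian A acting on row vectors from the right. Both points
    vary, as is required to compare two trajectories with each other. *)
Definition sdiff {R : realType} {n m : nat} (xi : 'rV[R]_n -> 'rV[R]_m) (q : 'rV[R]_n)
    (A : 'M[R]_(n, m)) : Prop :=
  forall k : R, 0 < k -> exists2 d : R, 0 < d & forall y y',
    `|y - q| < d -> `|y' - q| < d -> `|xi y - xi y' - (y - y') *m A| <= k * `|y - y'|.

Lemma sdiff_lipschitz {R : realType} {n m : nat} (xi : 'rV[R]_n -> 'rV[R]_m) q A :
  sdiff xi q A -> exists L : R, 0 < L /\ exists2 d : R, 0 < d & forall y y',
    `|y - q| < d -> `|y' - q| < d -> `|xi y - xi y'| <= L * `|y - y'|.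
Proof.
move=> h; have [a a0 ha] := mx_bound A.
have [d d0 hd] := h 1 ltr01.
exists (a + 1); split; first by rewrite ltr_wpDl.
exists d => // y y' yd yd'; have h1 := hd _ _ yd yd'; have h2 := ha (y - y').
rewrite -(subrK ((y - y') *m A) (xi y - xi y')); apply: le_trans (ler_normD _ _) _; lra.
Qed.

Section Flows.
Context {R : realType} {n : nat}.

(** [Psi] is the flow of the opposite field, hence inverse to [Phi] at equal times. The bound M * T
    <= rho / 8 limits each displacement to rho / 8, so that several flows can be composed near q
    without leaving the half ball of admissible starting points. *)
Definition flow_box (xi : 'rV[R]_n -> 'rV[R]_n) (q : 'rV[R]_n) (rho L M T : R)
    (Phi Psi : R -> 'rV[R]_n -> 'rV[R]_n) : Prop :=
  [/\ [/\ 0 < rho, 0 < L, 0 < M, 0 < T & L * T <= 2^-1 /\ M * T <= rho / 8],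
    forall x x', `|x - q| <= rho -> `|x' - q| <= rho -> `|xi x - xi x'| <= L * `|x - x'|,
    forall x, `|x - q| <= rho -> `|xi x| <= M,
    forall y, `|y - q| <= rho / 2 -> Phi 0 y = y /\ ltraj xi q rho (Phi ^~ y) T &
    forall y, `|y - q| <= rho / 2 -> Psi 0 y = y /\ ltraj (fun x => - xi x) q rho (Psi ^~ y) T].

Lemma flow_box_exists (xi : 'rV[R]_n -> 'rV[R]_n) (q : 'rV[R]_n) (rho L : R) :
  0 < rho -> 0 < L ->
  (forall x x', `|x - q| <= rho -> `|x' - q| <= rho -> `|xi x - xi x'| <= L * `|x - x'|) ->
  exists T Phi Psi, flow_box xi q rho L (`|xi q| + L * rho + 1) T Phi Psi.
Proof.
move=> r0 L0 xL.
pose M := `|xi q| + L * rho + 1.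
have M0 : 0 < M by rewrite /M ltr_wpDl// addr_ge0// mulr_ge0// ltW.
have xM x : `|x - q| <= rho -> `|xi x| <= M.
  move=> hx; have h := xL x q hx; rewrite subrr normr0 in h; have {}h := h (ltW r0).
  rewrite -(subrK (xi q) (xi x)); apply: le_trans (ler_normD _ _) _.
  have : L * `|x - q| <= L * rho by rewrite ler_wpM2l// ltW.
  rewrite /M; lra.
pose T := Num.min (L^-1 / 2) (M^-1 * rho / 8).
have T0 : 0 < T by rewrite lt_min !divr_gt0// ?mulr_gt0 ?invr_gt0.
have LT : L * T <= 2^-1.
  apply: (@le_trans _ _ (L * (L^-1 / 2))).
    by apply: ler_wpM2l; [exact: ltW|rewrite /T ge_min lexx].
  by rewrite mulrA divff ?gt_eqF// mul1r.
have MT : M * T <= rho / 8.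
  apply: (@le_trans _ _ (M * (M^-1 * rho / 8))).
    by apply: ler_wpM2l; [exact: ltW|rewrite /T ge_min lexx orbT].
  by rewrite !mulrA divff ?gt_eqF// mul1r.
have MT2 : M * T <= rho / 2 by apply: le_trans MT _; lra.
have [Phi hPhi] := local_flow xi q rho L M (ltW L0) r0 (ltW M0) xL xM T (ltW T0) LT MT2.
have xL' x x' : `|x - q| <= rho -> `|x' - q| <= rho -> `|- xi x - - xi x'| <= L * `|x - x'|.
  by move=> hx hx'; rewrite -opprD normrN; apply: xL.
have xM' x : `|x - q| <= rho -> `|- xi x| <= M by move=> hx; rewrite normrN; apply: xM.
have [Psi hPsi] := local_flow _ q rho L M (ltW L0) r0 (ltW M0) xL' xM' T (ltW T0) LT MT2.
by exists T, Phi, Psi; split.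
Qed.

Lemma flow_boxN xi q rho L M T Phi Psi : flow_box xi q rho L M T Phi Psi ->
  flow_box (fun x => - xi x) q rho L M T Psi Phi.
Proof.
move=> [h1 h2 h3 h4 h5]; split=> //.
- by move=> x x' hx hx'; rewrite -opprD normrN; apply: h2.
- by move=> x hx; rewrite normrN; apply: h3.
- move=> y hy; have [p1 p2] := h4 y hy; split=> // t ht.
  by rewrite opprK; apply: p2.
Qed.

Section InFlowBox.
Variables (xi : 'rV[R]_n -> 'rV[R]_n) (q : 'rV[R]_n) (rho L M T : R).
Variables (Phi Psi : R -> 'rV[R]_n -> 'rV[R]_n).
Hypothesis hB : flow_box xi q rho L M T Phi Psi.

Lemma flow_near y t : `|y - q| <= rho / 2 -> 0 <= t <= T ->
  `|Phi t y - y| <= t * M /\ `|Phi t y - y| <= rho / 8.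
Proof.
move=> hy /andP[t0 tT]; have [[r0 L0 M0 T0 [LT MT]] xL xM hP _] := hB.
have [p0 p] := hP y hy.
have := ltraj_speed xi q rho M (ltW M0) xM _ T 0 t p (lexx _) t0 tT.
rewrite p0 subr0 => h; split=> //; apply: le_trans h _; apply: le_trans MT.
by rewrite mulrC ler_wpM2l// ltW.
Qed.

Lemma flow_inv y t : `|y - q| <= rho / 4 -> 0 <= t <= T -> Psi t (Phi t y) = y.
Proof.
move=> hy /[dup] tT' /andP[t0 tT]; have [[r0 L0 M0 T0 [LT MT]] xL xM hP hQ] := hB.
have hy2 : `|y - q| <= rho / 2 by apply: le_trans hy _; lra.
have [p0 p] := hP y hy2.
have [_ hn] := flow_near y t hy2 tT'.
have hPy : `|Phi t y - q| <= rho / 2.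
  rewrite -(subrKA y); apply: le_trans (ler_normD _ _) _; lra.
have [s0 s] := hQ _ hPy.
have Lt : L * t <= 2^-1 by apply: le_trans LT; rewrite ler_wpM2l// ltW.
have := local_flow_inverse xi q rho L (Phi ^~ y) (Psi ^~ (Phi t y)) t (ltW L0) xL t0 Lt
  (ltrajW _ _ _ _ _ _ tT p) (ltrajW _ _ _ _ _ _ tT s) s0.
by rewrite p0.
Qed.

Lemma flow_lip y y' t : `|y - q| <= rho / 2 -> `|y' - q| <= rho / 2 -> 0 <= t <= T ->
  `|Phi t y - Phi t y'| <= 2 * `|y - y'|.
Proof.
move=> hy hy' tT; have [[r0 L0 M0 T0 [LT MT]] xL xM hP _] := hB.
have [p0 p] := hP y hy; have [p0' p'] := hP y' hy'.
by have := ltraj_dist xi q rho L (ltW L0) xL _ _ T t LT p p' tT; rewrite p0 p0'.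
Qed.

Lemma flow_linear (A : 'M[R]_n) (a k : R) y y' t : 0 <= a -> 0 <= k ->
  (forall u : 'rV[R]_n, `|u *m A| <= a * `|u|) ->
  (forall x x', `|x - q| <= rho -> `|x' - q| <= rho ->
    `|xi x - xi x' - (x - x') *m A| <= k * `|x - x'|) ->
  `|y - q| <= rho / 2 -> `|y' - q| <= rho / 2 -> 0 <= t <= T ->
  `|Phi t y - Phi t y' - (y - y') - t *: ((y - y') *m A)| <=
    t * ((2 * k + 2 * a * L * t) * `|y - y'|).
Proof.
move=> a0 k0 ha hA hy hy' tT; have [[r0 L0 M0 T0 [LT MT]] xL xM hP _] := hB.
have [p0 p] := hP y hy; have [p0' p'] := hP y' hy'.
have := ltraj_linear xi q rho L (ltW L0) xL (mulmxr A) a k _ _ T t a0 k0 ha hA LT p p' tT.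
by rewrite p0 p0'.
Qed.

Lemma flow_taylor y t : `|y - q| <= rho / 2 -> 0 <= t <= T ->
  `|Phi t y - y - t *: xi y| <= t * (L * (t * M)).
Proof.
move=> hy tT; have [[r0 L0 M0 T0 [LT MT]] xL xM hP _] := hB.
have [p0 p] := hP y hy.
by have := ltraj_taylor xi q rho L M (ltW L0) (ltW M0) xL xM _ T t p tT; rewrite p0.
Qed.

(** Up to time d a trajectory from the d-ball stays within d (1 + M) of q, so its velocity is within
    L d (1 + M) of [xi q]. *)
Lemma flow_steady y t t' d : `|y - q| <= d -> 0 <= t' -> t' <= t -> t <= d ->
  d <= T -> d <= rho / 2 ->
  `|Phi t y - Phi t' y - (t - t') *: xi q| <= (t - t') * (L * (d * (1 + M))).
Proof.
move=> hy t'0 t't td dT dr; have [[r0 L0 M0 T0 [LT MT]] xL xM hP _] := hB.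
have t0 := le_trans t'0 t't; have d0 := le_trans t0 td.
have hy2 := le_trans hy dr.
have [p0 p] := hP y hy2.
apply: (@mvt_rV R n (Phi ^~ y) (fun u => xi (Phi u y))) => //.
- by rewrite mulr_ge0 ?mulr_ge0 ?addr_ge0// ltW.
- move=> u /andP[tu ut]; apply: (p u _).2.
  by rewrite (le_trans t'0 tu) (le_trans ut (le_trans td dT)).
- move=> u /andP[tu ut].
  have uT : 0 <= u <= T by rewrite (le_trans t'0 tu) (le_trans ut (le_trans td dT)).
  have r0' := ltW r0.
  have qq : `|q - q| <= rho by rewrite subrr normr0.
  apply: le_trans (xL _ _ (p u uT).1 qq) _; rewrite ler_pM2l//.
  have [h1 _] := flow_near y u hy2 uT.
  have h2 : u * M <= d * M by rewrite ler_pM2r// (le_trans ut td).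
  rewrite -(subrKA y); apply: le_trans (ler_normD _ _) _; lra.
Qed.

Lemma flow_near_id y y' t : `|y - q| <= rho / 2 -> `|y' - q| <= rho / 2 -> 0 <= t <= T ->
  `|Phi t y - Phi t y' - (y - y')| <= t * (2 * L * `|y - y'|).
Proof.
move=> hy hy' tT; have [[r0 L0 M0 T0 [LT MT]] xL xM hP _] := hB.
have h0 (u : 'rV[R]_n) : `|u *m (0 : 'M[R]_n)| <= 0 * `|u| by rewrite mulmx0 normr0 mul0r.
have hA x x' : `|x - q| <= rho -> `|x' - q| <= rho ->
    `|xi x - xi x' - (x - x') *m (0 : 'M[R]_n)| <= L * `|x - x'|.
  by move=> hx hx'; rewrite mulmx0 subr0; apply: xL.
have := flow_linear 0 0 L y y' t (lexx _) (ltW L0) h0 hA hy hy' tT.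
by rewrite mulmx0 scaler0 subr0 mulr0 !mul0r addr0.
Qed.

End InFlowBox.
End Flows.

(** * Moves by flows and their commutators, after Chow *)

Section Moves.
Context {R : realType} {n : nat} {V : normedModType R}.
Variable F : 'rV[R]_n -> V.

(** [m s y] is y + s w up to a k-Lipschitz error in (s, y) jointly: a form stable under composition
    and strong enough for Newton's iteration. The variation of F is bounded by e whatever s is, not
    by a multiple of s: a commutator may run for a fixed time and come back, so its cost does not
    tend to 0 with s. *)
Definition approx_move (q w : 'rV[R]_n) (e k : R) : Prop :=
  exists (m : R -> 'rV[R]_n -> 'rV[R]_n) (d : R), 0 < d /\
    forall s y, `|s| < d -> `|y - q| < d ->
      [/\ m 0 y = y, `|F (m s y) - F y| <= e &
        forall s' y', `|s'| < d -> `|y' - q| < d ->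
          `|m s y - m s' y' - (y - y') - (s - s') *: w| <= k * (`|y - y'| + `|s - s'|)].

(* w can be realized, up to an arbitrarily small relative error, as the velocity
   of a family of displacements along which F varies by at most e. *)
Definition tangent (e : R) (q w : 'rV[R]_n) : Prop :=
  forall k, 0 < k -> approx_move q w e k.

Lemma approx_move_close e k q w w' : 
  approx_move q w e k -> approx_move q w' e (k + `|w' - w|).
Proof.
move=> [m [d [d0 hm]]]; exists m, d; split=> // s y sd yd; have [h1 h2 h3] := hm s y sd yd.
split=> // s' y' sd' yd'; have := h3 s' y' sd' yd'.
set X := m s y - _ - _ => hX.
have -> : X - (s - s') *: w' = (X - (s - s') *: w) - (s - s') *: (w' - w).
  by rewrite scalerBr opprB addrA subrK.
apply: le_trans (ler_normB _ _) _; rewrite normrZ.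
have : 0 <= `|w' - w| * `|y - y'| by rewrite mulr_ge0.
lra.
Qed.

Lemma tangent0 e q : 0 <= e -> tangent e q 0.
Proof.
move=> e0 k k0; exists (fun _ y => y), 1; split=> // s y _ _; split=> //.
  by rewrite subrr normr0.
move=> s' y' _ _; rewrite subrr scaler0 subr0 normr0.
by apply: mulr_ge0; [exact: ltW|exact: addr_ge0].
Qed.

(** Running the parameter [a] times faster multiplies the error by [|a|]. It serves with a the
    inverse of the flow time x of a commutator, whose moves must therefore be accurate to o(x). *)
Lemma approx_moveZ e k q w a : 1 <= `|a| -> 0 <= k ->
  approx_move q w e k -> approx_move q (a *: w) e (k * `|a|).
Proof.
move=> a1 k0 [m [d [d0 hm]]].
have a0 : 0 < `|a| by apply: lt_le_trans a1.
exists (fun s y => m (a * s) y), (d / `|a|); split; first by rewrite divr_gt0.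
have hs (s : R) : `|s| < d / `|a| -> `|a * s| < d.
  by rewrite ltr_pdivlMr// normrM mulrC.
have hd : d / `|a| <= d by rewrite ler_pdivrMr//; apply: ler_peMr => //; exact: ltW.
move=> s y sd yd; have [h1 h2 h3] := hm _ y (hs _ sd) (lt_le_trans yd hd).
split=> //; first by rewrite mulr0.
move=> s' y' sd' yd'; have := h3 _ y' (hs _ sd') (lt_le_trans yd' hd).
rewrite -mulrBr scalerA (mulrC (s - s')) => h4; apply: le_trans h4 _.
rewrite normrM.
have : 0 <= k * (`|a| - 1) * `|y - y'| by rewrite !mulr_ge0// subr_ge0.
lra.
Qed.

Lemma tangentN e q w : tangent e q w -> tangent e q (- w).
Proof.
move=> h k k0; have := @approx_moveZ e k q w (-1); rewrite normrN normr1 mulr1 scaleN1r.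
by apply => //; [exact: ltW|exact: h].
Qed.

Lemma approx_moveD e e' k k' q w w' : 0 <= k -> k < k' ->
  approx_move q w e k -> tangent e' q w' -> approx_move q (w + w') (e + e') k'.
Proof.
move=> k0 kk' [m [d [d0 hm]]] h'.
(* The first move changes a point by at most (k + |w|) |s| and differences by at most the factor 1 +
   k in y and k + |w| in s. So W bounds both the room needed by the second move and the
   amplification of its error k1. *)
pose W := 2 + k + `|w|.
have W1 : 1 <= W by rewrite /W; have := normr_ge0 w; lra.
have W0 : 0 < W by apply: lt_le_trans W1.
pose k1 := (k' - k) / W.
have k10 : 0 < k1 by rewrite divr_gt0// subr_gt0.
have k1W : k1 * W = k' - k by rewrite divfK// gt_eqF.
have [m' [d' [d'0 hm']]] := h' _ k10.
pose D := Num.min d (d' / W).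
have D0 : 0 < D by rewrite lt_min d0 divr_gt0.
have Dd : D <= d by rewrite /D ge_min lexx.
have Dd' : D * W <= d' by rewrite -ler_pdivlMr// /D ge_min lexx orbT.
have DD : D <= d' by apply: le_trans Dd'; apply: ler_peMr => //; exact: ltW.
exists (fun s y => m' s (m s y)), D; split=> // s y sD yD.
have inD (s1 : R) (y1 : 'rV[R]_n) : `|s1| < D -> `|y1 - q| < D ->
    [/\ `|s1| < d, `|s1| < d', `|y1 - q| < d & `|m s1 y1 - q| < d'].
  move=> s1D y1D.
  have s1d := lt_le_trans s1D Dd; have y1d := lt_le_trans y1D Dd.
  split=> //; first exact: lt_le_trans s1D DD.
  have [m0 _ hh] := hm s1 y1 s1d y1d.
  have z0 : `|0 : R| < d by rewrite normr0.
  have [m00 _ _] := hm 0 y1 z0 y1d.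
  have := hh 0 y1 z0 y1d; rewrite m00 subrr normr0 add0r !subr0 => h4.
  have h5 : `|m s1 y1 - y1| <= (k + `|w|) * `|s1|.
    rewrite -(subrK (s1 *: w) (m s1 y1 - y1)); apply: le_trans (ler_normD _ _) _.
    rewrite normrZ; move: h4; clear; lra.
  rewrite -(subrKA y1); apply: le_lt_trans (ler_normD _ _) _.
  have h6 : (k + `|w|) * `|s1| <= (k + `|w|) * D.
    by rewrite ler_wpM2l ?addr_ge0//; exact: ltW.
  apply: lt_le_trans Dd'; rewrite /W; clear -h5 h6 y1D D0; lra.
have [sd sd' yd zd] := inD s y sD yD.
have [m0 Fm hh] := hm s y sd yd.
have [m0' Fm' hh'] := hm' s (m s y) sd' zd.
split.
- have yd' : `|y - q| < d' by exact: lt_le_trans yD DD.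
  by rewrite m0; have [-> _ _] := hm' s y sd' yd'.
- rewrite -(subrKA (F (m s y))); apply: le_trans (ler_normD _ _) _; clear -Fm Fm'; lra.
move=> s' y' sD' yD'.
have [sd2 sd2' yd2 zd2] := inD s' y' sD' yD'.
have h1 := hh s' y' sd2 yd2; have h2 := hh' s' (m s' y') sd2' zd2.
set z := m s y in h1 h2 *; set z' := m s' y' in h1 h2 *.
have nz : `|z - z'| <= (1 + k) * `|y - y'| + (k + `|w|) * `|s - s'|.
  rewrite -(subrK (y - y') (z - z')) -(subrK ((s - s') *: w) (z - z' - (y - y'))).
  apply: le_trans (ler_normD _ _) _; apply: le_trans (lerD (ler_normD _ _) (lexx _)) _.
  rewrite normrZ; clear -h1; lra.
rewrite scalerDr.
have -> : m' s z - m' s' z' - (y - y') - ((s - s') *: w + (s - s') *: w') =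
   (m' s z - m' s' z' - (z - z') - (s - s') *: w') + (z - z' - (y - y') - (s - s') *: w).
  by apply/rowP => j; rewrite !mxE; ring.
apply: le_trans (ler_normD _ _) _; apply: le_trans (lerD h2 h1) _.
have b1 : k1 * `|z - z'| <= k1 * ((1 + k) * `|y - y'| + (k + `|w|) * `|s - s'|).
  by apply: ler_wpM2l => //; exact: ltW.
have b2 : k1 * W * (`|y - y'| + `|s - s'|) = (k' - k) * (`|y - y'| + `|s - s'|).
  by rewrite k1W.
move: b2; rewrite /W.
have : 0 <= k1 * `|y - y'| by rewrite mulr_ge0// ltW.
have : 0 <= k1 * `|s - s'| by rewrite mulr_ge0// ltW.
have k10' := ltW k10.
have : 0 <= k1 * (`|w| * `|y - y'|) by rewrite mulr_ge0// mulr_ge0.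
clear -b1 kk' k0; lra.
Qed.

Lemma tangentD e e' q w w' :
  tangent e q w -> tangent e' q w' -> tangent (e + e') q (w + w').
Proof.
move=> h h' k k0; have k2 : 0 < k / 2 by lra.
by apply: (approx_moveD _ _ (k / 2)) (h _ k2) h'; lra.
Qed.

(** The chain rule with explicit errors, on increments: a map with linear part P and velocity w
    followed by one with linear part Q and velocity v. The error of the first passes through Q, and
    that of the second acts on the full increment Dz. *)
Lemma compose_affine (Dz Dy Df : 'rV[R]_n) (P Q : 'M[R]_n) (w v : 'rV[R]_n)
    (p c al be al' be' s : R) :
  0 <= c -> 0 <= al' ->
  (forall u : 'rV[R]_n, `|u *m P| <= p * `|u|) ->
  (forall u : 'rV[R]_n, `|u *m Q| <= c * `|u|) ->
  `|Dz - Dy *m P - s *: w| <= al * `|Dy| + be * `|s| ->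
  `|Df - Dz *m Q - s *: v| <= al' * `|Dz| + be' * `|s| ->
  `|Df - Dy *m (P *m Q) - s *: (w *m Q + v)| <=
    (c * al + al' * (p + al)) * `|Dy| + (c * be + al' * (`|w| + be) + be') * `|s|.
Proof.
move=> c0 al'0 hP hQ h1 h2.
pose E := Dz - Dy *m P - s *: w; rewrite -/E in h1.
have zE : Dz = E + Dy *m P + s *: w by rewrite /E (addrAC _ _ (s *: w)) !subrK.
have nz : `|Dz| <= (p + al) * `|Dy| + (`|w| + be) * `|s|.
  rewrite zE; apply: le_trans (ler_normD _ _) _.
  apply: le_trans (lerD (ler_normD _ _) (lexx _)) _; rewrite normrZ.
  have := hP Dy; lra.
have -> : Df - Dy *m (P *m Q) - s *: (w *m Q + v) =
    (Df - Dz *m Q - s *: v) + E *m Q.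
  rewrite {1}zE !mulmxDl -scalemxAl -mulmxA scalerDr.
  move: (E *m Q) (_ *m (P *m Q)) (s *: (w *m Q)) (s *: v) => a2 a3 a4 a5.
  by apply/rowP => j; rewrite !mxE; ring.
apply: le_trans (ler_normD _ _) _; apply: le_trans (lerD h2 (hQ E)) _.
have b1 := ler_wpM2l c0 h1; have b2 := ler_wpM2l al'0 nz.
lra.
Qed.

(* In the flow of [xi], the velocity [xi q] is realized with no relative error. *)
Lemma tangent_flow (xi : 'rV[R]_n -> 'rV[R]_n) (q : 'rV[R]_n) (rho K L e : R) :
  0 < rho -> 0 < L -> 0 <= K -> 0 < e ->
  (forall x x', `|x - q| <= rho -> `|x' - q| <= rho -> `|xi x - xi x'| <= L * `|x - x'|) ->
  (forall sg T, 0 <= T -> ltraj xi q rho sg T -> `|F (sg T) - F (sg 0)| <= K * T) ->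
  tangent e q (xi q).
Proof.
move=> r0 L0 K0 e0 xL hF k k0.
have [T [Phi [Psi]]] := flow_box_exists xi q rho L r0 L0 xL.
move: (_ + 1) => M hB.
have hB' := flow_boxN _ _ _ _ _ _ _ _ hB.
have [[_ _ M0 T0 [LT MT]] _ xM hP hQ] := hB.
pose m (s : R) y := if 0 <= s then Phi s y else Psi (- s) y.
(* Both errors are proportional to the size d of the neighbourhood: 2 L d in the starting point by
   [flow_near_id], and L d (1 + M) in time by [flow_steady]. *)
pose C := 2 * L + L * (1 + M).
have M10 : 0 < 1 + M by rewrite ltr_wpDr// ltW.
have C0 : 0 < C by rewrite /C !addr_gt0// mulr_gt0.
pose d := Num.min (Num.min T (rho / 2)) (Num.min (k / C) (e / (K + 1))).
have d0 : 0 < d by rewrite !lt_min T0 !divr_gt0// ltr_wpDl.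
have [dT dr dk de] : [/\ d <= T, d <= rho / 2, d * C <= k & d * (K + 1) <= e].
  rewrite -!ler_pdivlMr// ?ltr_wpDl// /d.
  by split; rewrite !ge_min lexx ?orbT.
have hFN sg t : 0 <= t -> ltraj (fun x => - xi x) q rho sg t ->
    `|F (sg t) - F (sg 0)| <= K * t.
  move=> t0 h; have h' := ltraj_rev _ _ _ _ _ h.
  have E : (fun x => - - xi x) = xi by apply/funext => x; rewrite opprK.
  rewrite E in h'; have := hF _ _ t0 h'; rewrite subrr subr0 distrC; exact.
have bndF (t : R) : 0 <= t -> t < d -> K * t <= e.
  move=> t0 td; apply: le_trans de; rewrite mulrC.
  by apply: ler_pM => //; [exact: ltW|rewrite lerDl].
have hPsi (s : R) : s <= 0 -> m s = Psi (- s) \/ s = 0.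
  by rewrite /m le_eqVlt => /orP[/eqP ->|s0]; [right|left; rewrite leNgt s0].
exists m, d; split=> // s y sd yd.
have hyr z : `|z - q| < d -> `|z - q| <= rho / 2 by move=> /ltW h; apply: le_trans h dr.
have m0 z : `|z - q| < d -> m 0 z = z.
  by move=> hz; rewrite /m lexx; apply: (hP z (hyr _ hz)).1.
have mP (t : R) : 0 <= t -> m t = Phi t by move=> t0; rewrite /m t0.
have mN (t : R) z : `|z - q| < d -> t <= 0 -> m t z = Psi (- t) z.
  move=> hz t0; have [->//|->] := hPsi t t0.
  by rewrite m0// oppr0 (hQ z (hyr _ hz)).1.
have bd (t : R) : `|t| < d -> `|t| <= T by move=> /ltW h; apply: le_trans h dT.
split; first exact: m0.
- have [s0|s0] := leP 0 s.
    have [p0 p] := hP y (hyr _ yd).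
    have := bd s sd; rewrite (mP _ s0) ger0_norm// => sT.
    have := hF _ _ s0 (ltrajW _ _ _ _ _ _ sT p); rewrite p0 => h; apply: le_trans h _.
    by apply: bndF => //; rewrite ger0_norm// in sd.
  have [p0 p] := hQ y (hyr _ yd).
  have s0' : 0 <= - s by rewrite oppr_ge0 ltW.
  have := bd s sd; rewrite (mN _ _ yd (ltW s0)) ltr0_norm// => sT.
  have := hFN _ _ s0' (ltrajW _ _ _ _ _ _ sT p); rewrite p0 => h; apply: le_trans h _.
  by apply: bndF => //; rewrite ltr0_norm// in sd.
move=> s' y' sd' yd'.
have nE : `|m s y - m s y' - (y - y')| <= d * (2 * L * `|y - y'|).
  have L2 : 0 <= 2 * L * `|y - y'| by rewrite mulr_ge0// mulr_ge0// ltW.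
  have [s0|s0] := leP 0 s.
    rewrite ger0_norm// in sd; rewrite mP//.
    have sT : 0 <= s <= T by rewrite s0 (le_trans (ltW sd) dT).
    apply: le_trans (flow_near_id _ _ _ _ _ _ _ _ hB y y' s (hyr _ yd) (hyr _ yd') sT) _.
    by rewrite ler_wpM2r// ltW.
  have s0w := ltW s0; rewrite ltr0_norm// in sd; rewrite !mN//.
  have sT : 0 <= - s <= T by rewrite oppr_ge0 (ltW s0) (le_trans (ltW sd) dT).
  apply: le_trans (flow_near_id _ _ _ _ _ _ _ _ hB' y y' (- s) (hyr _ yd) (hyr _ yd') sT) _.
  by rewrite ler_wpM2r// ltW.
pose kap := L * (d * (1 + M)).
have stP (t t' : R) : 0 <= t' -> t' <= t -> t < d ->
    `|m t y' - m t' y' - (t - t') *: xi q| <= (t - t') * kap.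
  move=> t'0 t't td; rewrite !mP// ?(le_trans t'0 t't)//.
  exact: (flow_steady _ _ _ _ _ _ _ _ hB y' t t' d (ltW yd') t'0 t't (ltW td) dT dr).
have stN (t t' : R) : t <= 0 -> t' <= t -> - t' < d ->
    `|m t y' - m t' y' - (t - t') *: xi q| <= (t - t') * kap.
  move=> t0 t't td; rewrite !mN// ?(le_trans t't t0)//.
  have a0 : 0 <= - t by rewrite oppr_ge0.
  have tt : - t <= - t' by rewrite lerN2.
  have := flow_steady _ _ _ _ _ _ _ _ hB' y' (- t') (- t) d (ltW yd') a0 tt (ltW td) dT dr.
  have -> : - t' - - t = t - t' by rewrite opprK addrC.
  have -> : Psi (- t) y' - Psi (- t') y' - (t - t') *: xi q =
      - (Psi (- t') y' - Psi (- t) y' - (t - t') *: - xi q).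
    by apply/rowP => j; rewrite !mxE; ring.
  by rewrite normrN.
have stA (t t' : R) : `|t| < d -> `|t'| < d -> t' <= t ->
    `|m t y' - m t' y' - (t - t') *: xi q| <= (t - t') * kap.
  rewrite !ltr_norml => /andP[t1 t2] /andP[t1' t2'] tt.
  have [t'0|t'0] := leP 0 t'; first exact: stP.
  have [t0|t0] := leP t 0; first by apply: stN => //; lra.
  have h1 : `|m t y' - m 0 y' - (t - 0) *: xi q| <= (t - 0) * kap.
    by apply: stP => //; exact: ltW.
  have h2 : `|m 0 y' - m t' y' - (0 - t') *: xi q| <= (0 - t') * kap.
    by apply: stN => //; [exact: ltW|lra].
  have -> : m t y' - m t' y' - (t - t') *: xi q =
    (m t y' - m 0 y' - (t - 0) *: xi q) + (m 0 y' - m t' y' - (0 - t') *: xi q).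
    by apply/rowP => j; rewrite !mxE; ring.
  apply: le_trans (ler_normD _ _) _; apply: le_trans (lerD h1 h2) _; lra.
have stE : `|m s y' - m s' y' - (s - s') *: xi q| <= `|s - s'| * kap.
  have [ss|ss] := leP s' s; first by rewrite (ger0_norm (_ : 0 <= s - s')) ?subr_ge0//; apply: stA.
  rewrite (ltr0_norm (_ : s - s' < 0)) ?subr_lt0// opprB.
  have := stA s' s sd' sd (ltW ss); rewrite -normrN.
  have -> // : - (m s' y' - m s y' - (s' - s) *: xi q) = m s y' - m s' y' - (s - s') *: xi q.
  by apply/rowP => j; rewrite !mxE; ring.
have -> : m s y - m s' y' - (y - y') - (s - s') *: xi q =
    (m s y - m s y' - (y - y')) + (m s y' - m s' y' - (s - s') *: xi q).
  by apply/rowP => j; rewrite !mxE; ring.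
apply: le_trans (ler_normD _ _) _; apply: le_trans (lerD nE stE) _.
have b1 : d * C * (`|y - y'| + `|s - s'|) <= k * (`|y - y'| + `|s - s'|).
  by apply: ler_wpM2r => //; exact: addr_ge0.
apply: le_trans b1; rewrite /kap /C.
have : 0 <= d * (L * (1 + M)) * `|y - y'| by rewrite !mulr_ge0// ltW.
have : 0 <= d * (2 * L) * `|s - s'| by rewrite !mulr_ge0// ltW.
lra.
Qed.

(** The conjugate [Psi x] o [m s] o [Phi x] of a move by a flow of Y. The flows have linear parts 1
    + x A and 1 - x A up to E: the velocity w becomes w (1 - x A), and the product 1 - x^2 A^2
    differs from the identity by the term x^2 a^2. The two flows of length x cost 2 K x in F. *)
Lemma approx_move_conj (Y : 'rV[R]_n -> 'rV[R]_n) q rho L M T Phi Psi (A : 'M[R]_n)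
    (a K x E e k : R) (w : 'rV[R]_n) :
  flow_box Y q rho L M T Phi Psi -> 0 <= a -> 0 <= K -> 0 <= x -> x <= T -> x <= 1 ->
  0 <= E -> 0 <= k ->
  (forall u : 'rV[R]_n, `|u *m A| <= a * `|u|) ->
  (forall sg T, 0 <= T -> ltraj Y q rho sg T -> `|F (sg T) - F (sg 0)| <= K * T) ->
  (forall y y', `|y - q| <= rho / 2 -> `|y' - q| <= rho / 2 ->
    `|Phi x y - Phi x y' - (y - y') - x *: ((y - y') *m A)| <= E * `|y - y'|) ->
  (forall y y', `|y - q| <= rho / 2 -> `|y' - q| <= rho / 2 ->
    `|Psi x y - Psi x y' - (y - y') + x *: ((y - y') *m A)| <= E * `|y - y'|) ->
  approx_move (Phi x q) w e k ->
  let al := E + k * (1 + a + E) in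
  approx_move q (w - x *: (w *m A)) (e + 2 * (K * x))
    (x ^+ 2 * a ^+ 2 + ((1 + a) * al + E * (1 + a + al)) + ((1 + a) * k + E * (`|w| + k))).
Proof.
move=> hB a0 K0 x0 xT x1 E0 k0 hA hF hP hQ [m [d [d0 hm]]] al.
have hB' := flow_boxN _ _ _ _ _ _ _ _ hB.
have [[r0 L0 M0 T0 [LT MT]] _ xM hPhi hPsi] := hB.
have xT' : 0 <= x <= T by rewrite x0 xT.
have W0 : 0 < 1 + k + `|w| by rewrite -addrA ltr_pwDl// addr_ge0.
pose D := Num.min (d / 2) (Num.min (rho / 8) (rho / 8 / (1 + k + `|w|))).
have D0 : 0 < D by rewrite !lt_min !divr_gt0.
have [Dd Dr DW] : [/\ D <= d / 2, D <= rho / 8 & D * (1 + k + `|w|) <= rho / 8].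
  by rewrite -(ler_pdivlMr _ _ W0) /D; split; rewrite !ge_min lexx ?orbT.
have qq : `|q - q| <= rho / 2 by rewrite subrr normr0 divr_ge0// ltW.
have inD (s1 : R) y1 : `|s1| < D -> `|y1 - q| < D ->
    [/\ `|s1| < d, `|y1 - q| <= rho / 4, `|Phi x y1 - Phi x q| < d & `|m s1 (Phi x y1) - q| <= rho / 2].
  move=> s1D y1D.
  have s1d : `|s1| < d by clear -s1D Dd d0; lra.
  have y4 : `|y1 - q| <= rho / 4 by clear -y1D Dr r0; lra.
  have y2 : `|y1 - q| <= rho / 2 by clear -y4 r0; lra.
  have g1 : `|Phi x y1 - Phi x q| < d.
    by apply: le_lt_trans (flow_lip _ _ _ _ _ _ _ _ hB y1 q x y2 qq xT') _; clear -y1D Dd; lra.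
  split=> //.
  have [m0 _ hh] := hm s1 (Phi x y1) s1d g1.
  have z0 : `|0 : R| < d by rewrite normr0.
  have [m00 _ _] := hm 0 (Phi x y1) z0 g1.
  have := hh 0 (Phi x y1) z0 g1; rewrite m00 subrr normr0 add0r !subr0 => h4.
  have h5 : `|m s1 (Phi x y1) - Phi x y1| <= (k + `|w|) * `|s1|.
    rewrite -(subrK (s1 *: w) (m s1 (Phi x y1) - Phi x y1)); apply: le_trans (ler_normD _ _) _.
    rewrite normrZ; move: h4; clear; lra.
  have [_ h6] := flow_near _ _ _ _ _ _ _ _ hB y1 x y2 xT'.
  have h7 : (k + `|w|) * `|s1| <= (k + `|w|) * D.
    by rewrite ler_wpM2l ?addr_ge0//; exact: ltW.
  rewrite -(subrKA (Phi x y1)) -(subrKA y1 (Phi x y1)).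
  apply: le_trans (ler_normD _ _) _; apply: le_trans (lerD (lexx _) (ler_normD _ _)) _.
  clear -h5 h6 h7 y1D DW D0 Dr y4; lra.
exists (fun s y => Psi x (m s (Phi x y))), D; split=> // s y sD yD.
have [sd y4 gd md] := inD s y sD yD.
have [m0 Fm hh] := hm s _ sd gd.
split.
- by rewrite m0; exact: (flow_inv _ _ _ _ _ _ _ _ hB).
- have y2 : `|y - q| <= rho / 2 by clear -y4 r0; lra.
  have [p0 p] := hPhi y y2.
  have F1 := hF _ _ x0 (ltrajW _ _ _ _ _ _ xT p); rewrite p0 in F1.
  have [p0' p'] := hPsi _ md.
  have F2 : `|F (Psi x (m s (Phi x y))) - F (m s (Phi x y))| <= K * x.
    have h' := ltraj_rev _ _ _ _ _ (ltrajW _ _ _ _ _ _ xT p').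
    have EE : (fun x => - - Y x) = Y by apply/funext => u; rewrite opprK.
    rewrite EE in h'; have := hF _ _ x0 h'; rewrite subrr subr0 p0' distrC; exact.
  rewrite -(subrKA (F (m s (Phi x y)))) -(subrKA (F (Phi x y)) (F (m s (Phi x y)))).
  apply: le_trans (ler_normD _ _) _; apply: le_trans (lerD (lexx _) (ler_normD _ _)) _.
  clear -F1 F2 Fm; lra.
move=> s' y' sD' yD'.
have [sd' y4' gd' md'] := inD s' y' sD' yD'.
have y2 : `|y - q| <= rho / 2 by clear -y4 r0; lra.
have y2' : `|y' - q| <= rho / 2 by clear -y4' r0; lra.
have h1 := hP y y' y2 y2'.
have h2 := hh s' _ sd' gd'.
have h3 := hQ _ _ md md'.
set Dy := y - y' in h1 *; set g := Phi x y in h1 h2 h3 *; set g' := Phi x y' in h1 h2 h3 *.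
set z := m s g in h2 h3 *; set z' := m s' g' in h2 h3 *; set ds := s - s' in h2 *.
pose P : 'M[R]_n := 1%:M + x *: A; pose Q : 'M[R]_n := 1%:M - x *: A.
have xa (u : 'rV[R]_n) : x * `|u *m A| <= a * `|u| :> R.
  have hu := hA u; have : x * `|u *m A| <= 1 * `|u *m A| by rewrite ler_wpM2r.
  clear -hu; lra.
have hPn (u : 'rV[R]_n) : `|u *m P| <= (1 + a) * `|u|.
  rewrite mulmxDr mulmx1 -scalemxAr; apply: le_trans (ler_normD _ _) _.
  by rewrite normrZ ger0_norm// mulrDl mul1r lerD2l.
have hQn (u : 'rV[R]_n) : `|u *m Q| <= (1 + a) * `|u|.
  rewrite mulmxBr mulmx1 -scalemxAr; apply: le_trans (ler_normB _ _) _.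
  by rewrite normrZ ger0_norm// mulrDl mul1r lerD2l.
have h1n (u : 'rV[R]_n) : `|u *m 1%:M| <= 1 * `|u| by rewrite mulmx1 mul1r.
have {}h1 : `|(g - g') - Dy *m P - ds *: 0| <= E * `|Dy| + 0 * `|ds|.
  by rewrite scaler0 subr0 mul0r addr0 mulmxDr mulmx1 -scalemxAr opprD addrA.
have {}h2 : `|(z - z') - (g - g') *m 1%:M - ds *: w| <= k * `|g - g'| + k * `|ds|.
  by rewrite mulmx1 -mulrDr.
have {}h3 : `|(Psi x z - Psi x z') - (z - z') *m Q - ds *: 0| <= E * `|z - z'| + 0 * `|ds|.
  by rewrite scaler0 subr0 mul0r addr0 mulmxBr mulmx1 -scalemxAr opprB addrA (addrAC _ (x *: _)).
have h12 := compose_affine _ _ _ _ _ _ _ _ _ _ _ _ _ _ ler01 k0 hPn h1n h1 h2.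
have hP1 (u : 'rV[R]_n) : `|u *m (P *m 1%:M)| <= (1 + a) * `|u| by rewrite mulmx1.
have a10 : 0 <= 1 + a by rewrite addr_ge0.
have := compose_affine _ _ _ _ _ _ _ _ _ _ _ _ _ _ a10 E0 hP1 hQn h12 h3.
rewrite mulmx1 mul0mx add0r addr0 normr0 !mul1r !addr0 mulr0 !add0r.
have -> : P *m Q = 1%:M - (x ^+ 2) *: (A *m A).
  rewrite /P /Q mulmxBr mulmx1 mulmxDl mul1mx -scalemxAl -scalemxAr scalerA -expr2.
  by rewrite opprD addrA addrK.
rewrite /Q !mulmxBr !mulmx1 -!scalemxAr -/al.
set RR := Psi x z - Psi x z'; set w2 := w - _ => h.
have -> : RR - Dy - ds *: w2 =
    (RR - (Dy - x ^+ 2 *: (Dy *m (A *m A))) - ds *: w2) - x ^+ 2 *: (Dy *m (A *m A)).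
  by apply/rowP => j; rewrite !mxE; ring.
apply: le_trans (ler_normB _ _) _.
have : `|x ^+ 2 *: (Dy *m (A *m A))| <= x ^+ 2 * a ^+ 2 * `|Dy|.
  rewrite normrZ ger0_norm ?sqr_ge0// -mulrA ler_wpM2l ?sqr_ge0// mulmxA.
  apply: le_trans (hA _) _; rewrite expr2 -mulrA ler_wpM2l//.
move: h; set c1 := (1 + a) * al + _; set c2 := (1 + a) * k + _ => h h'.
have al0 : 0 <= al by rewrite addr_ge0// mulr_ge0// !addr_ge0.
have c10 : 0 <= c1 by rewrite addr_ge0 ?mulr_ge0// addr_ge0.
have c20 : 0 <= c2 by rewrite addr_ge0 ?mulr_ge0// addr_ge0.
have : 0 <= x ^+ 2 * a ^+ 2 * `|ds| by rewrite !mulr_ge0// sqr_ge0.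
have : 0 <= c1 * `|ds| by rewrite mulr_ge0.
have : 0 <= c2 * `|Dy| by rewrite mulr_ge0.
move: h h'; clear; lra.
Qed.

(** With x at most kap, moves accurate to x kap and flow expansions accurate to x kap c1, every term
    of the conjugation error carries a factor x kap. It thus stays of order kap after division by x.
    [c2] bounds al / (x kap). *)
Lemma conj_error_bound (x kap a p c1 z W E al c2 : R) :
  0 <= x -> x <= kap -> kap <= 1 -> 0 <= p -> 0 <= c1 -> z <= W ->
  E = x * (kap * c1) -> al = E + x * kap * (p + E) -> c2 = 2 * c1 + p ->
  x ^+ 2 * a ^+ 2 + (p * al + E * (p + al)) + (p * (x * kap) + E * (z + x * kap)) <=
    x * kap * (a ^+ 2 + (p * c2 + c1 * (p + c2)) + (p + c1 * (W + 1))).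
Proof.
move=> x0 xk kap1 p0 c10 zW eE eal ec2.
have kap0 : 0 <= kap by apply: le_trans xk.
have x1 : x <= 1 by apply: le_trans kap1.
have xk0 : 0 <= x * kap by exact: mulr_ge0.
have xk1 : x * kap <= 1 by apply: mulr_ile1.
have E0 : 0 <= E by rewrite eE !mulr_ge0.
have Ec : E <= c1 by rewrite eE mulrA ler_piMl.
have c20 : 0 <= c2 by rewrite ec2 addr_ge0// mulr_ge0.
have al1 : al <= x * kap * c2.
  have -> : x * kap * c2 = E + x * kap * (p + c1) by rewrite eE ec2; ring.
  by rewrite eal lerD2l ler_wpM2l// lerD2l.
have al2 : al <= c2 by apply: le_trans al1 _; rewrite ler_piMl.
have -> : x * kap * (a ^+ 2 + (p * c2 + c1 * (p + c2)) + (p + c1 * (W + 1))) =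
   x * kap * a ^+ 2 + (p * (x * kap * c2) + E * (p + c2)) + (p * (x * kap) + E * (W + 1)).
  by rewrite eE; ring.
apply: lerD; first apply: lerD.
- by rewrite ler_wpM2r ?sqr_ge0// expr2 ler_wpM2l.
- by apply: lerD; [rewrite ler_wpM2l|rewrite ler_wpM2l// lerD2l].
- by rewrite lerD2l ler_wpM2l// lerD.
Qed.

(* The commutator of a flow of Y with moves along Z, with the flow time x much
   smaller than the prescribed error and the moves much more accurate than x. *)
Lemma tangent_bracket (Y Z : 'rV[R]_n -> 'rV[R]_n) q (A B : 'M[R]_n) (rho K : R) :
  0 < rho -> 0 <= K -> sdiff Y q A -> sdiff Z q B ->
  (forall sg T, 0 <= T -> ltraj Y q rho sg T -> `|F (sg T) - F (sg 0)| <= K * T) ->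
  (forall y, `|y - q| <= rho -> forall e, 0 < e -> tangent e y (Z y)) ->
  forall e, 0 < e -> tangent e q (Y q *m B - Z q *m A).
Proof.
move=> rho0 K0 dY dZ hF hZ e e0 k k0.
have [a a0 hA] := mx_bound A; have [b b0 hB] := mx_bound B.
have [L [L0 [d1 d10 hL]]] := sdiff_lipschitz _ _ _ dY.
pose p := 1 + a; pose c1 := 2 + 2 * a * L; pose c2 := 2 * c1 + p.
pose W := `|Z q| + (b + 1) * (`|Y q| + L + 1); pose M0 := `|Y q| + L + 1.
pose G1 := a ^+ 2 + (p * c2 + c1 * (p + c2)) + (p + c1 * (W + 1)).
pose G2 := M0 + b * L * M0 + a * (b + 1) * M0.
have p0 : 0 <= p by rewrite addr_ge0.
have p1 : 1 <= p by rewrite lerDl.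
have c10 : 0 <= c1 by rewrite addr_ge0// !mulr_ge0// ltW.
have c20 : 0 <= c2 by rewrite addr_ge0// mulr_ge0.
have M00 : 0 <= M0 by rewrite !addr_ge0// ltW.
have W0 : 0 <= W by rewrite addr_ge0// mulr_ge0// ?addr_ge0// ltW.
have G10 : 0 <= G1.
  have g1 := sqr_ge0 a; have g2 : 0 <= p * c2 by exact: mulr_ge0.
  have g3 : 0 <= c1 * (p + c2) by rewrite mulr_ge0// addr_ge0.
  have g4 : 0 <= c1 * (W + 1) by rewrite mulr_ge0// addr_ge0.
  rewrite /G1; clear -g1 g2 g3 g4 p0; lra.
have L0' := ltW L0.
have G20 : 0 <= G2.
  have g1 : 0 <= b * L * M0 by rewrite !mulr_ge0.
  have g2 : 0 <= a * (b + 1) * M0 by rewrite !mulr_ge0// addr_ge0.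
  rewrite /G2; clear -g1 g2 M00; lra.
(* All relative errors are measured in kap: G1 collects those of the conjugation, G2 those of
   replacing the difference quotient of velocities by the bracket. *)
pose kap := Num.min 1 (k / (G1 + G2 + 1)).
have G0 : 0 < G1 + G2 + 1 by rewrite ltr_wpDl// addr_ge0.
have kap0 : 0 < kap by rewrite lt_min ltr01 divr_gt0.
have kap1 : kap <= 1 by rewrite /kap ge_min lexx.
have kapk : kap * (G1 + G2 + 1) <= k by rewrite -ler_pdivlMr// /kap ge_min lexx orbT.
clearbody kap.
have [d2 d20 hY] := dY _ kap0; have [d3 d30 hZd] := dZ _ kap0.
pose r := Num.min (Num.min 1 rho) (Num.min (Num.min d1 d2) d3) / 2.
have r2 : 0 < Num.min (Num.min 1 rho) (Num.min (Num.min d1 d2) d3).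
  by rewrite !lt_min ltr01 rho0 d10 d20.
have r0 : 0 < r by rewrite divr_gt0.
have [r1 rrho rd1 rd2 rd3] : [/\ r <= 1, r <= rho, r < d1, r < d2 & r < d3].
  have rr : r < Num.min (Num.min 1 rho) (Num.min (Num.min d1 d2) d3) by rewrite /r; clear -r2; lra.
  move: rr; rewrite !lt_min => /andP[/andP[u1 u2] /andP[/andP[u3 u4] u5]].
  by split=> //; exact: ltW.
have hLr x x' : `|x - q| <= r -> `|x' - q| <= r -> `|Y x - Y x'| <= L * `|x - x'|.
  by move=> hx hx'; apply: hL; [exact: le_lt_trans hx rd1|exact: le_lt_trans hx' rd1].
have [T [Phi [Psi]]] := flow_box_exists Y q r L r0 L0 hLr.
set M := `|Y q| + L * r + 1 => hBox.
have MM : M <= M0 by rewrite /M /M0 lerD2r lerD2l ler_piMr// ltW.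
have hBox' := flow_boxN _ _ _ _ _ _ _ _ hBox.
have [[_ _ Mp T0 [LT MT]] _ xM hPhi hPsi] := hBox.
(* The bound by kap absorbs the terms of second order in x; the last one pays for F along the two
   flows of Y, leaving room for e / 4 twice, once for each move along Z. *)
pose x := Num.min (Num.min T kap) (e / (4 * (K + 1))).
have K1 : 0 < K + 1 by rewrite ltr_wpDl.
have x0 : 0 < x by rewrite !lt_min T0 kap0 divr_gt0// mulr_gt0.
have [xT xk xe] : [/\ x <= T, x <= kap & x * (4 * (K + 1)) <= e].
  by rewrite -ler_pdivlMr ?mulr_gt0// /x; split; rewrite !ge_min lexx ?orbT.
clearbody x.
have x1 : x <= 1 by apply: le_trans kap1.
have x0' := ltW x0; have kap0' := ltW kap0.
have xT' : 0 <= x <= T by rewrite x0' xT.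
have qq : `|q - q| <= r / 2 by rewrite subrr normr0 divr_ge0// ltW.
have hYr x1' x' : `|x1' - q| <= r -> `|x' - q| <= r ->
    `|Y x1' - Y x' - (x1' - x') *m A| <= kap * `|x1' - x'|.
  by move=> hx hx'; apply: hY; [exact: le_lt_trans hx rd2|exact: le_lt_trans hx' rd2].
pose E := x * (kap * c1).
have hE (D : R) : 0 <= D -> x * ((2 * kap + 2 * a * L * x) * D) <= E * D.
  move=> D0; rewrite /E mulrA ler_wpM2r// ler_wpM2l// /c1.
  have : a * L * x <= a * L * kap by rewrite ler_wpM2l// mulr_ge0.
  clear; lra.
have E0 : 0 <= E by rewrite !mulr_ge0.
have hPE y y' : `|y - q| <= r / 2 -> `|y' - q| <= r / 2 ->
    `|Phi x y - Phi x y' - (y - y') - x *: ((y - y') *m A)| <= E * `|y - y'|.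
  move=> hy hy'.
  by apply: le_trans (flow_linear _ _ _ _ _ _ _ _ hBox A a kap y y' x a0 kap0' hA hYr hy hy' xT') (hE _ _).
have hAN (u : 'rV[R]_n) : `|u *m (- A)| <= a * `|u| by rewrite mulmxN normrN.
have hYrN x1' x' : `|x1' - q| <= r -> `|x' - q| <= r ->
    `|- Y x1' - - Y x' - (x1' - x') *m (- A)| <= kap * `|x1' - x'|.
  by move=> hx hx'; rewrite mulmxN -!opprD normrN; apply: hYr.
have hQE y y' : `|y - q| <= r / 2 -> `|y' - q| <= r / 2 ->
    `|Psi x y - Psi x y' - (y - y') + x *: ((y - y') *m A)| <= E * `|y - y'|.
  move=> hy hy'.
  have := flow_linear _ _ _ _ _ _ _ _ hBox' (- A) a kap y y' x a0 kap0' hAN hYrN hy hy' xT'.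
  by rewrite mulmxN scalerN opprK => h; apply: le_trans h (hE _ _).
pose q1 := Phi x q.
have [n1 n2] := flow_near _ _ _ _ _ _ _ _ hBox q x qq xT'.
have n3 := flow_taylor _ _ _ _ _ _ _ _ hBox q x qq xT'.
rewrite -/q1 in n1 n2 n3.
have q1r : `|q1 - q| <= r by apply: le_trans n2 _; clear -r0; lra.
have e4 : 0 < e / 4 by rewrite divr_gt0.
have kk : 0 < x * kap by rewrite mulr_gt0.
have hZ1 : approx_move q1 (Z q1) (e / 4) (x * kap).
  by apply: hZ => //; apply: le_trans q1r _.
have hFr sg t : 0 <= t -> ltraj Y q r sg t -> `|F (sg t) - F (sg 0)| <= K * t.
  move=> t0 h; apply: hF => // u ut; have [h1 h2] := h u ut.
  by split=> //; apply: le_trans h1 _.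
have C := approx_move_conj Y q r L M T Phi Psi A a K x E _ _ _ hBox a0 K0 x0' xT x1 E0
   (ltW kk) hA hFr hPE hQE hZ1.
move: C; set w1 := Z q1 - _; rewrite /=; set k2 := (_ + _ + _) => C.
have nZ : `|Z q1 - Z q - (q1 - q) *m B| <= kap * `|q1 - q|.
  by apply: hZd; [apply: le_lt_trans rd3|rewrite subrr normr0].
have nq : `|q1 - q| <= x * M0 by apply: le_trans n1 _; rewrite ler_wpM2l.
have nB := hB (q1 - q).
have kM : kap * `|q1 - q| <= kap * (x * M0) by rewrite ler_wpM2l.
have bM : b * `|q1 - q| <= b * (x * M0) by rewrite ler_wpM2l.
have nZ2 : `|Z q1 - Z q| <= x * ((b + 1) * M0).
  rewrite -(subrK ((q1 - q) *m B) (Z q1 - Z q)); apply: le_trans (ler_normD _ _) _.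
  have : kap * (x * M0) <= x * M0 by rewrite ler_piMl// mulr_ge0.
  clear -kM bM nB nZ nq; lra.
have wW : `|Z q1| <= W.
  rewrite -(subrK (Z q) (Z q1)); apply: le_trans (ler_normD _ _) _.
  rewrite addrC lerD2l; apply: le_trans nZ2 _.
  by rewrite ler_piMl// mulr_ge0// addr_ge0.
have k2G : k2 <= x * kap * G1.
  by rewrite /k2 /G1 -/p; apply: conj_error_bound.
have k20 : 0 <= k2.
  have al0 : 0 <= E + x * kap * (1 + a + E) by rewrite addr_ge0// mulr_ge0 ?addr_ge0// ltW.
  have kk' := ltW kk; rewrite -/p in al0.
  have t1 : 0 <= x ^+ 2 * a ^+ 2 by rewrite mulr_ge0// sqr_ge0.
  have t2 : 0 <= E * (p + (E + x * kap * (p + E))) by rewrite mulr_ge0// addr_ge0.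
  have t3 : 0 <= E * (`|Z q1| + x * kap) by rewrite mulr_ge0// addr_ge0.
  by rewrite /k2 -/p addr_ge0// addr_ge0// ?addr_ge0// mulr_ge0.
have k23 : k2 < x * kap * (G1 + 1).
  by rewrite mulrDr mulr1; apply: le_lt_trans k2G _; rewrite ltrDl.
(* Undoing the move along [Z q] leaves the velocity [w1 - Z q], which is x (Y q B - Z q A) up to O(x
   kap): [Z q1 - Z q] is nearly x Y q B, and the conjugation contributes - x Z q1 A. Dividing by x
   yields the bracket. *)
have D := approx_moveD _ _ _ _ _ _ _ k20 k23 C (tangentN _ _ _ (hZ q _ _ e4)).
have {}D : approx_move q (w1 - Z q) (e / 4 + 2 * (K * x) + e / 4) (x * kap * (G1 + 1)).
  by apply: D; rewrite subrr normr0 ltW.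
have xi1 : 1 <= `|x^-1| by rewrite ger0_norm ?invr_ge0// invf_ge1.
have D2 := approx_moveZ _ _ _ _ _ xi1 (le_trans k20 (ltW k23)) D.
have D3 := approx_move_close _ _ _ _ (Y q *m B - Z q *m A) D2.
have [m [d [d0 hm]]] := D3.
exists m, d; split=> // s y sd yd; have [h1 h2 h3] := hm s y sd yd.
split=> //; first by apply: le_trans h2 _; clear -xe x0; lra.
move=> s' y' sd' yd'; apply: le_trans (h3 s' y' sd' yd') _.
rewrite ler_wpM2r// ?addr_ge0//; apply: le_trans kapk.
have -> : x * kap * (G1 + 1) * `|x^-1| = kap * (G1 + 1).
  by rewrite ger0_norm ?invr_ge0// mulrC !mulrA mulVf ?mul1r// gt_eqF.
suff : `|Y q *m B - Z q *m A - x^-1 *: (w1 - Z q)| <= kap * G2 by clear -kap0; lra.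
have -> : Y q *m B - Z q *m A - x^-1 *: (w1 - Z q) =
    - (x^-1 *: (w1 - Z q - x *: (Y q *m B - Z q *m A))).
  by rewrite [x^-1 *: (w1 - Z q - _)]scalerBr scalerA mulVf ?gt_eqF// scale1r opprB.
rewrite normrN normrZ ger0_norm ?invr_ge0// ler_pdivrMl//.
have -> : w1 - Z q - x *: (Y q *m B - Z q *m A) =
   (Z q1 - Z q - (q1 - q) *m B) + (q1 - q - x *: Y q) *m B - x *: ((Z q1 - Z q) *m A).
  rewrite /w1 !mulmxBl -scalemxAl !scalerBr.
  by apply/rowP => j; rewrite !mxE; ring.
apply: le_trans (ler_normB _ _) _; apply: le_trans (lerD (ler_normD _ _) (lexx _)) _.
have t1 := hB (q1 - q - x *: Y q).
have t2 : `|x *: ((Z q1 - Z q) *m A)| <= x * (a * (x * ((b + 1) * M0))).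
  rewrite normrZ ger0_norm// ler_wpM2l//; apply: le_trans (hA _) _.
  by rewrite ler_wpM2l.
have t3 : x * (L * (x * M)) <= x * (L * (kap * M0)).
  by rewrite ler_wpM2l// ler_wpM2l// ler_pM// ltW.
have t4 : b * `|q1 - q - x *: Y q| <= b * (x * (L * (kap * M0))).
  by rewrite ler_wpM2l//; apply: le_trans n3 _.
have t5 : x * (a * (x * ((b + 1) * M0))) <= x * (a * (kap * ((b + 1) * M0))).
  by rewrite ler_wpM2l// ler_wpM2l// ler_wpM2r// mulr_ge0// addr_ge0.
rewrite /G2; move: nZ kM t1 t2 t3 t4 t5; clear; lra.
Qed.

(** The moves in the coordinate directions listed in l are composed, the one in direction j being
    run for the time [s ord0 j]; a direction counts as often as it is listed. *)
Lemma moves_along (q : 'rV[R]_n) (e : R) : 0 <= e -> (forall w, tangent e q w) ->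
  forall (l : seq 'I_n) (k : R), 0 < k ->
  exists (h : 'rV[R]_n -> 'rV[R]_n) (d : R), [/\ 0 < d, h 0 = q &
    forall s, `|s| < d -> `|F (h s) - F q| <= (size l)%:R * e /\
      forall s', `|s'| < d ->
        `|h s - h s' - \sum_(j <- l) (s - s') ord0 j *: delta_mx ord0 j| <= k * `|s - s'|].
Proof.
move=> e0 hT; elim=> [|i l IH] k k0.
  exists (fun _ => q), 1; split=> // s _; rewrite subrr normr0 mul0r; split=> // s' _.
  by rewrite subrr big_nil subr0 normr0 mulr_ge0// ltW.
(* Accuracy 1 makes the inner composition Lipschitz with constant N + 1, which the new move
   amplifies; accuracy k / 2 leaves half of the error to that move. *)
have k2 : 0 < Num.min 1 (k / 2) by rewrite lt_min ltr01 divr_gt0.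
have [h [d [d0 h0 hh]]] := IH _ k2.
pose N : R := (size l)%:R.
have N0 : 0 <= N by rewrite /N.
have hN (s : 'rV[R]_n) : `|\sum_(j <- l) s ord0 j *: delta_mx ord0 j : 'rV[R]_n| <= N * `|s|.
  apply: le_trans (ler_norm_sum _ _ _) _.
  apply: (@le_trans _ _ (\sum_(j <- l) `|s|)).
    apply: ler_sum => j _; rewrite normrZ.
    have : `|delta_mx ord0 j : 'rV[R]_n| <= 1.
      apply/rV_norm_le => // u; rewrite mxE eqxx /=; case: eqP => _; rewrite ?normr1// normr0//.
    have := rV_norm_coord s j.
    move=> h1 h2; apply: le_trans (ler_pM _ _ h1 h2) _ => //; by rewrite mulr1.
  by rewrite big_const_seq count_predT iter_addr addr0 /N mulr_natl.
pose k1 := k / (2 * (N + 2)).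
have k10 : 0 < k1 by rewrite divr_gt0// mulr_gt0// ltr_wpDl.
have [m [d' [d'0 hm]]] := hT (delta_mx ord0 i) k1 k10.
pose D := Num.min d (d' / (N + 2)).
have N2 : 0 < N + 2 by rewrite ltr_wpDl.
have D0 : 0 < D by rewrite lt_min d0 divr_gt0.
have [Dd Dd'] : D <= d /\ D * (N + 2) <= d'.
  by rewrite -ler_pdivlMr// /D; split; rewrite ge_min lexx ?orbT.
have k11 : k1 * (N + 2) = k / 2 by rewrite /k1; field; rewrite gt_eqF.
have m1 : Num.min 1 (k / 2) <= 1 by rewrite ge_min lexx.
have m2 : Num.min 1 (k / 2) <= k / 2 by rewrite ge_min lexx orbT.
have zd : `|0 : 'rV[R]_n| < d by rewrite normr0.
have lip s s' : `|s| < D -> `|s'| < D -> `|h s - h s'| <= (N + 1) * `|s - s'|.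
  move=> sD sD'; have [_ /(_ s' (lt_le_trans sD' Dd)) h1] := hh s (lt_le_trans sD Dd).
  have h2 := hN (s - s').
  rewrite -(subrK (\sum_(j <- l) (s - s') ord0 j *: delta_mx ord0 j) (h s - h s')).
  apply: le_trans (ler_normD _ _) _; apply: le_trans (lerD h1 h2) _.
  rewrite -mulrDl ler_wpM2r// addrC lerD2l//.
have near (s : 'rV[R]_n) : `|s| < D -> `|s ord0 i| < d' /\ `|h s - q| < d'.
  move=> sD; have h1 := lip s 0 sD; rewrite normr0 subr0 h0 in h1; have {}h1 := h1 D0.
  have h2 := rV_norm_coord s i.
  have h3 : `|s| * (N + 2) < d' by apply: lt_le_trans Dd'; rewrite ltr_pM2r.
  have : 0 <= N * `|s| by rewrite mulr_ge0.
  have := normr_ge0 s.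
  by move=> g1 g2; clear -g1 g2 h1 h2 h3 D0; split; lra.
exists (fun s : 'rV[R]_n => m (s ord0 i) (h s)), D; split=> //.
  have [|z1 z2] := near 0; first by rewrite normr0.
  by rewrite mxE h0; have [|//|-> //] := hm 0 q; rewrite ?normr0// subrr normr0.
move=> s sD; have [si hsq] := near s sD.
have [_ Fm hm2] := hm _ _ si hsq.
have [Fh hh2] := hh s (lt_le_trans sD Dd).
split.
  rewrite -(subrKA (F (h s))); apply: le_trans (ler_normD _ _) _.
  by rewrite [size (i :: l)]/= -natr1 mulrDl mul1r addrC lerD.
move=> s' sD'; have [si' hsq'] := near s' sD'.
have h1 := hm2 _ _ si' hsq'; have h2 := hh2 _ (lt_le_trans sD' Dd).
have h3 := lip s s' sD sD'; have h4 := rV_norm_coord (s - s') i.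
have e1 : (s - s') ord0 i = s ord0 i - s' ord0 i by rewrite !mxE.
rewrite big_cons {1}e1; rewrite e1 in h4.
set S := \sum_(j <- l) _ in h2 *.
set X := m _ _ - _ in h1 *.
have -> : X - ((s ord0 i - s' ord0 i) *: delta_mx ord0 i + S) =
  (X - (h s - h s') - (s ord0 i - s' ord0 i) *: delta_mx ord0 i) + (h s - h s' - S).
  by apply/rowP => j; rewrite !mxE; ring.
apply: le_trans (ler_normD _ _) _; apply: le_trans (lerD h1 h2) _.
have h5 : k1 * (`|h s - h s'| + `|s ord0 i - s' ord0 i|) <= k1 * ((N + 2) * `|s - s'|).
  apply: ler_wpM2l; first exact: ltW.
  by clear -h3 h4; lra.
have h6 : Num.min 1 (k / 2) * `|s - s'| <= k / 2 * `|s - s'| by rewrite ler_wpM2r.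
rewrite mulrA k11 in h5; clear -h5 h6; lra.
Qed.

(* Newton's iteration applied to the composition of the n coordinate moves. *)
Lemma tangent_continuous (q : 'rV[R]_n) (e : R) : 0 <= e -> (forall w, tangent e q w) ->
  exists2 d : R, 0 < d & forall q', `|q' - q| < d -> `|F q' - F q| <= n%:R * e.
Proof.
move=> e0 hT.
have h2 : 0 < 2^-1 :> R by rewrite invr_gt0.
have [h [d [d0 h0 hh]]] := moves_along q e e0 hT (enum 'I_n) _ h2.
(* For the full list of coordinates the sum is [s - s'] itself, so h differs from a translation by a
   map of Lipschitz constant 1/2 and each correction halves the residual. *)
have hs s s' : `|s| < d -> `|s'| < d -> `|h s - h s' - (s - s')| <= 2^-1 * `|s - s'|.
  by move=> sd sd'; have [_ /(_ s' sd')] := hh s sd; rewrite big_enum /= -row_sum_delta.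
exists (d / 4); first by rewrite divr_gt0.
move=> q' q'd.
have [C CE] : exists C : R, C = `|q' - q| by exists `|q' - q|.
rewrite -CE in q'd; have CC : 0 <= C by rewrite CE.
pose s := fix s k := if k is k'.+1 then s k' + (q' - h (s k')) else (0 : 'rV[R]_n).
have key k : `|s k| <= 2 * C * (1 - 2^-1 ^+ k) /\ `|q' - h (s k)| <= C * 2^-1 ^+ k.
  elim: k => [|k [IH1 IH2]].
    by rewrite /= normr0 h0 expr0 subrr mulr0 mulr1 CE.
  have p0 : 0 <= 2^-1 ^+ k :> R by rewrite exprn_ge0.
  have C0 : 0 <= C * 2^-1 ^+ k by exact: mulr_ge0.
  have b1 : `|s k.+1| <= 2 * C * (1 - 2^-1 ^+ k.+1).
    apply: le_trans (ler_normD _ _) _; apply: le_trans (lerD IH1 IH2) _.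
    by rewrite exprS; clear; lra.
  have sd : `|s k| < d by apply: le_lt_trans IH1 _; clear -q'd C0 d0 CC; lra.
  have sd' : `|s k.+1| < d.
    apply: le_lt_trans b1 _; rewrite exprS; clear -q'd C0 d0 CC; lra.
  split=> //.
  have := hs _ _ sd' sd; rewrite [s k.+1]/= (addrC (s k)) addrK.
  have -> : h (q' - h (s k) + s k) - h (s k) - (q' - h (s k)) = - (q' - h (q' - h (s k) + s k)).
    by apply/rowP => j; rewrite !mxE; ring.
  rewrite normrN => hb; apply: le_trans hb _; rewrite exprS.
  by clear -IH2; lra.
have [l hl] : exists l, forall k, `|s k - l| <= 2 * C * 2^-1 ^+ k.
  apply: geometric_cauchy => k.
  by have [_] := key k; rewrite [s k.+1]/= (addrC (s k)) addrK.
have ld : `|l| < d.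
  have := hl 0%N; rewrite expr0 mulr1 sub0r normrN => hl0.
  apply: le_lt_trans hl0 _; clear -q'd d0 CC; lra.
have sd k : `|s k| < d.
  have [b1 _] := key k; apply: le_lt_trans b1 _.
  have C0 : 0 <= C * 2^-1 ^+ k by rewrite mulr_ge0// exprn_ge0.
  clear -q'd d0 C0 CC; lra.
have <- : h l = q'.
  apply/eqP; rewrite -subr_eq0 -normr_le0.
  apply: (@le0_of_geometric _ _ (4 * C)) => k.
  have [_ b2] := key k; have b3 := hl k.
  have b4 := hs _ _ ld (sd k); rewrite (distrC (s k)) in b3.
  have b5 : `|h l - h (s k)| <= 3 * C * 2^-1 ^+ k.
    rewrite -(subrK (l - s k) (h l - h (s k))); apply: le_trans (ler_normD _ _) _.
    clear -b3 b4; lra.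
  rewrite -(subrKA (h (s k))); apply: le_trans (ler_normD _ _) _.
  rewrite (distrC _ q'); clear -b2 b5; lra.
have [b _] := hh l ld.
by rewrite size_enum_ord in b.
Qed.

End Moves.

(** * Absolutely continuous functions *)

Section AbsoluteContinuity.
Context {R : realType}.
Notation mu := (@lebesgue_measure R).

(* Cousin-type induction: the increment of K is controlled by eta on the good
   part and, on the rest, by increments of H over disjoint intervals inside O. *)
Definition covered_upto (K H : R -> R) (a eta : R) (O : set R) (x : R) (l : seq (R * R)) :=
  [/\ pairwise (fun p q => q.2 <= p.1) l,
    all (fun p => [&& a <= p.1, p.1 <= p.2 & p.2 <= x]) l,
    ((\sum_(p <- l) (p.2 - p.1))%:E <= mu (O `&` `[a, x]))%E &
    K x - K a <= eta * (x - a) + \sum_(p <- l) `|H p.2 - H p.1|].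

Lemma covered_good (K H : R -> R) a eta (O : set R) x y l : measurable O -> x <= y ->
  covered_upto K H a eta O x l -> K y - K x <= eta * (y - x) ->
  covered_upto K H a eta O y l.
Proof.
move=> mO xy [h1 h2 h3 h4] hK; split=> //.
- apply/allP => p /(allP h2) /and3P[p1 p2 p3].
  by rewrite p1 p2 (le_trans p3 xy).
- apply: le_trans h3 _; apply: le_measure; rewrite ?inE.
  + by apply: measurableI => //; exact: measurable_itv.
  + by apply: measurableI => //; exact: measurable_itv.
  + move=> t [Ot]; rewrite /= !in_itv/= => /andP[at_ tx]; split=> //.
    by rewrite at_ (le_trans tx xy).
- lra.
Qed.

Lemma covered_bad (K H : R -> R) a eta (O : set R) x y l : measurable O -> 0 <= eta ->
  a <= x -> x <= y -> (forall t, x <= t <= y -> O t) ->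
  covered_upto K H a eta O x l -> K y - K x <= `|H y - H x| ->
  covered_upto K H a eta O y ((x, y) :: l).
Proof.
move=> mO eta0 ax xy hO [h1 h2 h3 h4] hK; split=> /=.
- rewrite h1 andbT; apply/allP => p /(allP h2) /and3P[p1 p2 p3] //.
- rewrite ax xy lexx/=; apply/allP => p /(allP h2) /and3P[p1 p2 p3].
  by rewrite p1 p2 (le_trans p3 xy).
- rewrite big_cons/= EFinD.
  have -> : O `&` `[a, y] = (O `&` `[a, x]) `|` `]x, y].
    apply/seteqP; split=> t /=; rewrite !in_itv/=.
      move=> [Ot /andP[at_ ty]]; case: (leP t x) => tx; [left|right] => //.
      by rewrite at_.
    move=> [[Ot /andP[at_ tx]]|/andP[xt ty]].
      by rewrite at_ (le_trans tx xy).
    by split; [apply: hO; rewrite ltW|rewrite ty (le_trans ax (ltW xt))].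
  have dis : (O `&` `[a, x]) `&` `]x, y] = set0.
    by apply/seteqP; split=> // t /=; rewrite !in_itv/= => -[[_ /andP[_ tx]] /andP[xt _]]; lra.
  have mOa : measurable (O `&` `[a, x]).
    by apply: measurableI => //; exact: measurable_itv.
  rewrite measureU//=.
  rewrite addeC lebesgue_measure_itv/= lte_fin; case: ltP => [xy'|yx].
    exact: (leeD h3 (lexx (y - x)%:E)).
  have -> : y = x by apply/eqP; rewrite eq_le yx xy.
  by rewrite subrr adde0 adde0.
- rewrite big_cons/=.
  have : 0 <= eta * (y - x) by rewrite mulr_ge0// subr_ge0.
  lra.
Qed.

(** The local alternative at the supremum c of the points reached extends a cover from some x close
    to c on the left to points beyond c. In the first alternative the interval must contain t, which
    is what differentiability at t can control. *)
Lemma cousin_cover (K H : R -> R) a b eta (O : set R) : measurable O -> a <= b -> 0 <= eta ->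
  (forall u v, a <= u -> u <= v -> v <= b -> K v - K u <= `|H v - H u|) ->
  (forall t, a <= t <= b -> exists2 d, 0 < d &
    (forall u v, a <= u -> u <= t -> t <= v -> v <= b -> t - d < u -> v < t + d ->
       K v - K u <= eta * (v - u)) \/
    (forall s, t - d < s < t + d -> O s)) ->
  exists l, covered_upto K H a eta O b l.
Proof.
move=> mO ab eta0 hKH hloc.
pose S : set R := [set x | a <= x <= b /\ exists l, covered_upto K H a eta O x l].
have Sa : S a.
  split; first by rewrite lexx.
  exists [::]; split=> //; first by rewrite big_nil.
  by rewrite big_nil !subrr mulr0 addr0.
have supS : has_sup S by split; [exists a|exists b => x [/andP[]]].
pose c := sup S.
have ac : a <= c by apply: ub_le_sup => //; exact: supS.2.
have cb : c <= b by apply: ge_sup; [exists a|move=> x [/andP[]]].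
have acb : a <= c <= b by rewrite ac cb.
have [d d0 hd] := hloc c acb.
have [x Sx xc] := sup_adherent d0 supS.
have xc' : x <= c by apply: ub_le_sup => //; exact: supS.2.
have [/andP[ax xb] [l hl]] := Sx.
have step y : c <= y -> y <= b -> y < c + d -> exists l, covered_upto K H a eta O y l.
  move=> cy yb yd; case: hd => [hg|hO].
    exists l; apply: covered_good hl _ => //; first exact: le_trans xc' cy.
    by apply: hg.
  exists ((x, y) :: l); apply: covered_bad hl _ => //.
  - exact: le_trans xc' cy.
  - move=> t /andP[xt ty]; apply: hO; rewrite (lt_le_trans xc xt)/=.
    exact: le_lt_trans ty yd.
  - by apply: hKH => //; exact: le_trans xc' cy.
have [->//|cltb] := eqVneq b c; first by apply: step => //; rewrite ltrDl.
have {}cltb : c < b by rewrite lt_def cltb cb.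
exfalso; pose y := Num.min b (c + d / 2).
have yb : y <= b by rewrite /y ge_min lexx.
have cy : c < y by rewrite /y lt_min cltb ltrDl divr_gt0.
have yd : y < c + d.
  by rewrite /y gt_min ltrD2l ltr_pdivrMr// ltr_pMr// ltr1n orbT.
have [l' hl'] := step y (ltW cy) yb yd.
have : y <= c.
  by apply: ub_le_sup; [exact: supS.2|split; [rewrite yb (le_trans ac (ltW cy))|exists l']].
by rewrite leNgt cy.
Qed.

Lemma covered_abs_continuous (K H : R -> R) a b eta e d (O : set R) l :
  (forall m (u v : 'I_m -> R),
      (forall i, [/\ a <= u i, u i <= v i & v i <= b]) ->
      (forall i j, i != j -> v i <= u j \/ v j <= u i) ->
      \sum_(i < m) (v i - u i) < d ->
      \sum_(i < m) `|H (v i) - H (u i)| < e) ->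
  (mu O < d%:E)%E -> measurable O ->
  covered_upto K H a eta O b l -> K b - K a <= eta * (b - a) + e.
Proof.
move=> hac Od mO [h1 h2 h3 h4].
apply: le_trans h4 _; rewrite lerD2l; apply/ltW.
rewrite (big_nth (0, 0)) big_mkord.
apply: (hac _ (fun i => (nth (0, 0) l i).1) (fun i => (nth (0, 0) l i).2)).
- move=> i; have := allP h2 (nth (0, 0) l i) (mem_nth _ (ltn_ord i)).
  by move=> /and3P[].
- move=> i j ij; have /pairwiseP := h1 => /(_ (0, 0)) h.
  have [lt|lt|/val_inj e1] := ltngtP i j; last by rewrite e1 eqxx in ij.
    by right; apply: (h i j) => //; rewrite inE ltn_ord.
  by left; apply: (h j i) => //; rewrite inE ltn_ord.
- rewrite -lte_fin; apply: le_lt_trans Od.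
  have : ((\sum_(p <- l) (p.2 - p.1))%:E <= mu O)%E.
    apply: le_trans h3 _; apply: le_measure; rewrite ?inE//.
    by apply: measurableI => //; exact: measurable_itv.
  by rewrite (big_nth (0, 0)) big_mkord.
Qed.

Lemma straddle (f : R -> R) (t f' e : R) : derivable f t 1 -> 'D_1 f t = f' -> 0 < e ->
  exists2 r : R, 0 < r & forall s, `|s - t| < r -> `|f s - f t - f' * (s - t)| <= e * `|s - t|.
Proof.
move=> df ef e0.
have df' : differentiable f t by exact/derivable1_diffP.
have /nbhs_eps[r r0 hr] := (eqaddoP _ _ _ _).1 (diff_locally df') _ e0.
exists r => // s st; have := hr (s - t); rewrite subr0 => /(_ st).
rewrite /= !fctE /= subrK opprD addrA -ef deriveE//.
suff -> : 'd f t (s - t) = 'd f t 1 * (s - t) by [].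
by rewrite -[in LHS](mulr1 (s - t)) [LHS]linearZ mulrC.
Qed.

(** The null set is enclosed in an open set smaller than the modulus of absolute continuity of H, so
    the bad intervals contribute at most e / 2. Monotonicity of G lets its increments be dropped on
    them; elsewhere the inequality of derivatives holds up to eta. *)
Lemma abs_continuous_le (H G : R -> R) (a b : R) (N : set R) :
  a <= b -> abs_continuous H a b -> mu.-negligible N ->
  {in `[a, b] &, {homo G : x y / x <= y}} ->
  (forall t, a <= t <= b -> ~ N t -> exists h g, [/\ is_derive t 1 H h, is_derive t 1 G g & h <= g]) ->
  H b - H a <= G b - G a.
Proof.
move=> ab hac [A [mA A0 NA]] Gmono hd.
apply/ler_addgt0Pr => e e0.
pose eta := e / (2 * (b - a + 1)).
have ba1 : 0 < b - a + 1 by rewrite ltr_wpDl ?subr_ge0.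
have eta0 : 0 < eta by rewrite divr_gt0// mulr_gt0.
have e2 : 0 < e / 2 by rewrite divr_gt0.
have [d d0 hacd] := hac _ e2.
have Aoo : (mu A < +oo)%E by rewrite A0 ltry.
have [U [oU AU muU]] := lebesgue_regularity_outer mA Aoo d0.
have mU : measurable U by exact: open_measurable.
have Ud : (mu U < d%:E)%E.
  have UE : U = A `|` (U `\` A) by rewrite setDUK.
  have : (mu A + mu (U `\` A) < d%:E)%E by rewrite A0 add0e.
  by rewrite {2}UE measureU//; [exact: measurableD|rewrite setDIK].
pose K x := H x - G x.
have [l hl] : exists l, covered_upto K H a eta U b l.
  apply: cousin_cover => //; first exact: ltW.
    move=> u v au uv vb; rewrite /K.
    have : G u <= G v.
      by apply: Gmono => //; rewrite in_itv/= ?au ?vb ?andbT//= ?(le_trans uv vb)//(le_trans au uv).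
    have := ler_norm (H v - H u); lra.
  move=> t abt; have [At|At] := pselect (A t).
    have [r r0 hr] := @open_eps R R^o U t oU (AU t At).
    exists r => //; right => s /andP[s1 s2]; apply: hr.
    by rewrite ltr_norml; apply/andP; split; lra.
  have [h [g [[dH eH] [dG eG] hg]]] := hd t abt (fun Nt => At (NA t Nt)).
  have eta2 : 0 < eta / 2 by rewrite divr_gt0.
  have [r1 r10 hr1] := straddle H t h (eta / 2) dH eH eta2.
  have [r2 r20 hr2] := straddle G t g (eta / 2) dG eG eta2.
  exists (Num.min r1 r2); first by rewrite lt_min r10.
  left=> u v au ut tv vb h1 h2.
  have m1 : Num.min r1 r2 <= r1 by rewrite ge_min lexx.
  have m2 : Num.min r1 r2 <= r2 by rewrite ge_min lexx orbT.
  have nu : `|u - t| = t - u by rewrite ler0_norm ?subr_le0// opprB.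
  have nv : `|v - t| = v - t by rewrite ger0_norm ?subr_ge0.
  have a1 := hr1 u; have a2 := hr1 v; have a3 := hr2 u; have a4 := hr2 v.
  rewrite nu in a1 a3; rewrite nv in a2 a4.
  clear - a1 a2 a3 a4 h1 h2 m1 m2 hg ut tv eta0.
  have {}a1 := a1 ltac:(lra); have {}a2 := a2 ltac:(lra).
  have {}a3 := a3 ltac:(lra); have {}a4 := a4 ltac:(lra).
  move: a1 a2 a3 a4; rewrite !ler_norml => /andP[x1 x2] /andP[y1 y2] /andP[z1 z2] /andP[w1 w2].
  have : 0 <= (g - h) * (v - u) by rewrite mulr_ge0// subr_ge0//; exact: le_trans ut tv.
  rewrite /K; lra.
have := covered_abs_continuous K H a b eta (e / 2) d U l hacd Ud mU hl.
have : eta * (b - a) <= e / 2.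
  have -> : e / 2 = eta * (b - a + 1) by rewrite /eta; field; rewrite gt_eqF.
  by rewrite ler_pM2l// lerDl.
rewrite /K; lra.
Qed.

Lemma ac_modulus (W : normedModType R) (H : R -> W) a b : abs_continuous H a b ->
  forall e : R, 0 < e -> exists2 d : R, 0 < d & forall x y, a <= x <= b -> a <= y <= b ->
    `|x - y| < d -> `|H x - H y| < e.
Proof.
move=> hac e e0; have [d d0 hd] := hac e e0; exists d => // x y.
wlog xy : x y / y <= x.
  move=> hw hx hy hxy; have [yx|/ltW xy] := leP y x; first exact: hw.
  by rewrite distrC; apply: hw => //; rewrite distrC.
move=> /andP[ax xb] /andP[ay yb] hxy.
have := hd 1%N (fun=> y) (fun=> x); rewrite !big_ord1; apply => //.
  by move=> i j; rewrite !ord1 eqxx.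
by rewrite (le_lt_trans (ler_norm _) hxy).
Qed.

(** On A the derivative is the limit of the quotients with step 1 / (k + 1) of the continuous
    extension of H by clamping; A lies in the open interval, so that the steps eventually stay
    inside. *)
Lemma measurable_derive_on (H : R -> R) (a b : R) (A : set R) : a <= b -> abs_continuous H a b ->
  measurable A -> (forall t, A t -> a < t < b /\ derivable H t 1) ->
  measurable_fun setT (fun t => \1_A t * `|'D_1 H t|).
Proof.
move=> ab hac mA hA.
pose m := (a + b) / 2; pose r := (b - a) / 2.
have r0 : 0 <= r by rewrite divr_ge0// subr_ge0.
pose cl x := Num.max (m - r) (Num.min (m + r) x).
have clI x : a <= cl x <= b.
  have := clamp_dist m r x r0; rewrite ler_norml -/(cl x) /m /r => /andP[h1 h2].
  by apply/andP; split; lra.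
have cl_id x : a <= x <= b -> cl x = x.
  by move=> /andP[h1 h2]; apply: clamp_id; rewrite ler_norml /m /r; apply/andP; split; lra.
have clL x y : `|cl x - cl y| <= `|x - y| by exact: clamp_lipschitz.
clearbody cl; clear m r r0.
have cH : continuous (H \o cl).
  move=> x; apply/cvgrPdist_lt => e e0; have [d d0 hd] := ac_modulus _ H a b hac e e0.
  apply/(@nbhs_eps _ R^o); exists d => // y yx; apply: hd => //.
  by rewrite distrC; apply: le_lt_trans (clL _ _) yx.
apply: (@measurable_fun_cvg _ _ _ _
  (fun k t => \1_A t * (k.+1%:R * `|(H \o cl) (t + k.+1%:R^-1) - (H \o cl) t|))).
  move=> k; apply: measurable_funM; first exact: measurable_indic.
  apply: measurable_funM; first exact: measurable_cst.
  apply: measurableT_comp; first exact: normr_measurable.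
  apply: measurable_funB; apply: continuous_measurable_fun => //.
  move=> x; apply: (@continuous_comp R R R (fun y => y + k.+1%:R^-1) (H \o cl)); last exact: cH.
  by apply: cvgD; [exact: cvg_id|exact: cvg_cst].
move=> t _; rewrite indicE; case: (boolP (t \in A)) => [|_]; last first.
  by rewrite mul0r; under eq_cvg do rewrite mul0r; exact: cvg_cst.
rewrite inE => /hA[/andP[at_ tb] dH].
rewrite mul1r; under eq_cvg do rewrite mul1r.
apply/cvgrPdist_le => e e0.
have [d d0 hd] := straddle H t _ e dH erefl e0.
have m0 : 0 < Num.min d (b - t) by rewrite lt_min d0 subr_gt0.
have := near_infty_natSinv_lt (PosNum m0); apply: filterS => k /=.
rewrite lt_min => /andP[kd kb].
have k0 : 0 < k.+1%:R^-1 :> R by rewrite invr_gt0.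
rewrite !cl_id; last 2 first.
- by rewrite !ltW.
- by clear - at_ kb k0; move: k.+1%:R^-1 kb k0 => z kb k0; apply/andP; split; lra.
have := hd (t + k.+1%:R^-1); rewrite addrAC subrr add0r gtr0_norm// => /(_ kd) h.
have -> : k.+1%:R * `|H (t + k.+1%:R^-1) - H t| = `|k.+1%:R * (H (t + k.+1%:R^-1) - H t)|.
  by rewrite normrM [`|k.+1%:R|]ger0_norm.
apply: le_trans (ler_dist_dist _ _) _; rewrite distrC.
have -> : k.+1%:R * (H (t + k.+1%:R^-1) - H t) - 'D_1 H t =
   k.+1%:R * (H (t + k.+1%:R^-1) - H t - 'D_1 H t * k.+1%:R^-1).
  by rewrite [in RHS]mulrBr [X in _ = _ - X]mulrC divfK.
rewrite normrM [`|k.+1%:R|]ger0_norm// mulrC -ler_pdivlMr//.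
Qed.

(** [phi] may fail to be measurable, its integral being a supremum over simple functions. The
    measurable function g, equal to the absolute value of H' on a set of full measure in [a, b] and
    to 0 elsewhere, lies below it. H is then compared with the indefinite integral of g, whose
    derivative is g almost everywhere by Lebesgue's theorem. *)
Lemma ac_le_integral (H phi : R -> R) (a b l : R) : a <= b -> abs_continuous H a b ->
  (forall t, 0 <= phi t) ->
  {ae mu, forall t, t \in `[a, b] -> derivable H t 1 /\ `|'D_1 H t| <= phi t} ->
  (\int[mu]_(t in `[a, b]) (phi t)%:E <= l%:E)%E -> H b - H a <= l.
Proof.
move=> ab hac phi0 [N [mN N0 hN]] hl.
pose A : set R := `]a, b[ `\` N.
have mA : measurable A by apply: measurableD => //; exact: measurable_itv.
have hA t : A t -> [/\ a < t < b, derivable H t 1 & `|'D_1 H t| <= phi t].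
  move=> [/=]; rewrite in_itv/= => /andP[at_ tb] Nt.
  have [h1 h2] : derivable H t 1 /\ `|'D_1 H t| <= phi t.
    apply: contrapT => h; apply: Nt; apply: hN => /= h'; apply: h; apply: h'.
    by rewrite in_itv/= !ltW.
  by split=> //; rewrite at_.
pose g t := \1_A t * `|'D_1 H t|.
have g0 t : 0 <= g t by rewrite mulr_ge0// indicE.
have mg : measurable_fun setT g.
  by apply: (measurable_derive_on H a b) => // t /hA[].
have gphi : (\int[mu]_(t in setT) (g t)%:E <= l%:E)%E.
  apply: le_trans hl; rewrite ge0_integralE; last by move=> t _; rewrite lee_fin.
  rewrite [leRHS]ge0_integralE; last by move=> t _; rewrite lee_fin.
  apply: le_ereal_sup => _ [h hh <-]; exists h => // t.
  apply: le_trans (hh t) _; rewrite patch_setT patchE.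
  case: ifPn => [_|]; rewrite ?lee_fin /g indicE; case: (boolP (t \in A)); rewrite ?mul0r ?mul1r//.
    by rewrite inE => /hA[].
  rewrite inE => /hA[/andP[t1 t2] _ _] /negP; case; rewrite inE/= in_itv/= !ltW//.
have ig : mu.-integrable setT (EFin \o g).
  apply/integrableP; split; first exact/measurable_EFinP.
  apply: le_lt_trans (ltry l); apply: le_trans gphi.
  by under eq_integral do rewrite gee0_abs ?lee_fin//.
have igS D : measurable D -> mu.-integrable D (EFin \o g).
  by move=> mD; apply: integrableS ig.
have lg : locally_integrable setT g.
  by have := integrable_locally measurableT ig; rewrite patch_setT.
pose G y := \int[mu]_(t in `]-oo, y]) g t.
have Gmono x y : x <= y -> G x <= G y.
  move=> xy; rewrite /G /Rintegral; apply: fine_le.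
  - by apply: integrable_fin_num => //; exact: igS.
  - by apply: integrable_fin_num => //; exact: igS.
  - apply: ge0_subset_integral => //.
    + by apply/measurable_EFinP; apply: measurable_funTS.
    + by move=> t _; rewrite lee_fin.
    + by move=> t /=; rewrite !in_itv/= => /le_trans; apply.
have Ga : 0 <= G a.
  by apply: fine_ge0; apply: integral_ge0 => t _; rewrite lee_fin.
have Gb : G b <= l.
  have -> : l = fine l%:E by [].
  apply: fine_le => //.
    by apply: integrable_fin_num => //; exact: igS.
  apply: le_trans gphi; apply: ge0_subset_integral => //.
  + exact/measurable_EFinP.
  + by move=> t _; rewrite lee_fin.
have [N' [mN' N'0 hN']] := FTC1Ny (fun y => igS _ (measurable_itv _)) lg.
have hG t : ~ N' t -> derivable G t 1 /\ 'D_1 G t = g t.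
  by move=> N't; rewrite -derive1E; apply: contrapT => h; apply/N't/hN'.
clearbody G; suff : H b - H a <= G b - G a by lra.
apply: (abs_continuous_le H G a b (N `|` N' `|` [set a] `|` [set b])) => //.
  apply: negligibleU; last by exists [set b]; split=> //; exact: lebesgue_measure_set1.
  apply: negligibleU; last by exists [set a]; split=> //; exact: lebesgue_measure_set1.
  by apply: negligibleU; [exists N; split|exists N'; split].
  by move=> x y _ _; exact: Gmono.
move=> t /andP[at_ tb] hNt.
have At : A t.
  split=> /=; last by move=> Nt; apply: hNt; left; left; left.
  rewrite in_itv/= !lt_neqAle at_ tb !andbT; apply/andP; split; apply/eqP => tE; apply: hNt.
    by left; right.
  by right.
have [_ dH hH] := hA t At.
have [dG eG] : derivable G t 1 /\ 'D_1 G t = g t.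
  by apply: hG => N't; apply: hNt; left; left; right.
exists ('D_1 H t), (g t); split.
- exact: DeriveDef dH erefl.
- exact: DeriveDef dG eG.
- by rewrite /g indicE mem_set// mul1r ler_norm.
Qed.

End AbsoluteContinuity.

(** * Averages over grids *)

Section UnitIntegral.
Context {R : realType}.
Notation mu := (@lebesgue_measure R).
Implicit Types f g : R -> R.

Definition unit_int f : R := \int[mu]_(t in `[0, 1]) f t.

Lemma unit_integrable f : continuous f -> mu.-integrable `[0, 1] (EFin \o f).
Proof.
move=> cf; apply: continuous_compact_integrable; first exact: segment_compact.
exact: continuous_subspaceT.
Qed.

Lemma unit_int_le f g : continuous f -> continuous g ->
  (forall t, 0 <= t <= 1 -> f t <= g t) -> unit_int f <= unit_int g.
Proof.
move=> cf cg h; apply: le_Rintegral.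
- exact: measurable_itv.
- exact: unit_integrable.
- exact: unit_integrable.
- by move=> t /=; rewrite in_itv/=; exact: h.
Qed.

Lemma unit_int_cst (c : R) : unit_int (fun=> c) = c.
Proof.
rewrite /unit_int /Rintegral integral_cst//=.
by rewrite lebesgue_measure_itv/= lte_fin ltr01 -EFinD -EFinM/= subr0 mulr1.
Qed.

Lemma unit_int_shift f (c : R) : continuous f -> unit_int (fun t => f t + c) = unit_int f + c.
Proof.
move=> cf; rewrite /unit_int RintegralD//.
- by congr (_ + _); exact: unit_int_cst.
- exact: unit_integrable.
- by apply: unit_integrable => t; exact: cvg_cst.
Qed.

Lemma unit_int_dist f g e : continuous f -> continuous g ->
  (forall t, 0 <= t <= 1 -> `|f t - g t| <= e) -> `|unit_int f - unit_int g| <= e.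
Proof.
move=> cf cg h.
have le (a b : R -> R) : continuous a -> continuous b ->
    (forall t, 0 <= t <= 1 -> `|a t - b t| <= e) -> unit_int a - unit_int b <= e.
  move=> ca cb hab; rewrite lerBlDl -unit_int_shift//; apply: unit_int_le => //.
    by move=> t; apply: cvgD; [exact: cb|exact: cvg_cst].
  by move=> t /hab; rewrite ler_norml => /andP[_]; lra.
rewrite ler_norml; apply/andP; split; last exact: le.
have := le g f cg cf; rewrite lerNl opprB; apply.
by move=> t ht; rewrite distrC; exact: h.
Qed.

Lemma unit_int_cvg0 (f : nat -> R -> R) (B : R) : (forall j, continuous (f j)) ->
  (forall j t, 0 <= f j t <= B) ->
  {ae mu, forall t, 0 <= t <= 1 -> (fun j => f j t) @ \oo --> (0 : R)} ->
  (fun j => unit_int (f j)) @ \oo --> (0 : R).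
Proof.
move=> cf fB hf.
have mI : measurable (`[0, 1]%classic : set R) by exact: measurable_itv.
have := @dominated_convergence _ _ R mu `[0, 1]%classic mI (fun j => EFin \o f j) (cst 0%E)
  (EFin \o cst B).
case.
- by move=> j; apply/measurable_EFinP; apply: measurable_funTS; exact: continuous_measurable_fun.
- exact: measurable_cst.
- have [A [mA A0 hA]] := hf; exists A; split=> // t /= ht; apply: hA => /= h; apply: ht => t01.
  rewrite in_itv/= in t01; have {}h := h t01.
  by apply: (cvg_comp _ _ h); apply: cvg_EFin => //; near=> x.
- by apply: unit_integrable => t; exact: cvg_cst.
- by apply: aeW => t j _ /=; rewrite lee_fin; have /andP[h1 h2] := fB j t; rewrite ger0_norm.
move=> _ _; rewrite integral0 => h.
exact: (fine_cvg h).
Unshelve. all: by end_near.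
Qed.

Lemma unit_int_riemann f (N : nat) (e : R) : (0 < N)%N -> continuous f ->
  (forall s t, `|s - t| <= N%:R^-1 -> `|f s - f t| <= e) ->
  \sum_(i < N) f (i%:R / N%:R) <= N%:R * (unit_int f + e).
Proof.
move=> N0 cf hf; have [G G0 dG] := antiderivative f cf.
have NR : 0 < N%:R :> R by rewrite ltr0n.
have Ni : 0 < N%:R^-1 :> R by rewrite invr_gt0.
have dG' (t : R) : 0 <= t -> is_derive t 1 G (f t) by move=> t0; apply: dG; lra.
have cG (t : R) : 0 <= t -> {for t, continuous G}.
  by move=> /dG'[/derivable1_diffP/differentiable_continuous + _].
have -> : unit_int f = G 1 - G 0.
  rewrite /unit_int /Rintegral (@continuous_FTC2 _ f G 0 1)//.
  - exact: continuous_subspaceT.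
  - split.
    + by move=> x; rewrite in_itv/= => /andP[x0 _]; have [] := dG' x (ltW x0).
    + by apply: cvg_at_right_filter; apply: cG.
    + by apply: cvg_at_left_filter; apply: cG.
  - move=> x; rewrite in_itv/= => /andP[x0 _]; rewrite derive1E.
    by have [_ ->] := dG' x (ltW x0).
have -> : G 1 - G 0 = \sum_(i < N) (G (i.+1%:R / N%:R) - G (i%:R / N%:R)).
  have tel (z : R) k : \sum_(i < k) (G (i.+1%:R * z) - G (i%:R * z)) = G (k%:R * z) - G (0 * z).
    by elim: k => [|k IH]; [rewrite big_ord0 subrr|rewrite big_ord_recr/= IH; ring].
  by rewrite tel divff ?gt_eqF// mul0r.
have -> : N%:R * (\sum_(i < N) (G (i.+1%:R / N%:R) - G (i%:R / N%:R)) + e) =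
    \sum_(i < N) (N%:R * (G (i.+1%:R / N%:R) - G (i%:R / N%:R)) + e).
  by rewrite [RHS]big_split/= -mulr_sumr sumr_const card_ord [in LHS]mulrDr [N%:R * e]mulr_natl.
apply: ler_sum => i _.
have i0 : 0 <= i%:R / N%:R :> R by rewrite divr_ge0.
have iS : i.+1%:R / N%:R = i%:R / N%:R + N%:R^-1 :> R by rewrite -natr1 mulrDl mul1r.
have := @mvt_real R G f (i%:R / N%:R) (i.+1%:R / N%:R) (f (i%:R / N%:R)) e.
rewrite iS; have -> : i%:R / N%:R + N%:R^-1 - i%:R / N%:R = N%:R^-1 :> R by rewrite addrAC subrr add0r.
rewrite lerDl => /(_ (ltW Ni)) h.
have {h} : `|G (i%:R / N%:R + N%:R^-1) - G (i%:R / N%:R) - N%:R^-1 * f (i%:R / N%:R)| <= N%:R^-1 * e.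
  apply: h => u /andP[u1 u2]; first by apply: dG'; exact: le_trans i0 u1.
  by apply: hf; rewrite ger0_norm ?subr_ge0// lerBlDl.
rewrite ler_norml => /andP[+ _]; rewrite lerNl opprB lerBlDl => h.
rewrite -(ler_pM2l Ni); apply: le_trans h _.
by rewrite [leRHS]mulrDr mulrA mulVf ?mul1r ?gt_eqF.
Qed.

End UnitIntegral.

(** * Integrals over a cube and sums over its grid points *)

Section Grid.
Context {R : realType}.
Notation mu := (@lebesgue_measure R).
Implicit Types (G : (nat -> R) -> R) (w : nat -> R).

(** Points have coordinates indexed by all of [nat], so that fixing or integrating one of them does
    not change the type. *)
Definition upd w (k : nat) (t : R) : nat -> R := fun i => if i == k then t else w i.

Definition modulus G (d e : R) :=
  forall w w', (forall i, `|w i - w' i| <= d) -> `|G w - G w'| <= e.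

Definition unif_cont G := forall e : R, 0 < e -> exists2 d : R, 0 < d & modulus G d e.

(** Iterated one-dimensional integrals of uniformly continuous functions stand for Lebesgue measure
    on the cube; coordinates from k on remain parameters. *)
Fixpoint iter_int (k : nat) G w : R :=
  if k is k'.+1 then unit_int (fun t => iter_int k' G (upd w k' t)) else G w.

Fixpoint grid (k N : nat) : finType :=
  if k is k'.+1 then ('I_N * grid k' N)%type : finType else unit : finType.

Fixpoint grid_pt (k N : nat) : grid k N -> (nat -> R) -> nat -> R :=
  if k is k'.+1 return grid k N -> (nat -> R) -> nat -> R
  then fun p w => grid_pt k' N p.2 (upd w k' (p.1%:R / N%:R)) else fun _ w => w.

Lemma upd_dist w w' k t t' (d : R) : (forall i, `|w i - w' i| <= d) -> `|t - t'| <= d ->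
  forall i, `|upd w k t i - upd w' k t' i| <= d.
Proof. by move=> h ht i; rewrite /upd; case: eqP. Qed.

Lemma modulus_le G d d' e : d' <= d -> modulus G d e -> modulus G d' e.
Proof. by move=> dd h w w' hw; apply: h => i; apply: le_trans (hw i) dd. Qed.

Lemma upd_continuous G w k : unif_cont G -> continuous (fun t => G (upd w k t)).
Proof.
move=> hG x; apply/cvgrPdist_le => e e0; have [d d0 hd] := hG e e0.
apply/(@nbhs_eps R R^o); exists d => // y yx; apply: hd; apply: upd_dist.
  by move=> i; rewrite subrr normr0 ltW.
by rewrite distrC ltW.
Qed.

Lemma iter_int_unif k G : unif_cont G -> unif_cont (iter_int k G) /\
  forall d e, 0 <= d -> modulus G d e -> modulus (iter_int k G) d e.
Proof.
move=> hG.
have main : forall d e, 0 <= d -> modulus G d e -> modulus (iter_int k G) d e.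
  elim: k => [//|k IH] d e d0 hd w w' hw /=.
  have uk : unif_cont (iter_int k G).
    move=> e' e'0; have [d' d'0 hd'] := hG e' e'0; exists d' => //.
    by apply: IH => //; exact: ltW.
  apply: unit_int_dist; [exact: upd_continuous|exact: upd_continuous|].
  move=> t _; apply: (IH d e d0 hd); apply: upd_dist => //.
  by rewrite subrr normr0.
split=> // e e0; have [d d0 hd] := hG e e0; exists d => //.
by apply: main => //; exact: ltW.
Qed.

Lemma iter_int_bound k G B : unif_cont G -> (forall w, 0 <= G w <= B) ->
  forall w, 0 <= iter_int k G w <= B.
Proof.
move=> hG hB; elim: k => [//|k IH] w /=.
have ck := upd_continuous (iter_int k G) w k (iter_int_unif k G hG).1.
have icst := @unit_int_cst R.
apply/andP; split.
  rewrite -[leLHS](icst 0); apply: unit_int_le => //.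
    by move=> t; exact: cvg_cst.
  by move=> t _; case/andP: (IH (upd w k t)).
rewrite -[leRHS](icst B); apply: unit_int_le => //.
  by move=> t; exact: cvg_cst.
by move=> t _; case/andP: (IH (upd w k t)).
Qed.

Lemma iter_int_cvg0 k (G : nat -> (nat -> R) -> R) B : (forall j, unif_cont (G j)) ->
  (forall j w, 0 <= G j w <= B) -> (forall w, (fun j => G j w) @ \oo --> (0 : R)) ->
  forall w, (fun j => iter_int k (G j) w) @ \oo --> (0 : R).
Proof.
move=> hG hB h0; elim: k => [//|k IH] w /=.
apply: (unit_int_cvg0 _ B).
- by move=> j; apply: upd_continuous; exact: (iter_int_unif k (G j) (hG j)).1.
- by move=> j t; apply: iter_int_bound.
- by apply: aeW => t _; exact: IH.
Qed.

Lemma iter_int_grid k N G e : (0 < N)%N -> unif_cont G -> modulus G N%:R^-1 e ->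
  forall w, \sum_(p : grid k N) G (grid_pt k N p w) <= N%:R ^+ k * (iter_int k G w + k%:R * e).
Proof.
move=> N0 hG he; elim: k => [|k IH] w.
  by rewrite /= (big_pred1 tt) ?mul1r ?mul0r ?addr0//; case.
rewrite /= -(pair_bigA _ (fun (i : 'I_N) (p : grid k N) => G (grid_pt k N p (upd w k (i%:R / N%:R)))))/=.
pose f t := iter_int k G (upd w k t).
have NR : 0 < N%:R :> R by rewrite ltr0n.
have h : \sum_(i < N) f (i%:R / N%:R) <= N%:R * (unit_int f + e).
  apply: unit_int_riemann => //; first exact: upd_continuous (iter_int_unif k G hG).1.
  move=> s t st; apply: (iter_int_unif k G hG).2 he _ _ _; first by rewrite invr_ge0 ltW.
  by apply: upd_dist => // i; rewrite subrr normr0 invr_ge0 ltW.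
apply: le_trans (_ : \sum_(i < N) N%:R ^+ k * (f (i%:R / N%:R) + k%:R * e) <= _).
  by apply: ler_sum => i _; exact: IH.
rewrite -mulr_sumr big_split/= sumr_const card_ord exprS [X in _ <= X * _]mulrC -mulrA.
apply: ler_wpM2l; first by rewrite exprn_ge0// ltW.
have -> : unit_int (fun t => iter_int k G (upd w k t)) = unit_int f by [].
rewrite -[k.+1%:R]natr1 -[_ * e *+ N]mulr_natl.
have -> : N%:R * (unit_int f + (k%:R + 1) * e) = N%:R * (unit_int f + e) + N%:R * (k%:R * e) by ring.
by rewrite lerD2r.
Qed.

(** Integrating in x comes first, because convergence is known for almost every x with w fixed.
    Dominated convergence then applies to each further coordinate. For the index j so obtained, a
    fine grid replaces the integral in w, and some x does no worse than the mean; hence the order of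
    choice: j, then N, then x. *)
Lemma grid_average_small k (g : nat -> R -> (nat -> R) -> R) B :
  (forall j x, unif_cont (g j x)) ->
  (forall j (e : R), 0 < e -> exists2 d : R, 0 < d & forall x x', `|x - x'| <= d ->
     forall w, `|g j x w - g j x' w| <= e) ->
  (forall j (e : R), 0 < e -> exists2 d : R, 0 < d & forall x, modulus (g j x) d e) ->
  (forall j x w, 0 <= g j x w <= B) ->
  (forall w, {ae mu, forall x, 0 <= x <= 1 -> (fun j => g j x w) @ \oo --> (0 : R)}) ->
  forall (eta : R) w, 0 < eta -> exists J, forall j, (J <= j)%N -> exists N0, forall N, (N0 <= N)%N ->
    (0 < N)%N -> exists2 x, 0 <= x <= 1 &
      \sum_(p : grid k N) g j x (grid_pt k N p w) <= eta * N%:R ^+ k.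
Proof.
move=> gu gx gw gB ga eta w eta0.
pose Psi j w := unit_int (fun x => g j x w).
have gc j w' : continuous (fun x => g j x w').
  move=> x; apply/cvgrPdist_le => e e0; have [d d0 hd] := gx j e e0.
  by apply/(@nbhs_eps R R^o); exists d => // y yx; apply: hd; rewrite distrC ltW.
have Psim j d e : (forall x, modulus (g j x) d e) -> modulus (Psi j) d e.
  by move=> h w1 w2 hw; apply: unit_int_dist => // t _; exact: h.
have Psiu j : unif_cont (Psi j).
  by move=> e e0; have [d d0 hd] := gw j e e0; exists d => //; exact: Psim.
have icst := @unit_int_cst R.
have cc (c : R) : continuous (fun _ : R => c) by move=> t; exact: cvg_cst.
have PsiB j w' : 0 <= Psi j w' <= B.
  apply/andP; split.
    by rewrite -[leLHS](icst 0); apply: unit_int_le => // t _; case/andP: (gB j t w').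
  by rewrite -[leRHS](icst B); apply: unit_int_le => // t _; case/andP: (gB j t w').
have Psi0 w' : (fun j => Psi j w') @ \oo --> (0 : R).
  by apply: (unit_int_cvg0 _ B) => //; exact: ga.
have eta4 : 0 < eta / 4 by rewrite divr_gt0.
have /cvgrPdist_lt/(_ _ eta4)[J _ hJ] := iter_int_cvg0 k Psi B Psiu PsiB Psi0 w.
exists J => j /hJ /=; rewrite sub0r normrN => hj.
have {}hj := le_lt_trans (ler_norm _) hj.
have e10 : 0 < eta / 4 / (k.+1)%:R by rewrite divr_gt0.
have [d d0 hd] := gw j _ e10.
exists (Num.truncn d^-1).+1 => N hN N0.
have NR : 0 < N%:R :> R by rewrite ltr0n.
have Nd : N%:R^-1 <= d.
  rewrite -[d]invrK lef_pV2 ?posrE ?invr_gt0//.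
  by apply/ltW; apply: lt_le_trans (truncnS_gt _) _; rewrite ler_nat.
have hsum := iter_int_grid k N (Psi j) _ N0 (Psiu j) (modulus_le _ _ _ _ Nd (Psim j _ _ hd)) w.
have hk : k%:R * (eta / 4 / k.+1%:R) <= eta / 4.
  rewrite mulrCA; apply: ler_piMr; first exact: ltW.
  by rewrite ler_pdivrMr// mul1r ler_nat.
have {}hsum : \sum_(p : grid k N) Psi j (grid_pt k N p w) <= eta / 2 * N%:R ^+ k.
  apply: le_trans hsum _; rewrite mulrC; apply: ler_wpM2r; first by rewrite exprn_ge0// ltW.
  by move: hk hj; move: (k%:R * _) (iter_int _ _ _) => x y; lra.
have cS (I : seq (grid k N)) : continuous (fun x => \sum_(p <- I) g j x (grid_pt k N p w)) /\
    unit_int (fun x => \sum_(p <- I) g j x (grid_pt k N p w)) = \sum_(p <- I) Psi j (grid_pt k N p w).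
  elim: I => [|p I [c1 c2]].
    under [X in continuous X]eq_fun do rewrite big_nil.
    under [X in unit_int X]eq_fun do rewrite big_nil.
    by rewrite big_nil icst.
  under [X in continuous X]eq_fun do rewrite big_cons.
  under [X in unit_int X]eq_fun do rewrite big_cons.
  split; first by move=> x; apply: cvgD; [exact: gc|exact: c1].
  rewrite big_cons -c2 /unit_int RintegralD//; exact: unit_integrable.
have [c1 c2] := cS (index_enum (grid k N)).
(* If every x gave more than eta N^k, so would the mean over x, which is at most half of that. *)
apply: contrapT => hno.
have : eta * N%:R ^+ k <= eta / 2 * N%:R ^+ k.
  apply: le_trans hsum; rewrite -c2 -[leLHS]icst; apply: unit_int_le => // x x01.
  by apply: contrapT => /negP; rewrite -ltNge => /ltW h; apply: hno; exists x.
have : 0 < N%:R ^+ k :> R by rewrite exprn_gt0.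
move=> h; rewrite ler_pM2r//; lra.
Qed.

Lemma grid_pt_out k N (p : grid k N) w i : (k <= i)%N -> grid_pt k N p w i = w i.
Proof.
elim: k p w => [//|k IH] p w ki; rewrite /= IH; last exact: ltnW.
by rewrite /upd gtn_eqF.
Qed.

Lemma grid_pt_top k N (p : grid k.+1 N) w : grid_pt k.+1 N p w k = p.1%:R / N%:R.
Proof. by rewrite /= grid_pt_out// /upd eqxx. Qed.

Lemma grid_pt_indep k N (p : grid k N) w w' i : (i < k)%N -> grid_pt k N p w i = grid_pt k N p w' i.
Proof.
elim: k p w w' => [//|k IH] p w w'; rewrite ltnS leq_eqVlt => /orP[/eqP->|ik].
  by rewrite !grid_pt_top.
exact: IH.
Qed.

Lemma digit_near N (t : R) : (0 < N)%N -> 0 <= t <= 1 -> exists i : 'I_N, `|i%:R / N%:R - t| <= N%:R^-1.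
Proof.
case: N => [//|N] _ /andP[t0 t1].
have NR : 0 < N.+1%:R :> R by rewrite ltr0n.
have /andP[m1 m2] := truncn_itv (mulr_ge0 t0 (ltW NR)).
set m := Num.truncn _ in m1 m2.
have key (i : 'I_N.+1) : `|i%:R - t * N.+1%:R| <= 1 -> `|i%:R / N.+1%:R - t| <= N.+1%:R^-1.
  move=> h; rewrite -(ler_pM2r NR) mulVf ?gt_eqF//.
  by rewrite -[X in _ * X <= _](gtr0_norm NR) -normrM mulrBl divfK ?gt_eqF.
have [mN|Nm] := ltnP m N.+1.
  exists (Ordinal mN); apply: key; rewrite ler_norml /=.
  by move: m2; rewrite -natr1 => m2; apply/andP; split; lra.
(* Only t = 1 arrives here: its digit is one past the last. *)
exists ord_max; apply: key; rewrite ler_norml /=.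
have : N.+1%:R <= m%:R :> R by rewrite ler_nat.
have : t * N.+1%:R <= N.+1%:R by rewrite ler_piMl// ltW.
by rewrite -natr1 => h1 h2; apply/andP; split; lra.
Qed.

Lemma grid_near k N (y : nat -> R) : (0 < N)%N -> (forall i, (i < k)%N -> 0 <= y i <= 1) ->
  exists p : grid k N, forall i w, (i < k)%N -> `|grid_pt k N p w i - y i| <= N%:R^-1.
Proof.
move=> N0; elim: k => [|k IH] hy; first by exists tt.
have [|p hp] := IH; first by move=> i ik; apply: hy; exact: ltnW.
have [i hi] := digit_near N (y k) N0 (hy k (ltnSn k)).
exists (i, p) => j w; rewrite ltnS leq_eqVlt => /orP[/eqP->|jk].
  by rewrite grid_pt_top.
exact: hp.
Qed.

(** The tolerance 4 comes from [grid_pair]: two points whose images have the same nearest grid point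
    have images 2 / M apart at most, so they are themselves within 4 / M. This allows 9 values for
    each digit. *)
Fixpoint grid_close (k N : nat) : grid k N -> grid k N -> bool :=
  if k is k'.+1 return grid k N -> grid k N -> bool
  then fun p q => [&& (p.1 <= q.1 + 4)%N, (q.1 <= p.1 + 4)%N & grid_close k' N p.2 q.2]
  else fun _ _ => true.

Lemma grid_close_card k N (q : grid k N) : (#|[set p | grid_close k N p q]%SET| <= 9 ^ k)%N.
Proof.
elim: k q => [|k IH] q /=; first by rewrite (leq_trans (max_card _))// card_unit.
set A := [set i : 'I_N | (i <= q.1 + 4)%N && (q.1 <= i + 4)%N]%SET.
apply: (@leq_trans #|finset.setX A [set p | grid_close k N p q.2]%SET|).
  by apply: subset_leq_card; apply/fintype.subsetP => p; rewrite !inE andbA.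
rewrite cardsX expnS leq_mul//.
pose f (i : 'I_N) : 'I_9 := inord (i + 4 - q.1).
have finj : {in A &, injective f}.
  move=> i j; rewrite !inE => /andP[i1 i2] /andP[j1 j2] /(congr1 val).
  rewrite /= !inordK ?ltnS ?leq_subLR; [|lia|lia].
  by move=> e; apply: val_inj => /=; lia.
by rewrite -(card_in_imset finj) (leq_trans (max_card _))// card_ord.
Qed.

Lemma grid_closeP k N (p q : grid k N) : (0 < N)%N ->
  (forall i, (i < k)%N -> `|grid_pt k N p (fun=> 0) i - grid_pt k N q (fun=> 0) i| <= 4 / N%:R) ->
  grid_close k N p q.
Proof.
move=> N0; have NR : 0 < N%:R :> R by rewrite ltr0n.
elim: k p q => [//|k IH] p q h /=.
have := h k (ltnSn k); rewrite !grid_pt_top -mulrBl normrM [`|_^-1|]gtr0_norm ?invr_gt0//.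
rewrite ler_pM2r ?invr_gt0// ler_norml => /andP[h1 h2].
have a1 : (p.1 <= q.1 + 4)%N by rewrite -(ler_nat R) natrD; lra.
have a2 : (q.1 <= p.1 + 4)%N by rewrite -(ler_nat R) natrD; lra.
rewrite a1 a2 /=; apply: IH => i ik.
have := h i (ltnW ik); rewrite /=.
by rewrite (grid_pt_indep _ _ p.2 _ (fun=> 0))// (grid_pt_indep _ _ q.2 _ (fun=> 0)).
Qed.

(** The middle third of a grid three times as long in each direction. Its points are at distance at
    least 1/3 from the boundary of the cube, so a map moving points by at most 1/3 keeps them in the
    cube. *)
Fixpoint grid_mid (k N : nat) : grid k N -> grid k (N + (N + N)) :=
  if k is k'.+1 return grid k N -> grid k (N + (N + N))
  then fun p => (rshift N (lshift N p.1), grid_mid k' N p.2) else fun _ => tt.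

Lemma grid_mid_inj k N : injective (grid_mid k N).
Proof.
elim: k => [|k IH]; first by move=> [] [].
move=> [i p] [j q] /= [/eqP e1 /IH ->].
by congr (_, _); apply: val_inj; apply/eqP; move: e1; rewrite /= eqn_add2l.
Qed.

Lemma grid_mid_range k N (p : grid k N) w i : (0 < N)%N -> (i < k)%N ->
  3^-1 <= grid_pt k (N + (N + N)) (grid_mid k N p) w i <= 2 / 3.
Proof.
move=> N0; have NR : 0 < N%:R :> R by rewrite ltr0n.
elim: k p w => [//|k IH] p w; rewrite ltnS leq_eqVlt => /orP[/eqP->|ik]; last exact: IH.
rewrite grid_pt_top /= !natrD.
have p0 : 0 <= p.1%:R :> R by [].
have p1 : p.1%:R <= N%:R :> R by rewrite ler_nat ltnW.
have N3 : 0 < N%:R + (N%:R + N%:R) :> R by lra.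
by rewrite ler_pdivlMr// ler_pdivrMr//; apply/andP; split; lra.
Qed.

Lemma card_grid k N : #|grid k N| = (N ^ k)%N.
Proof. by elim: k => [|k IH] /=; rewrite ?card_unit// card_prod IH card_ord expnS. Qed.

Lemma card_preimset_fiber (T U : finType) (f : T -> U) (B : {set U}) C :
  (forall q, (#|[set p | f p == q]%SET| <= C)%N) -> (#|f @^-1: B| <= #|B| * C)%N.
Proof.
move=> h; rewrite -sum1_card (partition_big f (mem B))/=; last by move=> p; rewrite inE.
rewrite -sum_nat_const; apply: leq_sum => q qB.
apply: leq_trans (h q); rewrite -sum1_card big_mkcond [X in (_ <= X)%N]big_mkcond/=.
by apply: leq_sum => p _; rewrite !inE; case: ifP => // /andP[_ ->].
Qed.

(** A counting form of the change of variables z -> th z. Call a grid point bad if h exceeds eta / 2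
    there; the bound on the sum gives (1 + 9^n) |B| <= N^n / 2, the factor 3^n being the ratio of
    the large grid to its middle third. So some inner point is good and the grid point nearest to
    its image is good too; the last eta / 2 covers the rounding. *)
Lemma grid_pair n N (h : 'rV[R]_n -> R) (th : 'rV[R]_n -> 'rV[R]_n) (eta : R) (M := (N + (N + N))%N)
    (inner := fun z : 'rV[R]_n => forall i, 3^-1 <= z ord0 i <= 2 / 3)
    (pt := fun p : grid n M => \row_i grid_pt n M p (fun=> 0) i : 'rV[R]_n) :
  (0 < N)%N -> 0 < eta -> (forall z, 0 <= h z) ->
  (forall z z', `|z - z'| <= M%:R^-1 -> `|h z - h z'| <= eta / 2) ->
  (forall z, inner z -> forall i, 0 <= th z ord0 i <= 1) ->
  (forall z z', inner z -> inner z' -> `|z - z'| <= 2 * `|th z - th z'|) ->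
  \sum_(p : grid n M) h (pt p) <= eta / (4 * (1 + 9 ^+ n) * 3 ^+ n) * M%:R ^+ n ->
  exists z, [/\ inner z, h z <= eta & h (th z) <= eta].
Proof.
move=> N0 eta0 h0 hh thB thL hsum.
have M0 : (0 < M)%N by rewrite addn_gt0 N0.
have MR : 0 < M%:R :> R by rewrite ltr0n.
have Mi : 0 < M%:R^-1 :> R by rewrite invr_gt0.
pose P (p : grid n N) := pt (grid_mid n N p).
have Pin p : inner (P p) by move=> i; rewrite !mxE; exact: grid_mid_range.
have ptd (z z' : 'rV[R]_n) e : 0 <= e -> (forall i, `|z ord0 i - z' ord0 i| <= e) -> `|z - z'| <= e.
  by move=> e0 hi; apply/rV_norm_le => // i; rewrite !mxE.
have /choice[nr hnr] : forall p : grid n N, exists q : grid n M, `|pt q - th (P p)| <= M%:R^-1.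
  move=> p; pose y i := if insub i is Some j then th (P p) ord0 j else 0.
  have yE (i : 'I_n) : y i = th (P p) ord0 i by rewrite /y valK.
  have [|q hq] := @grid_near n M y M0.
    by move=> i ik; have := yE (Ordinal ik) => /= ->; exact: thB.
  exists q; apply: ptd; first exact: ltW.
  by move=> i; rewrite !mxE -yE; exact: hq.
pose B := [set p : grid n M | eta / 2 < h (pt p)]%SET.
have cB : #|B|%:R * (eta / 2) <= \sum_(p : grid n M) h (pt p).
  rewrite mulr_natl -sumr_const big_mkcond; apply: ler_sum => p _.
  by rewrite inE; case: ifP => // /ltW.
apply: contrapT => hno.
(* Otherwise each inner point is charged to a bad grid point: to its own place, by an injective map,
   or to the one nearest to its image, which serves at most 9^n inner points. *)
have cover : (N ^ n <= #|B| + #|B| * 9 ^ n)%N.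
  rewrite -card_grid -cardsT.
  apply: leq_trans (_ : #|(grid_mid n N @^-1: B) :|: (nr @^-1: B)| <= _)%N.
    apply: subset_leq_card; apply/fintype.subsetP => p _; rewrite !inE.
    apply: contrapT => /negP; rewrite negb_or -!leNgt => /andP[p1 p2].
    apply: hno; exists (P p); split=> //.
      by apply: le_trans p1 _; rewrite ler_pdivrMr// ler_pMr// ler1n.
    have := hh (pt (nr p)) (th (P p)) (hnr p); rewrite ler_norml => /andP[h1 _].
    lra.
  apply: leq_trans (leq_card_setU _ _) _; rewrite leq_add//.
    rewrite -[leqRHS]muln1; apply: card_preimset_fiber => q.
    apply/card_le1_eqP => p p'; rewrite !inE => /eqP e1 /eqP e2.
    by apply: (@grid_mid_inj n N); rewrite e1 e2.
  apply: card_preimset_fiber => q.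
  have [->|/set0Pn[p0]] := eqVneq [set p | nr p == q]%SET finset.set0; first by rewrite cards0.
  rewrite inE => /eqP np0.
  rewrite -(card_imset _ (@grid_mid_inj n N)).
  apply: leq_trans (grid_close_card n M (grid_mid n N p0)).
  apply: subset_leq_card; apply/fintype.subsetP => _ /imsetP[p + ->]; rewrite !inE => /eqP np.
  apply: grid_closeP => // i ik.
  have d1 : `|th (P p) - th (P p0)| <= 2 * M%:R^-1.
    have -> : th (P p) - th (P p0) = (pt (nr p0) - th (P p0)) - (pt (nr p) - th (P p)).
      by rewrite np np0; move: (th _) (th _) (pt q) => a b c; apply/rowP => l; rewrite !mxE; ring.
    apply: le_trans (ler_normB _ _) _; have := hnr p; have := hnr p0; lra.
  have d2 := thL _ _ (Pin p) (Pin p0).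
  have := rV_norm_coord (P p - P p0) (Ordinal ik); rewrite !mxE => d3.
  apply: le_trans d3 _; apply: le_trans d2 _; lra.
have c9 : 0 < 1 + 9 ^+ n :> R by rewrite ltr_wpDr// exprn_ge0.
have c3 : 0 < 3 ^+ n :> R by rewrite exprn_gt0.
have cN : 0 < N%:R ^+ n :> R by rewrite exprn_gt0// ltr0n.
have ME : M%:R ^+ n = 3 ^+ n * N%:R ^+ n :> R.
  by rewrite -exprMn; congr (_ ^+ _); rewrite /M !natrD; ring.
have {}cover : N%:R ^+ n <= #|B|%:R * (1 + 9 ^+ n) :> R.
  by move: cover; rewrite -(ler_nat R) natrX natrD natrM natrX mulrDr mulr1.
have {}cB := le_trans cB hsum.
have : #|B|%:R * (eta / 2) * (1 + 9 ^+ n) <= eta / 4 * N%:R ^+ n.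
  apply: le_trans (_ : eta / (4 * (1 + 9 ^+ n) * 3 ^+ n) * M%:R ^+ n * (1 + 9 ^+ n) <= _).
    by rewrite ler_pM2r.
  rewrite ME le_eqVlt; apply/orP; left; apply/eqP; field.
  by rewrite !gt_eqF.
move: cover; move: (N%:R ^+ n) (1 + 9 ^+ n) (#|B|%:R) cN => a c b a0 h1 h2.
have e2 : 0 < eta / 2 by rewrite divr_gt0.
have : eta / 2 * a <= eta / 4 * a.
  apply: le_trans h2; have -> : b * (eta / 2) * c = eta / 2 * (b * c) by ring.
  by rewrite ler_pM2l.
rewrite ler_pM2r//; lra.
Qed.

End Grid.

(** * Difference quotients along flows *)

Lemma lebesgue_null_negligible {R : realType} (A : set 'rV[R]_1) : lebesgue_null A ->
  (@lebesgue_measure R).-negligible [set x | A (const_mx x)].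
Proof.
move=> hA; pose mu := @lebesgue_measure R.
have /choice[C hC] : forall k : nat, exists C : set R,
    [/\ measurable C, [set x | A (const_mx x)] `<=` C & (mu C <= (k.+1%:R^-1)%:E)%E].
  move=> k; have k0 : 0 < k.+1%:R^-1 :> R by rewrite invr_gt0.
  have [I [a [b [ab cov hs]]]] := hA _ k0.
  pose D i : set R := if I i then `[a i ord0 ord0, b i ord0 ord0]%classic else set0.
  have mD i : measurable (D i) by rewrite /D; case: ifP => _; [exact: measurable_itv|exact: measurable0].
  exists (\bigcup_i D i); split.
  - by apply: bigcup_measurable => i _; exact: mD.
  - move=> x /= /cov[i /= Ii hi]; exists i => //; rewrite /D Ii/= in_itv/=.
    by have := hi ord0; rewrite mxE.
  - apply: le_trans hs; rewrite eseries_mkcond.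
    have mU : measurable (\bigcup_i D i) by apply: bigcup_measurable => i _; exact: mD.
    apply: le_trans (measure_sigma_subadditive (@lebesgue_measure R) mD mU (@subset_refl _ _)) _.
    apply: lee_nneseries => [i _ //|i _]; rewrite /D; case: ifP => _; last by rewrite measure0.
    have := @lebesgue_measure_itv R `[a i ord0 ord0, b i ord0 ord0]; rewrite /= => ->.
    rewrite big_ord1 lte_fin; case: ltP => [h|_]; first by rewrite EFinD.
    by rewrite lee_fin subr_ge0; exact: ab.
exists (\bigcap_k C k); split.
- by apply: bigcap_measurable => // k _; have [] := hC k.
- apply/eqP; rewrite eq_le measure_ge0 andbT; apply/lee_addgt0Pr => e e0; rewrite add0e.
  have [k _ hk] := near_infty_natSinv_lt (PosNum e0).
  have [mC _ Ck] := hC k.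
  apply: le_trans (le_trans Ck _); last by rewrite lee_fin ltW//; exact: (hk k (leqnn k)).
  apply: le_measure; rewrite ?inE//; last by move=> x; apply.
  by apply: bigcap_measurable => // i _; have [] := hC i.
- by move=> x Ax k _; have [_ h _] := hC k; exact: h.
Qed.

(** The Radon-Nikodym property enters here, on the line: wherever f is differentiable, both
    sequences of quotients tend to its derivative. The limit itself is eliminated, so that only the
    difference of the quotients has to be averaged. *)
Lemma difference_quotients {R : realType} (V : completeNormedModType R)
    (RNP : radon_nikodym_property V) (f : R -> V) (K : R) (u v : nat -> R) :
  0 <= K -> (forall x y, `|f x - f y| <= K * `|x - y|) ->
  (forall j, 0 < u j) -> (forall j, 0 < v j) ->
  u @ \oo --> (0 : R) -> v @ \oo --> (0 : R) ->
  {ae @lebesgue_measure R, forall x,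
    (fun j => `|(u j)^-1 *: (f (x + u j) - f x) - (v j)^-1 *: (f (x + v j) - f x)|) @ \oo --> (0 : R)}.
Proof.
move=> K0 fL u0 v0 uc vc.
pose g (w : 'rV[R]_1) := f (w ord0 ord0).
have gL : lipschitz g.
  exists K; split; first exact: num_real.
  move=> k Kk [x y] _ /=; apply: le_trans (fL _ _) _.
  have := rV_norm_coord (x - y) ord0; rewrite !mxE => h.
  by apply: ler_pM => //; exact: ltW.
have := lebesgue_null_negligible _ (RNP 1%N g gL); apply: negligibleS => x /= hx dg; apply: hx.
have quot (w : nat -> R) : (forall j, 0 < w j) -> w @ \oo --> (0 : R) ->
    forall e, 0 < e -> \forall j \near \oo,
      `|(w j)^-1 *: (f (x + w j) - f x) - 'd g (const_mx x) (const_mx 1)| <= e.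
  move=> w0 wc e e0; have [d d0 hd] := diff_eps _ _ _ _ dg e e0.
  move/cvgrPdist_lt: wc => /(_ _ d0); apply: filterS => j; rewrite sub0r normrN => wj.
  have wE : const_mx (x + w j) - const_mx x = w j *: const_mx 1 :> 'rV[R]_1.
    by apply/rowP => i; rewrite !mxE; ring.
  have n1 : `|w j *: const_mx 1 : 'rV[R]_1| = `|w j|.
    rewrite normrZ; suff -> : `|const_mx 1 : 'rV[R]_1| = 1 by rewrite mulr1.
    apply/le_anti/andP; split.
      by apply/rV_norm_le => // i; rewrite mxE normr1.
    by have := rV_norm_coord (const_mx 1 : 'rV[R]_1) ord0; rewrite mxE normr1.
  have := hd (const_mx (x + w j)); rewrite wE n1 => /(_ wj).
  rewrite /g !mxE [X in _ - X](_ : _ = w j *: 'd g (const_mx x) (const_mx 1)); last exact: linearZ.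
  move=> h; rewrite -(ler_pM2l (w0 j)) -{1}(gtr0_norm (w0 j)) -normrZ scalerBr scalerA.
  by rewrite divff ?gt_eqF// scale1r mulrC -[X in _ <= _ * X](gtr0_norm (w0 j)).
apply/cvgrPdist_le => e e0; have e2 : 0 < e / 2 by rewrite divr_gt0.
have hu := quot u u0 uc _ e2; have hv := quot v v0 vc _ e2.
near=> j; rewrite sub0r normrN normr_id.
have h1 : `|(u j)^-1 *: (f (x + u j) - f x) - 'd g (const_mx x) (const_mx 1)| <= e / 2 by near: j.
have h2 : `|(v j)^-1 *: (f (x + v j) - f x) - 'd g (const_mx x) (const_mx 1)| <= e / 2 by near: j.
rewrite -[X in X - _](subrK ('d g (const_mx x) (const_mx 1))) -addrA.
apply: le_trans (ler_normD _ _) _; rewrite [X in _ + X <= _]distrC; lra.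
Unshelve. all: by end_near.
Qed.

(** Heine-Cantor on the closed ball, in a form where y' may leave it; compactness is used as the
    near-covering property with the radius as parameter. *)
Lemma closed_ball_unif_cont {R : realType} {n : nat} (V : normedModType R) (F : 'rV[R]_n -> V)
    (q : 'rV[R]_n) (r : R) :
  (forall y, `|y - q| <= r -> forall e, 0 < e -> exists2 d, 0 < d &
     forall y', `|y' - y| < d -> `|F y' - F y| <= e) ->
  forall e, 0 < e -> exists2 d, 0 < d & forall y y', `|y - q| <= r -> `|y' - y| < d -> `|F y' - F y| <= e.
Proof.
move=> hF e e0.
pose B := [set y : 'rV[R]_n | `|y - q| <= r].
have cB : compact B.
  apply: bounded_closed_compact.
    exists (r + `|q|); split; first exact: num_real.
    move=> x hx y /= yB; apply: ltW; apply: le_lt_trans hx.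
    by rewrite -[y](subrK q); apply: le_trans (ler_normD _ _) _; rewrite lerD2r.
  apply: (@preimage_closed _ _ (fun y : 'rV[R]_n => `|y - q|) [set x | x <= r]); last exact: closed_le.
  move=> y _; apply/continuous_eps => t t0; exists t => // z zy.
  by apply: le_lt_trans (ler_dist_dist _ _) _; rewrite opprB addrA subrK.
have /(_ R (0^'+) (fun d y => forall y', `|y' - y| < d -> `|F y' - F y| <= e)) :=
  (compact_near_coveringP B).1 cB.
case.
  move=> y yB; have e2 : 0 < e / 2 by rewrite divr_gt0.
  have [d d0 hd] := hF y yB _ e2; have d2 : 0 < d / 2 by rewrite divr_gt0.
  exists ([set z | `|z - y| < d / 2], [set s | s < d / 2]).
    split=> /=; first by apply/nbhs_eps; exists (d / 2).
    by apply: nbhs_right_lt.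
  move=> [z s] [/= zy sd] y' y'z.
  have h1 := hd z ltac:(lra).
  have h2 : `|F y' - F y| <= e / 2.
    apply: hd; have -> : y' - y = (y' - z) + (z - y) by rewrite addrA subrK.
    by apply: le_lt_trans (ler_normD _ _) _; lra.
  have -> : F y' - F z = (F y' - F y) - (F z - F y) by rewrite opprB addrA subrK.
  by apply: le_trans (ler_normB _ _) _; lra.
move=> d /= d0 hd.
have d2 : 0 < d / 2 by rewrite divr_gt0.
exists (d / 2) => // y y' yB; apply: (hd (d / 2)) => //=.
by rewrite sub0r normrN gtr0_norm// ltr_pdivrMr// ltr_pMr// ltr1n.
Qed.

(** Centre and radius are both 1/2, written out so that the general facts on clamping apply
    verbatim. *)
Definition clamp01 {R : realType} (x : R) : R := Num.max (2^-1 - 2^-1) (Num.min (2^-1 + 2^-1) x).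

Lemma clamp01_itv {R : realType} (x : R) : 0 <= clamp01 x <= 1.
Proof.
have := @clamp_dist R 2^-1 2^-1 x; rewrite -/(clamp01 x) ler_norml => h.
by have /andP[h1 h2] := h ltac:(lra); apply/andP; split; lra.
Qed.

Lemma clamp01_id {R : realType} (x : R) : 0 <= x <= 1 -> clamp01 x = x.
Proof. by move=> /andP[h1 h2]; apply: clamp_id; rewrite ler_norml; apply/andP; split; lra. Qed.

Lemma clamp01_lip {R : realType} (x y : R) : `|clamp01 x - clamp01 y| <= `|x - y|.
Proof. exact: clamp_lipschitz. Qed.

Lemma ltraj_shift {R : realType} {n : nat} (xi : 'rV[R]_n -> 'rV[R]_n) q rho sg s T : 0 <= s ->
  ltraj xi q rho sg T -> ltraj xi q rho (fun t => sg (s + t)) (T - s).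
Proof.
move=> s0 h t /andP[t0 tT].
have hT : 0 <= s + t <= T by apply/andP; split; lra.
have [h1 h2] := h _ hT; split=> //.
apply: is_derive_rV => j.
have h3 := is_derive_coord _ _ _ j h2.
have hB : is_derive t 1 (fun u : R => s + u) 1.
  have := @is_deriveD R R R (cst s) id t 1 0 1 _ _.
  by rewrite add0r; apply.
have := @is_derive1_comp R (fun u => sg u ord0 j) (fun u => s + u) t _ _ h3 hB.
by rewrite mulr1.
Qed.

Lemma positive_lower_bound (R : realType) (l : seq R) : all (fun c => 0 < c) l ->
  exists2 h : R, 0 < h & all (fun c => h <= c) l.
Proof.
elim: l => [_|c l IH /= /andP[c0 /IH[h h0 hl]]]; first by exists 1.
exists (Num.min c h); first by rewrite lt_min c0.
rewrite ge_min lexx/=; apply/allP => d /(allP hl) hd.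
by rewrite (le_trans _ hd)// ge_min lexx orbT.
Qed.

Section FlowMore.
Context {R : realType} {n : nat}.
Variables (xi : 'rV[R]_n -> 'rV[R]_n) (q : 'rV[R]_n) (rho L M T : R).
Variables (Phi Psi : R -> 'rV[R]_n -> 'rV[R]_n).
Hypothesis hB : flow_box xi q rho L M T Phi Psi.

Lemma flow_time y s t : `|y - q| <= rho / 2 -> 0 <= s <= T -> 0 <= t <= T ->
  `|Phi s y - Phi t y| <= `|s - t| * M.
Proof.
have [[_ _ /ltW M0 _ _] _ xM hP _] := hB => yq; have [_ tr] := hP _ yq.
wlog ts : s t / t <= s.
  move=> hw sT tT; have [|/ltW] := leP t s => ts; first exact: hw.
  by rewrite distrC [`|s - t|]distrC; apply: hw.
move=> /andP[s0 sT] /andP[t0 tT]; rewrite [`|s - t|]ger0_norm ?subr_ge0//.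
exact: (ltraj_speed xi q rho M M0 xM (Phi^~ y) T t s).
Qed.

Lemma flow_semigroup y s t : `|y - q| <= rho / 4 -> 0 <= s -> 0 <= t -> s + t <= T ->
  Phi t (Phi s y) = Phi (s + t) y.
Proof.
have [[r0 L0 M0 T0 [LT MT]] xL xM hP _] := hB => yq s0 t0 stT.
have yq2 : `|y - q| <= rho / 2 by lra.
have sT : 0 <= s <= T by apply/andP; split; lra.
have [_ sn] := flow_near _ _ _ _ _ _ _ _ hB y s yq2 sT.
have yq' : `|Phi s y - q| <= rho / 2.
  have -> : Phi s y - q = (Phi s y - y) + (y - q) by rewrite addrA subrK.
  by apply: le_trans (ler_normD _ _) _; lra.
have [e1 tr1] := hP _ yq'; have [_ tr2] := hP _ yq2.
have tr3 : ltraj xi q rho (Phi^~ (Phi s y)) t by apply: ltrajW tr1; lra.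
have tr4 : ltraj xi q rho (fun u => Phi (s + u) y) t.
  by apply: ltrajW (ltraj_shift _ _ _ _ s T s0 tr2); lra.
apply: (ltraj_unique xi q rho L (ltW L0) xL (Phi^~ (Phi s y)) (fun u => Phi (s + u) y) t t) => //.
- by apply: le_trans LT; rewrite ler_pM2l//; lra.
- by rewrite e1 addr0.
- by rewrite t0 lexx.
Qed.

Variables (V : normedModType R) (F : 'rV[R]_n -> V) (K : R).
Hypothesis hF : forall sg T, 0 <= T -> ltraj xi q rho sg T -> `|F (sg T) - F (sg 0)| <= K * T.

Lemma lip_along_flow y s t : `|y - q| <= rho / 2 -> 0 <= s <= T -> 0 <= t <= T ->
  `|F (Phi s y) - F (Phi t y)| <= K * `|s - t|.
Proof.
have [_ _ xM hP _] := hB => yq; have [_ tr] := hP _ yq.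
wlog ts : s t / t <= s.
  move=> hw sT tT; have [|/ltW] := leP t s => ts; first exact: hw.
  by rewrite distrC [`|s - t|]distrC; apply: hw.
move=> /andP[s0 sT] /andP[t0 tT]; rewrite [`|s - t|]ger0_norm ?subr_ge0//.
have st : 0 <= s - t by rewrite subr_ge0.
have := hF (fun u => Phi (t + u) y) (s - t) st.
have -> : t + (s - t) = s by rewrite addrC subrK.
rewrite addr0; apply.
by apply: ltrajW (ltraj_shift _ _ _ _ t T t0 tr); lra.
Qed.

End FlowMore.

Definition flow_quot {R : realType} {n : nat} {V : normedModType R} (Phi : R -> 'rV[R]_n -> 'rV[R]_n)
    (F : 'rV[R]_n -> V) (h : R) (y : 'rV[R]_n) : V := h^-1 *: (F (Phi h y) - F y).

Section Averaging.
Context {R : realType} {n : nat} {V : completeNormedModType R}.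
Hypothesis RNP : radon_nikodym_property V.
Variables (X Y : 'rV[R]_n -> 'rV[R]_n) (q : 'rV[R]_n) (rho L MX TX MY TY : R).
Variables (PhiX PsiX PhiY PsiY : R -> 'rV[R]_n -> 'rV[R]_n).
Hypothesis hX : flow_box X q rho L MX TX PhiX PsiX.
Hypothesis hY : flow_box Y q rho L MY TY PhiY PsiY.
Variables (F : 'rV[R]_n -> V) (K : R).
Hypothesis K0 : 0 <= K.
Hypothesis hFX : forall sg T, 0 <= T -> ltraj X q rho sg T -> `|F (sg T) - F (sg 0)| <= K * T.
Hypothesis hFY : forall sg T, 0 <= T -> ltraj Y q rho sg T -> `|F (sg T) - F (sg 0)| <= K * T.
Hypothesis FU : forall e, 0 < e -> exists2 d, 0 < d &
  forall y y', `|y - q| <= rho -> `|y' - y| < d -> `|F y' - F y| <= e.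

Local Notation quot := (flow_quot PhiX F).

Lemma quot_bound h y : 0 < h -> h <= TX -> `|y - q| <= rho / 2 -> `|quot h y| <= K.
Proof.
move=> h0 hT yq; have [[_ _ _ T0 _] _ _ hP _] := hX.
have := lip_along_flow _ _ _ _ _ _ _ _ hX V F K hFX y h 0 yq.
have hT' : 0 <= h <= TX by rewrite (ltW h0).
have z0 : 0 <= (0 : R) <= TX by rewrite lexx ltW.
rewrite (hP _ yq).1 subr0 gtr0_norm// => /(_ hT' z0) h1.
by rewrite /flow_quot normrZ gtr0_norm ?invr_gt0// mulrC ler_pdivrMr.
Qed.

Lemma quot_unif h e : 0 < h -> h <= TX -> 0 < e -> exists2 d, 0 < d &
  forall y y', `|y - q| <= rho / 2 -> `|y' - q| <= rho / 2 -> `|y' - y| < d ->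
    `|quot h y' - quot h y| <= e.
Proof.
move=> h0 hT e0; have [[r0 _ _ _ _] _ _ _ _] := hX.
have e1 : 0 < e * h / 2 by rewrite divr_gt0// mulr_gt0.
have [d d0 hd] := FU _ e1; exists (d / 2); first by rewrite divr_gt0.
move=> y y' yq y'q yd; have hT' : 0 <= h <= TX by rewrite (ltW h0).
have h1 := hd y y' ltac:(lra) ltac:(lra).
have h2 := flow_lip _ _ _ _ _ _ _ _ hX y' y h y'q yq hT'.
have [_ h3] := flow_near _ _ _ _ _ _ _ _ hX y h yq hT'.
have h4 : `|PhiX h y - q| <= rho.
  have -> : PhiX h y - q = (PhiX h y - y) + (y - q) by rewrite addrA subrK.
  by apply: le_trans (ler_normD _ _) _; lra.
have h5 := hd _ (PhiX h y') h4 ltac:(lra).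
rewrite /flow_quot -scalerBr normrZ gtr0_norm ?invr_gt0// mulrC ler_pdivrMr//.
have -> : F (PhiX h y') - F y' - (F (PhiX h y) - F y) =
  (F (PhiX h y') - F (PhiX h y)) - (F y' - F y).
  by rewrite !opprB addrACA [RHS]addrACA; congr (_ + _); rewrite addrC.
by apply: le_trans (ler_normB _ _) _; lra.
Qed.

Lemma quotients_converge (y : 'rV[R]_n) (tau : R) (u v : nat -> R) : `|y - q| <= rho / 4 -> 0 < tau ->
  2 * tau <= TX -> (forall j, 0 < u j <= 1) -> (forall j, 0 < v j <= 1) ->
  u @ \oo --> (0 : R) -> v @ \oo --> (0 : R) ->
  {ae @lebesgue_measure R, forall x, 0 <= x <= 1 ->
    (fun j => `|quot (tau * u j) (PhiX (tau * x) y) - quot (tau * v j) (PhiX (tau * x) y)|)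
      @ \oo --> (0 : R)}.
Proof.
move=> yq tau0 tauT hu hv uc vc.
have [[r0 _ _ _ _] _ _ _ _] := hX.
have yq2 : `|y - q| <= rho / 2 by lra.
(* The curve is followed up to parameter 2, whence 2 * tau <= TX: for x in [0, 1] and steps at most
   1, the point x + w stays where f is the unclamped curve. The clamp makes f Lipschitz on the whole
   line. *)
pose f (x : R) := F (PhiX (tau * (2 * clamp01 (x / 2))) y).
have fid x : 0 <= x <= 2 -> f x = F (PhiX (tau * x) y).
  move=> /andP[x0 x2]; rewrite /f clamp01_id; last by apply/andP; split; lra.
  by congr (F (PhiX _ _)); field.
have ct (x : R) : 0 <= tau * (2 * clamp01 (x / 2)) <= TX.
  have /andP[c0 c1] := clamp01_itv (x / 2).
  move: (clamp01 _) c0 c1 => c c0 c1.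
  have h1 : 0 <= tau * c by rewrite mulr_ge0// ltW.
  have h2 : tau * c <= tau by rewrite ler_piMr// ltW.
  by apply/andP; split; lra.
have fL x x' : `|f x - f x'| <= (K * tau) * `|x - x'|.
  apply: le_trans (lip_along_flow _ _ _ _ _ _ _ _ hX V F K hFX y _ _ yq2 (ct x) (ct x')) _.
  have c : `|clamp01 (x / 2) - clamp01 (x' / 2)| <= `|x - x'| / 2.
    by apply: le_trans (clamp01_lip _ _) _; rewrite -mulrBl normrM [`|_^-1|]ger0_norm.
  rewrite -mulrA; apply: ler_wpM2l => //; rewrite -!mulrBr 2!normrM [`|tau|]gtr0_norm//.
  by rewrite [`|2|]ger0_norm//; apply: ler_wpM2l; [exact: ltW|lra].
have hp (w : nat -> R) j : 0 < w j <= 1 -> 0 < w j by case/andP.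
have := difference_quotients V RNP f (K * tau) u v (mulr_ge0 K0 (ltW tau0)) fL
  (fun j => hp u j (hu j)) (fun j => hp v j (hv j)) uc vc.
move=> [A [mA A0 hA]]; exists A; split=> // x /= hx; apply: hA => /= hc; apply: hx => x01.
have [x0 x1] := andP x01.
have qE (w : R) : 0 < w <= 1 -> quot (tau * w) (PhiX (tau * x) y) = tau^-1 *: (w^-1 *: (f (x + w) - f x)).
  move=> /andP[w0 w1]; rewrite /flow_quot fid ?fid; last 2 first.
  - by apply/andP; split; lra.
  - by apply/andP; split; lra.
  rewrite (flow_semigroup _ _ _ _ _ _ _ _ hX)//; last 3 first.
  - by rewrite mulr_ge0// ltW.
  - by rewrite mulr_ge0// ltW.
  - apply: le_trans tauT; rewrite -mulrDr mulrC; apply: ler_pM => //; [lra|exact: ltW|lra].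
  by rewrite -mulrDr scalerA invfM.
rewrite [X in X @ _](_ : _ = fun j => `|tau^-1| *
    `|(u j)^-1 *: (f (x + u j) - f x) - (v j)^-1 *: (f (x + v j) - f x)|); last first.
  by apply/funext => j; rewrite !qE// -scalerBr normrZ.
have h := cvgM (cvg_cst `|tau^-1|) hc.
by rewrite mulr0 in h; exact: h.
Qed.

End Averaging.

Lemma subrACA {W : zmodType} (a b c d : W) : a - b - (c - d) = (a - c) - (b - d).
Proof. by rewrite !opprB addrACA [RHS]addrACA; congr (_ + _); rewrite addrC. Qed.

Lemma quotient_transfer {R : realType} {V : normedModType R} (p p' A B a b : V) (h H eta c : R) :
  0 < h -> 0 < H -> `|H^-1 *: (A - p) - h^-1 *: (a - p)| <= eta ->
  `|H^-1 *: (B - p') - h^-1 *: (b - p')| <= eta -> `|B - A| <= eta * H / 2 ->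
  `|p' - p| <= c -> c <= eta * H / 2 -> `|a - b| <= c + 3 * eta * h.
Proof.
move=> h0 H0.
have scale (u w : V) : `|u - h^-1 *: w| <= eta -> `|h *: u - w| <= eta * h.
  move=> hu; have -> : h *: u - w = h *: (u - h^-1 *: w).
    by rewrite scalerBr scalerA divff ?gt_eqF// scale1r.
  by rewrite normrZ gtr0_norm// mulrC ler_pM2r.
move=> /scale h1 /scale h2 hAB hp hc.
have h3 : `|h *: (H^-1 *: (B - p')) - h *: (H^-1 *: (A - p))| <= eta * h.
  rewrite -!scalerBr !normrZ !gtr0_norm ?invr_gt0// mulrC ler_pM2r// mulrC ler_pdivrMr//.
  have -> : B - p' - (A - p) = (B - A) - (p' - p).
    by rewrite !opprB addrACA [RHS]addrACA; congr (_ + _); rewrite addrC.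
  by apply: le_trans (ler_normB _ _) _; lra.
move: h1 h2 h3; move: (h *: _) (h *: _) => u w h1 h2 h3.
have -> : a - b = (u - (b - p')) - (w - (a - p)) - (u - w) - (p' - p).
  rewrite [(u - _) - (w - _)]subrACA [_ - (u - w)]addrAC subrr sub0r opprB subrACA.
  by rewrite [b - p' - p]addrAC subrACA subrr subr0 subrACA subrr subr0.
apply: le_trans (ler_normB _ _) _; apply: le_trans (lerD (ler_normB _ _) hp) _.
apply: le_trans (lerD (lerD (ler_normB _ _) h3) (lexx _)) _; lra.
Qed.

(** The averaging argument. Points are described by a flow time x along X and a point y of a unit
    cube; the defect psi j between the quotients at scales [tau * u j] and [tau * v j] is small on
    average. [grid_pair] makes it small at a point and at its Y-translate, and [quotient_transfer]
    concludes. *)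
Lemma almost_commuting_pair {R : realType} {n : nat} {V : completeNormedModType R}
    (X Y : 'rV[R]_n -> 'rV[R]_n) (q : 'rV[R]_n) (rho L MX TX MY TY : R)
    (PhiX PsiX PhiY PsiY : R -> 'rV[R]_n -> 'rV[R]_n) (F : 'rV[R]_n -> V) (K eps eta kap : R) :
  radon_nikodym_property V ->
  flow_box X q rho L MX TX PhiX PsiX -> flow_box Y q rho L MY TY PhiY PsiY -> 0 <= K ->
  (forall sg T, 0 <= T -> ltraj X q rho sg T -> `|F (sg T) - F (sg 0)| <= K * T) ->
  (forall sg T, 0 <= T -> ltraj Y q rho sg T -> `|F (sg T) - F (sg 0)| <= K * T) ->
  (forall e, 0 < e -> exists2 d, 0 < d &
    forall y y', `|y - q| <= rho -> `|y' - y| < d -> `|F y' - F y| <= e) -> 0 < eps -> 0 < eta -> 0 < kap ->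
  exists h y, [/\ 0 < h < kap, eps * h < kap, h <= TX, eps * h <= TY & `|y - q| <= kap /\
    `|F (PhiX h y) - F (PhiX h (PhiY (eps * h) y))| <= K * (eps * h) + 3 * eta * h].
Proof.
move=> RNP hX hY K0 hFX hFY FU eps0 eta0 kap0.
pose quot := flow_quot PhiX F.
have [[r0 L0 MX0 TX0 [LTX MTX]] xL xM hP hQ] := hX.
have [[_ _ MY0 TY0 [LTY MTY]] yL yM hPY hQY] := hY.
(* tau is the unit of time along X: two units fit in the flow box, trajectories stay in the
   kap-ball, and flows up to time tau are within relative distance 1/8 of translations. *)
have [tau tau0 /= /and4P[tk tT tL /andP[tM _]]] := @positive_lower_bound R
  [:: kap / 2; TX / 2; (16 * L)^-1; kap / 2 / MX]
  ltac:(by rewrite /= !divr_gt0// invr_gt0 mulr_gt0).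
have {}tL : tau * (2 * L) <= 8^-1.
  have : tau * (16 * L) <= 1 by rewrite -ler_pdivlMr ?mulr_gt0// div1r.
  lra.
have {}tM : tau * MX <= kap / 2 by rewrite -ler_pdivlMr.
have [r r00 /= /and3P[rk rr _]] := @positive_lower_bound R [:: kap / 2; rho / 8]
  ltac:(by rewrite /= !divr_gt0).
pose u (j : nat) : R := j.+1%:R^-1.
have u0 j : 0 < u j by rewrite invr_gt0.
have u1 j : u j <= 1 by rewrite invf_le1// ler1n.
have uT j : tau * u j <= TX.
  apply: le_trans (_ : tau <= _); last by clear -tT TX0; lra.
  by rewrite ler_piMr// ltW.
have tu0 j : 0 < tau * u j by rewrite mulr_gt0.
(* The short scale v j is chosen once the long scale u j is fixed: by uniform continuity of F, a
   translation along Y of length [eps * (tau * v)] changes F after the long time by at most eta H /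
   2, where H = [tau * u j]. The other bounds keep that translation near the identity and within r /
   6. *)
have /choice[v hv] : forall j, exists v : R, [/\ 0 < v <= u j, tau * v < kap, eps * (tau * v) < kap,
    eps * (tau * v) <= TY &
    [/\ eps * (tau * v) * (2 * L) <= 8^-1, 2 * (eps * (tau * v) * MY) <= r / 3,
        K * (eps * (tau * v)) <= eta * (tau * u j) / 2 &
      forall y, `|y - q| <= rho / 4 ->
        `|F (PhiX (tau * u j) (PhiY (eps * (tau * v)) y)) - F (PhiX (tau * u j) y)|
          <= eta * (tau * u j) / 2]].
  move=> j.
  have ej : 0 < eta * (tau * u j) / 2 by rewrite divr_gt0// mulr_gt0.
  have [d d0 hd] := FU _ ej.
  have et : 0 < eps * tau by rewrite mulr_gt0.
  have K1 : 0 < K + 1 by rewrite ltr_wpDl.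
  have [v v0 /= /and5P[v1 v2 v3 v4 /and5P[v5 v6 v7 v8 _]]] := @positive_lower_bound R
    [:: u j; kap / 2 / tau; kap / 2 / (eps * tau); TY / (eps * tau); (eps * tau * (16 * L))^-1;
        r / (6 * MY * (eps * tau)); eta * (tau * u j) / 2 / ((K + 1) * (eps * tau));
        d / 2 / (2 * MY * (eps * tau))]
    ltac:(by rewrite /= u0 !divr_gt0 ?mulr_gt0// ?invr_gt0 ?divr_gt0 ?mulr_gt0).
  have vt : tau * v <= kap / 2 by rewrite mulrC -ler_pdivlMr.
  have ev : eps * (tau * v) = v * (eps * tau) by rewrite mulrA mulrC.
  have w2 : eps * (tau * v) <= kap / 2 by rewrite ev -ler_pdivlMr.
  have w3 : eps * (tau * v) <= TY by rewrite ev -ler_pdivlMr.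
  have w4 : v * (eps * tau * (16 * L)) <= 1 by rewrite -ler_pdivlMr ?div1r// !mulr_gt0.
  have w5 : v * (6 * MY * (eps * tau)) <= r by rewrite -ler_pdivlMr// !mulr_gt0.
  have w6 : v * ((K + 1) * (eps * tau)) <= eta * (tau * u j) / 2 by rewrite -ler_pdivlMr// !mulr_gt0.
  have w7 : v * (2 * MY * (eps * tau)) <= d / 2 by rewrite -ler_pdivlMr// !mulr_gt0.
  have vp : 0 < v * (eps * tau) by rewrite mulr_gt0.
  exists v; split=> //.
  - by rewrite v0.
  - by clear -vt kap0; lra.
  - by clear -w2 kap0; lra.
  split.
  - by rewrite ev; clear -w4; lra.
  - by rewrite ev; clear -w5; lra.
  - by rewrite ev; clear -w6 vp; lra.
  move=> y yq; rewrite ev in w3 *.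
  have yq2 : `|y - q| <= rho / 2 by clear -yq r0; lra.
  have sT : 0 <= v * (eps * tau) <= TY by rewrite (ltW vp).
  have hT : 0 <= tau * u j <= TX by rewrite uT ltW.
  have [h1 h2] := flow_near _ _ _ _ _ _ _ _ hY y _ yq2 sT.
  have yq3 : `|PhiY (v * (eps * tau)) y - q| <= rho / 2.
    rewrite -(subrKA y); apply: le_trans (ler_normD _ _) _; clear -h2 yq r0; lra.
  have h3 := flow_lip _ _ _ _ _ _ _ _ hX _ y _ yq3 yq2 hT.
  have [_ h4] := flow_near _ _ _ _ _ _ _ _ hX y _ yq2 hT.
  apply: hd.
    rewrite -(subrKA y); apply: le_trans (ler_normD _ _) _; clear -h4 yq r0; lra.
  by apply: le_lt_trans h3 _; clear -h1 w7 d0; lra.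
pose psi j y := `|quot (tau * u j) y - quot (tau * v j) y|.
have v01 j : 0 < v j <= 1.
  by have [/andP[v0 v1] _ _ _ _] := hv j; rewrite v0 (le_trans v1).
have u01 j : 0 < u j <= 1 by rewrite u0 u1.
have tv0 j : 0 < tau * v j by rewrite mulr_gt0//; case/andP: (v01 j).
have vT j : tau * v j <= TX.
  by apply: le_trans (uT j); rewrite ler_pM2l//; have [/andP[]] := hv j.
have uc : u @ \oo --> (0 : R).
  apply/cvgrPdist_lt => e e0; have := near_infty_natSinv_lt (PosNum e0).
  by apply: filterS => j; rewrite sub0r normrN gtr0_norm.
have vc : v @ \oo --> (0 : R).
  apply/cvgrPdist_lt => e e0; have := near_infty_natSinv_lt (PosNum e0).
  apply: filterS => j hj; rewrite sub0r normrN; have [/andP[v0 v1] _ _ _ _] := hv j.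
  by rewrite gtr0_norm//; apply: le_lt_trans v1 hj.
(* The unit cube is mapped onto the cube of side r around q; clamping extends the map to all y, so
   that the integrands are defined and uniformly continuous everywhere. *)
pose zz (y : 'rV[R]_n) : 'rV[R]_n := q + r *: (\row_i clamp01 (y ord0 i) - const_mx 2^-1).
have zzq y : `|zz y - q| <= r / 2.
  rewrite /zz addrC addKr normrZ gtr0_norm//; apply: ler_wpM2l; first exact: ltW.
  apply/rV_norm_le => [|i]; first by rewrite invr_ge0.
  rewrite !mxE; have /andP[c1 c2] := clamp01_itv (y ord0 i).
  by rewrite ler_norml; apply/andP; clear -c1 c2; split; lra.
have zzd y y' : `|zz y - zz y'| <= r * `|y - y'|.
  have -> : zz y - zz y' = r *: (\row_i (clamp01 (y ord0 i) - clamp01 (y' ord0 i))).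
    by apply/rowP => i; rewrite !mxE; ring.
  rewrite normrZ gtr0_norm//; apply: ler_wpM2l; first exact: ltW.
  apply/rV_norm_le => // i; rewrite !mxE; apply: le_trans (clamp01_lip _ _) _.
  by have := rV_norm_coord (y - y') i; rewrite !mxE.
have zzi (y : 'rV[R]_n) : (forall i, 0 <= y ord0 i <= 1) -> zz y = q + r *: (y - const_mx 2^-1).
  by move=> hy; apply/rowP => i; rewrite !mxE clamp01_id.
have zq4 y : `|zz y - q| <= rho / 4 by apply: le_trans (zzq y) _; clear -r0 rr; lra.
have zq2 y : `|zz y - q| <= rho / 2 by apply: le_trans (zzq y) _; clear -r0 rr; lra.
pose t x := tau * clamp01 x.
have tT' x : 0 <= t x <= TX.
  have /andP[c1 c2] := clamp01_itv x; rewrite mulr_ge0 ?(ltW tau0)//=.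
  apply: le_trans (_ : tau <= _); last by clear -tT TX0; lra.
  by rewrite ler_piMr// ltW.
have tt x : 0 <= t x <= tau.
  have /andP[c1 c2] := clamp01_itv x; rewrite mulr_ge0 ?(ltW tau0)//=.
  by rewrite ler_piMr// ltW.
(* For fixed y the point runs along an integral curve of X, where the quotients converge for almost
   every x. For fixed x the map is invertible in y, which allows the translation along Y to be read
   in the cube. *)
pose P x y := PhiX (t x) (zz y).
have Pq x y : `|P x y - q| <= kap /\ `|P x y - q| <= rho / 4.
  have [h1 h2] := flow_near _ _ _ _ _ _ _ _ hX (zz y) (t x) (zq2 y) (tT' x).
  have h3 : t x * MX <= tau * MX by rewrite ler_pM2r//; case/andP: (tt x).
  have h4 := zzq y.
  by split; rewrite -(subrKA (zz y)); apply: le_trans (ler_normD _ _) _;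
    clear -h1 h2 h3 h4 tM rk rr r0 kap0 r00; lra.
have Pq3 x y : `|P x y - q| <= rho / 4 - rho / 16.
  have [_ h2] := flow_near _ _ _ _ _ _ _ _ hX (zz y) (t x) (zq2 y) (tT' x).
  have h4 := zzq y.
  rewrite -(subrKA (zz y)); apply: le_trans (ler_normD _ _) _.
  by clear -h2 h4 rr r0; lra.
have Pq2 x y : `|P x y - q| <= rho / 2 by have [_] := Pq x y; clear -r0; lra.
pose G j x y := psi j (P x y).
have psiU j e : 0 < e -> exists2 d, 0 < d & forall y y', `|y - q| <= rho / 2 ->
    `|y' - q| <= rho / 2 -> `|y' - y| < d -> `|psi j y' - psi j y| <= e.
  move=> e0; have e2 : 0 < e / 2 by rewrite divr_gt0.
  have [d1 d10 h1] := quot_unif _ _ _ _ _ _ _ _ hX F FU _ _ (tu0 j) (uT j) e2.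
  have [d2 d20 h2] := quot_unif _ _ _ _ _ _ _ _ hX F FU _ _ (tv0 j) (vT j) e2.
  exists (Num.min d1 d2); first by rewrite lt_min d10.
  move=> y y' yq y'q; rewrite lt_min => /andP[y1 y2].
  apply: le_trans (ler_dist_dist _ _) _.
  have -> (a b c d : V) : a - b - (c - d) = (a - c) - (b - d).
    by rewrite !opprB addrACA [RHS]addrACA; congr (_ + _); rewrite addrC.
  apply: le_trans (ler_normB _ _) _.
  by have := h1 _ _ yq y'q y1; have := h2 _ _ yq y'q y2; clear; lra.
have Gx j e : 0 < e -> exists2 d, 0 < d & forall x x', `|x - x'| <= d -> forall y,
    `|G j x y - G j x' y| <= e.
  move=> e0; have [d d0 hd] := psiU j e e0.
  have tm0 : 0 < tau * MX by rewrite mulr_gt0.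
  exists (d / 2 / (tau * MX)); first by rewrite !divr_gt0.
  move=> x x' xx y; apply: hd => //.
  apply: le_lt_trans (flow_time _ _ _ _ _ _ _ _ hX _ _ _ (zq2 y) (tT' x) (tT' x')) _.
  have -> : `|t x - t x'| * MX = `|clamp01 x - clamp01 x'| * (tau * MX).
    by rewrite -mulrBr normrM gtr0_norm// mulrAC mulrC.
  apply: le_lt_trans (_ : `|x - x'| * (tau * MX) < _).
    by rewrite ler_pM2r//; exact: clamp01_lip.
  by move: xx; rewrite ler_pdivlMr//; clear -d0; lra.
have Gy j e : 0 < e -> exists2 d, 0 < d & forall x y y', `|y - y'| <= d ->
    `|G j x y - G j x y'| <= e.
  move=> e0; have [d d0 hd] := psiU j e e0.
  exists (d / 4 / r); first by rewrite !divr_gt0.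
  move=> x y y' yy; apply: hd => //.
  have := flow_lip _ _ _ _ _ _ _ _ hX (zz y) (zz y') (t x) (zq2 y) (zq2 y') (tT' x).
  move: yy; rewrite ler_pdivlMr// => yy.
  have := zzd y y'; rewrite /P; clear -yy d0; lra.
pose row (w : nat -> R) : 'rV[R]_n := \row_i w i.
have rowd w w' d : 0 <= d -> (forall i, `|w i - w' i| <= d) -> `|row w - row w'| <= d.
  by move=> d0 h; apply/rV_norm_le => // i; rewrite !mxE.
pose g j x w := G j x (row w).
have gm j e : 0 < e -> exists2 d, 0 < d & forall x, modulus (g j x) d e.
  move=> e0; have [d d0 hd] := Gy j e e0; exists d => // x w w' hw.
  by apply: hd; apply: rowd => //; exact: ltW.
have eta1 : 0 < eta / (4 * (1 + 9 ^+ n) * 3 ^+ n).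
  by rewrite divr_gt0// !mulr_gt0// ?exprn_gt0// ltr_wpDr// exprn_ge0.
have [||||w|J hJ] := @grid_average_small R n g (2 * K) _ _ _ _ _ _ (fun=> 0) eta1.
- by move=> j x e e0; have [d d0 hd] := gm j e e0; exists d.
- by move=> j e e0; have [d d0 hd] := Gx j e e0; exists d => // x x' xx w; exact: hd.
- exact: gm.
- move=> j x w; rewrite /g /G /psi normr_ge0/=; apply: le_trans (ler_normB _ _) _.
  have := quot_bound _ _ _ _ _ _ _ _ hX F K hFX _ _ (tu0 j) (uT j) (Pq2 x (row w)).
  have := quot_bound _ _ _ _ _ _ _ _ hX F K hFX _ _ (tv0 j) (vT j) (Pq2 x (row w)).
  by clear; lra.
- have tT2 : 2 * tau <= TX by clear -tT; lra.
  have [A [mA A0 hA]] := quotients_converge RNP _ _ _ _ _ _ _ _ hX F K K0 hFX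
    (zz (row w)) tau u v (zq4 _) tau0 tT2 u01 v01 uc vc.
  exists A; split=> // x /= hx; apply: hA => /= hc; apply: hx => x01.
  by have := hc x01; rewrite /g /G /psi /P /t clamp01_id.
have [N0 hN0] := hJ J (leqnn J).
have [/andP[v0 vu] vk evk evT [evL evM Kev evF]] := hv J.
have [d d0 hd] := Gy J _ (divr_gt0 eta0 (ltr0Sn R 1)).
pose N := (N0 + (Num.truncn d^-1).+1)%N.
have N0' : (0 < N)%N by rewrite /N addnS.
have [||x x01] := hN0 (N + (N + N))%N.
- by rewrite /N -!addnA leq_addr.
- by rewrite addn_gt0 N0'.
pose s := eps * (tau * v J); have s0 : 0 < s by rewrite mulr_gt0.
have sT : 0 <= s <= TY by rewrite (ltW s0).
(* The translation along Y in the coordinates y, the time x being kept: flow forward, translate,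
   flow back and invert [zz]. *)
pose th (y : 'rV[R]_n) : 'rV[R]_n := const_mx 2^-1 + r^-1 *: (PsiX (t x) (PhiY s (P x y)) - q).
have qY y : `|PhiY s (P x y) - P x y| <= s * MY /\ `|PhiY s (P x y) - q| <= rho / 2.
  have [h1 h2] := flow_near _ _ _ _ _ _ _ _ hY _ _ (Pq2 x y) sT; split=> //.
  have [_ h3] := Pq x y.
  by rewrite -(subrKA (P x y)); apply: le_trans (ler_normD _ _) _; clear -h2 h3 r0; lra.
have hXN := flow_boxN _ _ _ _ _ _ _ _ hX.
have inv1 y : PsiX (t x) (P x y) = zz y by apply: (flow_inv _ _ _ _ _ _ _ _ hX).
(* A displacement of r / 3 is 1/3 in the unit cube, just what the middle third tolerates. *)
have near y : `|PsiX (t x) (PhiY s (P x y)) - zz y| <= r / 3.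
  rewrite -inv1.
  apply: le_trans (flow_lip _ _ _ _ _ _ _ _ hXN _ _ _ (qY y).2 (Pq2 x y) (tT' x)) _.
  by apply: le_trans evM; have := (qY y).1; rewrite /s; clear; lra.
have t8 : t x * (2 * L) <= 8^-1.
  by apply: le_trans tL; rewrite ler_pM2r ?mulr_gt0//; case/andP: (tt x).
have inr (y : 'rV[R]_n) : (forall i, 3^-1 <= y ord0 i <= 2 / 3) -> forall i, 0 <= y ord0 i <= 1.
  by move=> h i; have /andP[h1 h2] := h i; apply/andP; split; clear -h1 h2; lra.
have thI (y : 'rV[R]_n) : (forall i, 3^-1 <= y ord0 i <= 2 / 3) -> forall i, 0 <= th y ord0 i <= 1.
  move=> yin i.
  have h1 := rV_norm_coord (PsiX (t x) (PhiY s (P x y)) - zz y) i.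
  have {}h1 := le_trans h1 (near y).
  have e1 : th y ord0 i = y ord0 i + r^-1 * (PsiX (t x) (PhiY s (P x y)) - zz y) ord0 i.
    by rewrite (zzi _ (inr y yin)) /th !mxE; field; rewrite gt_eqF.
  have h2 : `|r^-1 * (PsiX (t x) (PhiY s (P x y)) - zz y) ord0 i| <= 3^-1.
    by rewrite normrM gtr0_norm ?invr_gt0// mulrC ler_pdivrMr// mulrC.
  have /andP[y1 y2] := yin i.
  move: h2; rewrite e1 ler_norml => /andP[a1 a2].
  by apply/andP; split; clear -a1 a2 y1 y2; lra.
move=> hsum.
have [|||||z [zin z1 z2]] := @grid_pair R n N (G J x) th eta N0' eta0.
- by move=> y; exact: normr_ge0.
- move=> y y' yy; apply: hd; apply: le_trans yy _.
  have NM : 0 < (N + (N + N))%:R :> R by rewrite ltr0n; apply: leq_trans N0' (leq_addr _ _).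
  rewrite -[d]invrK lef_pV2 ?posrE ?invr_gt0//.
  by apply/ltW; apply: lt_le_trans (truncnS_gt _) _; rewrite ler_nat (leq_trans _ (leq_addr _ _))// /N leq_addl.
- exact: thI.
- move=> y y' yin y'in.
  have e1 : y - y' = r^-1 *: (zz y - zz y').
    by rewrite (zzi _ (inr _ yin)) (zzi _ (inr _ y'in)); apply/rowP => i; rewrite !mxE; field; rewrite gt_eqF.
  have e2 : th y - th y' = r^-1 *: (PsiX (t x) (PhiY s (P x y)) - PsiX (t x) (PhiY s (P x y'))).
    by apply/rowP => i; rewrite !mxE; ring.
  rewrite e1 e2 !normrZ mulrCA ler_pM2l ?normr_gt0 ?invr_eq0 ?gt_eqF//.
  have a1 := flow_near_id _ _ _ _ _ _ _ _ hX _ _ _ (zq2 y) (zq2 y') (tT' x).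
  have a2 := flow_near_id _ _ _ _ _ _ _ _ hY _ _ _ (Pq2 x y) (Pq2 x y') sT.
  have a3 := flow_near_id _ _ _ _ _ _ _ _ hXN _ _ _ (qY y).2 (qY y').2 (tT' x).
  (* Each of the three flows composing [th] differs from the identity by at most 1/8 relatively, so
     it contracts by at most 8/7; the cube of 8/7 is below the factor 2 required. *)
  have low (p p' : 'rV[R]_n) c : 0 <= `|p'| -> c <= 8^-1 -> `|p - p'| <= c * `|p'| -> `|p'| <= 8 / 7 * `|p|.
    move=> p0 c8 h; have : c * `|p'| <= 8^-1 * `|p'| by rewrite ler_wpM2r.
    have : `|p'| <= `|p| + `|p - p'|.
      by rewrite -{1}(subrK p p') addrC; apply: le_trans (ler_normD _ _) _; rewrite [X in _ + X <= _]distrC.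
    by move: h; clear; lra.
  rewrite mulrA in a1; rewrite mulrA in a2; rewrite mulrA in a3.
  have b1 := low _ _ _ (normr_ge0 _) t8 a1.
  have b2 := low _ _ _ (normr_ge0 _) evL a2.
  have b3 := low _ _ _ (normr_ge0 _) t8 a3.
  have b0 := normr_ge0 (PsiX (t x) (PhiY s (P x y)) - PsiX (t x) (PhiY s (P x y'))).
  move: b0 b1 b2 b3; rewrite -/(P x y) -/(P x y').
  by move: (`|_ - _|) (`|_ - _|) (`|_ - _|) (`|_ - _|); clear => n1 n2 n3 n4 b0 b1 b2 b3; lra.
- exact: hsum.
have thz i : 0 <= th z ord0 i <= 1 by exact: thI.
have zth : zz (th z) = PsiX (t x) (PhiY s (P x z)).
  by rewrite (zzi _ thz); apply/rowP => i; rewrite !mxE; field; rewrite gt_eqF.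
(* The translate belongs to the same family with the same x, so smallness of the defect at [th z] is
   smallness at the translate. *)
have Pth : P x (th z) = PhiY s (P x z).
  rewrite /P zth; have hQY' := flow_inv _ _ _ _ _ _ _ _ hXN.
  apply: hQY' => //; have [h1 _] := qY z; have h2 := Pq3 x z.
  rewrite -(subrKA (P x z)); apply: le_trans (ler_normD _ _) _.
  by move: h1; rewrite /s => h1; clear -h1 h2 evM rr r0; lra.
rewrite /G Pth in z2; rewrite /G in z1.
exists (tau * v J), (P x z); split=> //.
- by rewrite tv0 vk.
split; first by have [] := Pq x z.
have e1 : 0 < tau * v J by rewrite tv0.
have hp : `|F (PhiY s (P x z)) - F (P x z)| <= K * s.
  have [y0 _] := hPY _ (Pq2 x z).
  have z0 : 0 <= (0 : R) <= TY by rewrite lexx ltW.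
  have := lip_along_flow _ _ _ _ _ _ _ _ hY V F K hFY (P x z) s 0 (Pq2 x z) sT z0.
  by rewrite y0 subr0 gtr0_norm.
have [_ Pz4] := Pq x z.
exact: (quotient_transfer _ _ _ _ _ _ _ _ _ _ e1 (tu0 J) z1 z2 (evF _ Pz4) hp Kev).
Qed.

(** * The contradiction in coordinates *)

(** Flowing along X turns the displacement z - y, about s Y y, into (z - y)(1 + h A), while s Y at
    the end point is s Y y + s h X y B to first order. What is left is s h (Y A - X B), the bracket
    [Y, X]. D1 to D4 are the flow and Taylor remainders, D5 and D6 the shift from y to q; all carry
    the factor s. *)
Lemma flow_displacement {R : realType} {n : nat} (X Y : 'rV[R]_n -> 'rV[R]_n) (q : 'rV[R]_n)
    (rho L MX TX MY TY : R) (PhiX PsiX PhiY PsiY : R -> 'rV[R]_n -> 'rV[R]_n)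
    (A B : 'M[R]_n) (a b k h s : R) (y : 'rV[R]_n) :
  flow_box X q rho L MX TX PhiX PsiX -> flow_box Y q rho L MY TY PhiY PsiY ->
  0 <= a -> 0 <= b -> 0 <= k ->
  (forall u : 'rV[R]_n, `|u *m A| <= a * `|u|) -> (forall u : 'rV[R]_n, `|u *m B| <= b * `|u|) ->
  (forall x x', `|x - q| <= rho -> `|x' - q| <= rho ->
    `|X x - X x' - (x - x') *m A| <= k * `|x - x'|) ->
  (forall x x', `|x - q| <= rho -> `|x' - q| <= rho ->
    `|Y x - Y x' - (x - x') *m B| <= k * `|x - x'|) ->
  `|y - q| <= rho / 4 -> 0 <= h <= TX -> 0 <= s <= TY ->
  `|PhiX h (PhiY s y) - PhiX h y - s *: Y (PhiX h y) - (s * h) *: (Y q *m A - X q *m B)| <=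
    s * (h * (2 * k + 2 * a * L * h) * MY + (1 + h * a) * (L * (s * MY)) + k * (h * MX) +
         b * (h * (L * (h * MX))) + h * (L * `|y - q| * (a + b))).
Proof.
move=> hX hY a0 b0 k0 hA hB XA YB yq hT sT.
have [[r0 L0 MX0 TX0 _] xL _ _ _] := hX.
have [[_ _ MY0 TY0 _] yL _ _ _] := hY.
have [h0 _] := andP hT; have [s0 _] := andP sT.
have yq2 : `|y - q| <= rho / 2 by lra.
have yq1 : `|y - q| <= rho by lra.
have qq : `|q - q| <= rho by rewrite subrr normr0 ltW.
have [n1 n2] := flow_near _ _ _ _ _ _ _ _ hY y s yq2 sT.
have [n3 n4] := flow_near _ _ _ _ _ _ _ _ hX y h yq2 hT.
have zq : `|PhiY s y - q| <= rho / 2.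
  by rewrite -(subrKA y); apply: le_trans (ler_normD _ _) _; clear -n2 yq r0; lra.
have aq : `|PhiX h y - q| <= rho.
  by rewrite -(subrKA y); apply: le_trans (ler_normD _ _) _; clear -n4 yq r0; lra.
have d1 := flow_linear _ _ _ _ _ _ _ _ hX A a k _ _ _ a0 k0 hA XA zq yq2 hT.
have d2 := flow_taylor _ _ _ _ _ _ _ _ hY y s yq2 sT.
have d3 := YB _ _ aq yq1.
have d4 := flow_taylor _ _ _ _ _ _ _ _ hX y h yq2 hT.
have d5 := yL _ _ yq1 qq; have d6 := xL _ _ yq1 qq.
move: n1 n3 d1 d2 d3 d4 d5 d6.
move: (PhiY s y) (PhiX h y) (PhiX h (PhiY s y)) => z g f.
set D1 := f - _ - _ - _; set D2 := z - _ - _; set D3 := Y g - _ - _; set D4 := g - _ - _.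
set D5 := Y y - Y q; set D6 := X y - X q => n1 n3 d1 d2 d3 d4 d5 d6.
have -> : f - g - s *: Y g - (s * h) *: (Y q *m A - X q *m B) =
    D1 + D2 + h *: (D2 *m A) - s *: D3 - s *: (D4 *m B) + (s * h) *: (D5 *m A - D6 *m B).
  rewrite /D1 /D2 /D3 /D4 /D5 /D6 !mulmxBl -!scalemxAl.
  move: (z *m A) (y *m A) (Y y *m A) (g *m B) (y *m B) (X y *m B) (Y q *m A) (X q *m B) (Y g) (Y y).
  move=> v1 v2 v3 v4 v5 v6 v7 v8 v9 v10.
  by apply/rowP => i; rewrite !mxE; ring.
have e1 : `|D1| <= s * (h * (2 * k + 2 * a * L * h) * MY).
  apply: le_trans d1 _.
  have c0 : 0 <= h * (2 * k + 2 * a * L * h) by rewrite mulr_ge0// addr_ge0// !mulr_ge0// ltW.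
  have := ler_wpM2l c0 n1; clear; lra.
have e2 : `|D2| <= s * (L * (s * MY)) by [].
have e2' : `|h *: (D2 *m A)| <= s * (h * a * (L * (s * MY))).
  rewrite normrZ ger0_norm//.
  have := ler_wpM2l h0 (le_trans (hA D2) (ler_wpM2l a0 e2)); clear; lra.
have e3 : `|s *: D3| <= s * (k * (h * MX)).
  by rewrite normrZ ger0_norm// ler_wpM2l// (le_trans d3)// ler_wpM2l.
have e4 : `|s *: (D4 *m B)| <= s * (b * (h * (L * (h * MX)))).
  by rewrite normrZ ger0_norm// ler_wpM2l// (le_trans (hB _))// ler_wpM2l.
have e5 : `|(s * h) *: (D5 *m A - D6 *m B)| <= s * (h * (L * `|y - q| * (a + b))).
  have sh0 : 0 <= s * h by rewrite mulr_ge0.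
  rewrite normrZ ger0_norm// [leRHS]mulrA; apply: ler_wpM2l => //.
  apply: le_trans (ler_normB _ _) _.
  have := le_trans (hA D5) (ler_wpM2l a0 d5); have := le_trans (hB D6) (ler_wpM2l b0 d6).
  clear; lra.
apply: le_trans (ler_normD _ _) _; apply: le_trans (lerD (ler_normB _ _) e5) _.
apply: le_trans (lerD (lerD (ler_normB _ _) e4) (lexx _)) _.
apply: le_trans (lerD (lerD (lerD (ler_normD _ _) e3) (lexx _)) (lexx _)) _.
apply: le_trans (lerD (lerD (lerD (lerD (ler_normD _ _) e2') (lexx _)) (lexx _)) (lexx _)) _.
by move: e1 e2; clear; lra.
Qed.

(** The covector is taken at the end point a of the first curve. There it kills Y, hence the main
    term s Y a of the displacement, and what survives is at least s h / 4. The two bounds on |F b -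
    F a| are then c e1 h / 2 from below and (3/8) c e1 h from above. *)
Lemma no_transverse_embedding {R : realType} {n : nat} {V : completeNormedModType R}
    (X Y : 'rV[R]_n -> 'rV[R]_n) (q : 'rV[R]_n) (A B : 'M[R]_n) (rho0 K c C : R)
    (F : 'rV[R]_n -> V) (th : 'rV[R]_n -> 'cV[R]_n) :
  radon_nikodym_property V -> 0 < rho0 -> 0 <= K -> 0 < c -> 0 <= C ->
  sdiff X q A -> sdiff Y q B ->
  (forall sg T, 0 <= T -> ltraj X q rho0 sg T -> `|F (sg T) - F (sg 0)| <= K * T) ->
  (forall sg T, 0 <= T -> ltraj Y q rho0 sg T -> `|F (sg T) - F (sg 0)| <= K * T) ->
  (forall e, 0 < e -> exists2 d, 0 < d &
    forall y y', `|y - q| <= rho0 -> `|y' - y| < d -> `|F y' - F y| <= e) ->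
  (forall a, `|a - q| <= rho0 -> [/\ forall v : 'rV[R]_n, `|v *m th a| <= C * `|v|,
     Y a *m th a = 0 & 2^-1 <= `|(Y q *m A - X q *m B) *m th a|]) ->
  (forall a b, `|a - q| <= rho0 -> `|b - q| <= rho0 ->
     c * Num.sqrt `|(b - a) *m th a| <= `|F b - F a|) ->
  False.
Proof.
move=> RNP rho00 K0 c0 C0 sX sY hFX hFY FU hth low.
have [a a0 hA] := mx_bound A; have [b b0 hB] := mx_bound B.
have [LX [LX0 [dX dX0 hLX]]] := sdiff_lipschitz _ _ _ sX.
have [LY [LY0 [dY dY0 hLY]]] := sdiff_lipschitz _ _ _ sY.
pose L := LX + LY.
have L0 : 0 < L by rewrite addr_gt0.
pose Mb := `|X q| + `|Y q| + L + 1.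
have Mb0 : 0 < Mb.
  by rewrite /Mb ltr_wpDl// addr_ge0// ?addr_ge0// ltW.
(* The remainder of the displacement is at most s h kap; paired with the covector it is at most s h
   / 4, half of the lower bound s h / 2 for the bracket term. *)
pose kap := (4 * (C + 1))^-1.
have C1 : 0 < C + 1 by rewrite ltr_wpDl.
have kap0 : 0 < kap by rewrite invr_gt0 mulr_gt0.
have Ckap : C * kap <= 4^-1.
  by rewrite /kap ler_pdivrMr ?mulr_gt0//; lra.
pose k := kap / (6 * Mb).
have k0 : 0 < k by rewrite divr_gt0// mulr_gt0.
have [d1 d10 h1] := sX k k0; have [d2 d20 h2] := sY k k0.
have [rho rho_gt0 /= /and5P[rr0 r1 r2 r3 /and3P[r4 r5 _]]] := @positive_lower_bound R
  [:: rho0; dX / 2; dY / 2; d1 / 2; d2 / 2; 1] ltac:(by rewrite /= rho00 !divr_gt0// ltr01).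
have XA x x' : `|x - q| <= rho -> `|x' - q| <= rho -> `|X x - X x' - (x - x') *m A| <= k * `|x - x'|.
  by move=> hx hx'; apply: h1; [apply: le_lt_trans hx _|apply: le_lt_trans hx' _]; clear -r3 d10; lra.
have YB x x' : `|x - q| <= rho -> `|x' - q| <= rho -> `|Y x - Y x' - (x - x') *m B| <= k * `|x - x'|.
  by move=> hx hx'; apply: h2; [apply: le_lt_trans hx _|apply: le_lt_trans hx' _]; clear -r4 d20; lra.
have XL x x' : `|x - q| <= rho -> `|x' - q| <= rho -> `|X x - X x'| <= L * `|x - x'|.
  move=> hx hx'; apply: le_trans (hLX _ _ _ _) _.
  - by apply: le_lt_trans hx _; clear -r1 dX0; lra.
  - by apply: le_lt_trans hx' _; clear -r1 dX0; lra.
  by apply: ler_wpM2r => //; rewrite lerDl ltW.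
have YL x x' : `|x - q| <= rho -> `|x' - q| <= rho -> `|Y x - Y x'| <= L * `|x - x'|.
  move=> hx hx'; apply: le_trans (hLY _ _ _ _) _.
  - by apply: le_lt_trans hx _; clear -r2 dY0; lra.
  - by apply: le_lt_trans hx' _; clear -r2 dY0; lra.
  by apply: ler_wpM2r => //; rewrite lerDr ltW.
have [TX [PhiX [PsiX hbX]]] := flow_box_exists X q rho L rho_gt0 L0 XL.
have [TY [PhiY [PsiY hbY]]] := flow_box_exists Y q rho L rho_gt0 L0 YL.
have MXb : `|X q| + L * rho + 1 <= Mb.
  rewrite /Mb lerD2r -addrA lerD2l; have : L * rho <= L by rewrite ler_piMr// ltW.
  by have := normr_ge0 (Y q); clear; lra.
have MYb : `|Y q| + L * rho + 1 <= Mb.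
  rewrite /Mb lerD2r addrAC addrC; have : L * rho <= L by rewrite ler_piMr// ltW.
  by have := normr_ge0 (X q); clear; lra.
have up sg T (Z : 'rV[R]_n -> 'rV[R]_n) : ltraj Z q rho sg T -> ltraj Z q rho0 sg T.
  by move=> h t ht; have [p1 p2] := h t ht; split=> //; exact: le_trans p1 rr0.
have hFX' sg T (T0 : 0 <= T) (tr : ltraj X q rho sg T) := hFX sg T T0 (up _ _ _ tr).
have hFY' sg T (T0 : 0 <= T) (tr : ltraj Y q rho sg T) := hFY sg T T0 (up _ _ _ tr).
have FU' e : 0 < e -> exists2 d, 0 < d &
    forall y y', `|y - q| <= rho -> `|y' - y| < d -> `|F y' - F y| <= e.
  move=> /FU[d d0 hd]; exists d; first exact: d0.
  move=> y y' yq; exact: hd _ _ (le_trans yq rr0).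
(* The remainder splits in two halves of kap: the strict differentiability terms give 3 k Mb = kap /
   2, and those proportional to h, eps or |y - q|, all at most dl, give at most dl Q. *)
pose Q := 2 * a * L * Mb + (1 + a) * L * Mb + b * L * Mb + L * (a + b).
have [L0' M0'] : 0 <= L /\ 0 <= Mb by split; exact: ltW.
have Q0 : 0 <= Q.
  have a1 : 0 <= 1 + a by apply: addr_ge0.
  have ab0 : 0 <= a + b by apply: addr_ge0.
  apply: addr_ge0; last exact: mulr_ge0.
  by apply: addr_ge0; [apply: addr_ge0|]; do ![apply: mulr_ge0].
have Q1 : 0 < Q + 1 by rewrite ltr_wpDl.
have K1 : 0 < 4 * (K + 1) by rewrite mulr_gt0// ltr_wpDl.
have [dl dl0 /= /and4P[dl1 dl2 dl3 _]] := @positive_lower_bound R [:: kap / 2 / (Q + 1); 1; rho / 4]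
  ltac:(by rewrite /= ltr01 !divr_gt0).
have {}dl1 : dl * Q <= kap / 2.
  by move: dl1; rewrite ler_pdivlMr//; clear -dl0; lra.
have [e1 e10 /= /and4P[e11 e12 e13 _]] := @positive_lower_bound R [:: 1; dl; c / (4 * (K + 1))]
  ltac:(by rewrite /= dl0 ltr01 divr_gt0).
(* A square, so that sqrt (s h) is exactly e1 h. K eps is quadratic in e1 while the lower bound is
   linear in it: small eps wins. *)
pose eps := e1 ^+ 2.
have eps0 : 0 < eps by rewrite exprn_gt0.
have epsd : eps <= dl.
  by rewrite /eps expr2; apply: le_trans e12; rewrite ler_piMr// ltW.
have Ke : K * eps <= c * e1 / 4.
  move: e13; rewrite ler_pdivlMr// => e13.
  have : e1 * (e1 * (4 * (K + 1))) <= e1 * c by rewrite ler_pM2l.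
  have : 0 <= e1 * e1 by rewrite mulr_ge0// ltW.
  by rewrite /eps expr2; clear; lra.
(* Then 3 eta = c e1 / 8, which with K eps <= c e1 / 4 stays below c e1 / 2. *)
pose eta := c * e1 / 24.
have eta0 : 0 < eta by rewrite divr_gt0// mulr_gt0.
have [h [y [/andP[h0 hd] ehd hTX ehTY [yd hF]]]] := almost_commuting_pair X Y q rho L _ TX _ TY
  PhiX PsiX PhiY PsiY F K eps eta dl RNP hbX hbY K0 hFX' hFY' FU' eps0 eta0 dl0.
pose s := eps * h.
have s0 : 0 < s by rewrite mulr_gt0.
have hT' : 0 <= h <= TX by rewrite (ltW h0).
have sT' : 0 <= s <= TY by rewrite (ltW s0).
have yq4 : `|y - q| <= rho / 4 by exact: le_trans yd dl3.
have yq2 : `|y - q| <= rho / 2 by clear -yq4 rho_gt0; lra.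
have D := flow_displacement X Y q rho L _ TX _ TY PhiX PsiX PhiY PsiY A B a b k h s y
  hbX hbY a0 b0 (ltW k0) hA hB XA YB yq4 hT' sT'.
have [_ p1] := flow_near _ _ _ _ _ _ _ _ hbX y h yq2 hT'.
have [_ p2] := flow_near _ _ _ _ _ _ _ _ hbY y s yq2 sT'.
have zq2 : `|PhiY s y - q| <= rho / 2.
  by rewrite -(subrKA y); apply: le_trans (ler_normD _ _) _; clear -p2 yq4 rho_gt0; lra.
have [_ p3] := flow_near _ _ _ _ _ _ _ _ hbX (PhiY s y) h zq2 hT'.
have aq : `|PhiX h y - q| <= rho0.
  by rewrite -(subrKA y); apply: le_trans (ler_normD _ _) _; clear -p1 yq4 rho_gt0 rr0; lra.
have bq : `|PhiX h (PhiY s y) - q| <= rho0.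
  by rewrite -(subrKA (PhiY s y)); apply: le_trans (ler_normD _ _) _; clear -p3 zq2 rho_gt0 rr0; lra.
have {}D : `|PhiX h (PhiY s y) - PhiX h y - s *: Y (PhiX h y) - (s * h) *: (Y q *m A - X q *m B)|
    <= s * h * kap.
  apply: le_trans D _; rewrite -[leRHS]mulrA; apply: ler_wpM2l; first exact: ltW.
  move: MXb MYb; move: (`|X q| + L * rho + 1) (`|Y q| + L * rho + 1) => MX MY MXb MYb.
  have -> : h * (2 * k + 2 * a * L * h) * MY + (1 + h * a) * (L * (s * MY)) + k * (h * MX) +
         b * (h * (L * (h * MX))) + h * (L * `|y - q| * (a + b)) =
      h * (2 * k * MY + 2 * a * L * h * MY + (1 + h * a) * L * eps * MY + k * MX +
         b * L * h * MX + L * `|y - q| * (a + b)) by rewrite /s; ring.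
  apply: ler_wpM2l; first exact: ltW.
  have hd' := ltW hd; have h1' : h <= 1 by exact: le_trans hd' dl2.
  have kM : k * Mb = kap / 6 by rewrite /k; field; rewrite gt_eqF.
  have b1 : k * MY <= k * Mb by rewrite ler_wpM2l// ltW.
  have b2 : k * MX <= k * Mb by rewrite ler_wpM2l// ltW.
  have aL : 0 <= a * L by rewrite mulr_ge0// ltW.
  have b3 : a * L * h * MY <= a * L * dl * Mb.
    apply: le_trans (_ : a * L * h * Mb <= _).
      by apply: ler_wpM2l => //; rewrite mulr_ge0// ltW.
    by apply: ler_wpM2r; [exact: ltW|apply: ler_wpM2l].
  have bL : 0 <= b * L by rewrite mulr_ge0// ltW.
  have b4 : b * L * h * MX <= b * L * dl * Mb.
    apply: le_trans (_ : b * L * h * Mb <= _).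
      by apply: ler_wpM2l => //; rewrite mulr_ge0// ltW.
    by apply: ler_wpM2r; [exact: ltW|apply: ler_wpM2l].
  have ab0 : 0 <= a + b by rewrite addr_ge0.
  have b5 : L * `|y - q| * (a + b) <= L * dl * (a + b).
    by apply: ler_wpM2r => //; apply: ler_wpM2l => //; exact: ltW.
  have b6 : (1 + h * a) * L * eps * MY <= (1 + a) * L * dl * Mb.
    have c1 : 1 + h * a <= 1 + a by rewrite lerD2l ler_piMl.
    have c2 : 0 <= 1 + h * a by rewrite addr_ge0// mulr_ge0// ltW.
    have c3 : (1 + h * a) * L <= (1 + a) * L by apply: ler_wpM2r => //; exact: ltW.
    have c4 : (1 + h * a) * L * eps <= (1 + a) * L * dl.
      by apply: ler_pM => //; [rewrite mulr_ge0// ltW|exact: ltW].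
    have c5 : 0 <= (1 + h * a) * L * eps by rewrite !mulr_ge0// ltW.
    apply: le_trans (_ : (1 + h * a) * L * eps * Mb <= _); first exact: ler_wpM2l.
    by apply: ler_wpM2r => //; exact: ltW.
  move: dl1 b1 b2 b3 b4 b5 b6; rewrite kM /Q; clear; lra.
have [th1 th2 th3] := hth _ aq.
have lb : s * h / 4 <= `|(PhiX h (PhiY s y) - PhiX h y) *m th (PhiX h y)|.
  have e : (PhiX h (PhiY s y) - PhiX h y - s *: Y (PhiX h y) - (s * h) *: (Y q *m A - X q *m B))
      *m th (PhiX h y) = (PhiX h (PhiY s y) - PhiX h y) *m th (PhiX h y) -
      (s * h) *: ((Y q *m A - X q *m B) *m th (PhiX h y)).
    have gen (u v w : 'rV[R]_n) (c1 c2 : R) (t : 'cV[R]_n) : v *m t = 0 ->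
        (u - c1 *: v - c2 *: w) *m t = u *m t - c2 *: (w *m t).
      by move=> v0; rewrite mulmxBl mulmxBl -!scalemxAl v0 scaler0 subr0.
    exact: gen.
  have t1 := le_trans (th1 _) (ler_wpM2l C0 D); rewrite e in t1.
  have sh0 : 0 < s * h by rewrite mulr_gt0.
  have t2 : s * h * 2^-1 <= `|(s * h) *: ((Y q *m A - X q *m B) *m th (PhiX h y))|.
    by rewrite normrZ gtr0_norm// ler_pM2l.
  have t3 : C * (s * h * kap) <= s * h * 4^-1.
    by rewrite mulrCA ler_pM2l.
  move: t1 t2; move: (_ *m th _) (_ *: _) => u w t1 t2.
  have : `|w| <= `|u| + `|u - w|.
    by rewrite -{1}(subrK u w) addrC; apply: le_trans (ler_normD _ _) _; rewrite [X in _ + X <= _]distrC.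
  by move: t1 t2 t3; clear; lra.
have := low _ _ aq bq.
have sq : e1 * h / 2 <= Num.sqrt `|(PhiX h (PhiY s y) - PhiX h y) *m th (PhiX h y)|.
  have -> : e1 * h / 2 = Num.sqrt (s * h / 4).
    have -> : s * h / 4 = (e1 * h / 2) ^+ 2 by rewrite /s /eps; field.
    by rewrite sqrtr_sqr ger0_norm// divr_ge0// mulr_ge0// ltW.
  by rewrite ler_wsqrtr.
have := ler_wpM2l (ltW c0) sq.
have hF' : `|F (PhiX h (PhiY s y)) - F (PhiX h y)| <= K * (eps * h) + 3 * eta * h.
  by rewrite distrC.
have q1 : K * eps * h <= c * e1 / 4 * h by rewrite ler_pM2r.
have q2 : 0 < c * e1 * h by rewrite !mulr_gt0.
move: hF' q1 q2; rewrite /eta; clear; lra.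
Qed.

(** * Charts and brackets *)

Lemma near_diff_comp {R : realType} (V W Z : normedModType R) (f : V -> W) (g : W -> Z) (h : V -> Z)
    (x : V) (y : W) : f x = y -> differentiable f x -> differentiable g y ->
  (\forall z \near x, g (f z) = h z) ->
  differentiable h x /\ forall v, 'd h x v = 'd g y ('d f x v).
Proof.
move=> <- df dg hn.
have [h1 h2] := near_eq_diff V Z (g \o f) h x hn (differentiable_comp df dg).
by split=> // v; rewrite h2 (diff_comp df dg).
Qed.

Section Charts.
Context {R : realType} {n : nat} {M : smoothManifold R n}.
Implicit Types (c : chart R n M) (p : M) (U : set M) (y : 'rV[R]_n).

Lemma chart_invP c y : (c @` chart_dom c) y -> chart_dom c (chart_inv c y) /\ c (chart_inv c y) = y.
Proof. by move=> [p cp <-]; rewrite chart_funK. Qed.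

Lemma chart_continuous c p : chart_dom c p -> {for p, continuous c}.
Proof.
move=> cp; have := @chart_fun_continuous _ _ _ c.
rewrite continuous_open_subspace; last exact: chart_dom_open.
by apply; rewrite inE.
Qed.

Lemma chart_inv_continuous_at c y : (c @` chart_dom c) y -> {for y, continuous (chart_inv c)}.
Proof.
move=> cy; have := @chart_inv_continuous _ _ _ c.
rewrite continuous_open_subspace; last exact: chart_img_open.
by apply; rewrite inE.
Qed.

Lemma chart_image_near c U p : open U -> U p -> chart_dom c p ->
  exists2 d : R, 0 < d & forall y, `|y - c p| < d -> (c @` (U `&` chart_dom c)) y.
Proof.
move=> oU Up cp; have cy : (c @` chart_dom c) (c p) by exists p.
have h1 : nbhs (chart_inv c (c p)) U.
  by rewrite chart_funK//; apply: open_nbhs_nbhs; split.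
have /nbhs_eps[d1 d10 hd1] := chart_inv_continuous_at c _ cy _ h1.
have [d2 d20 hd2] := open_eps _ _ _ (@chart_img_open _ _ _ c) cy.
exists (Num.min d1 d2); first by rewrite lt_min d10.
move=> y; rewrite lt_min => /andP[y1 y2].
have [q1 q2] := chart_invP _ _ (hd2 _ y2).
by exists (chart_inv c y) => //; split=> //; exact: hd1.
Qed.

Lemma chart_image_open c U : open U -> open (c @` (U `&` chart_dom c)).
Proof.
move=> oU; rewrite openE => _ [p [Up cp] <-].
by apply/nbhs_eps; exact: chart_image_near.
Qed.

Lemma chart_ball_open c p (d : R) : chart_dom c p ->
  (forall y, `|y - c p| < d -> (c @` chart_dom c) y) ->
  open (chart_dom c `&` [set q | `|c q - c p| < d]).
Proof.
move=> cp hd; rewrite openE => q [cq qd].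
apply: filterI; first by apply: open_nbhs_nbhs; split=> //; exact: chart_dom_open.
have hb : nbhs (c q) [set y | `|y - c p| < d].
  apply/nbhs_eps; exists (d - `|c q - c p|); first by rewrite subr_gt0.
  move=> y yq /=; rewrite -(subrKA (c q)); apply: le_lt_trans (ler_normD _ _) _; lra.
exact: (chart_continuous c q cq _ hb).
Qed.

Definition tmap c c' p : 'rV[R]_n -> 'rV[R]_n := 'd (c' \o chart_inv c) (c p).

Lemma transition_Ck c c' k : atlas c -> atlas c' ->
  Ck_on k (c @` (chart_dom c `&` chart_dom c')) (c' \o chart_inv c).
Proof. by move=> ac ac'; exact: atlas_compatible. Qed.

Lemma transition_diff c c' p : atlas c -> atlas c' -> chart_dom c p -> chart_dom c' p ->
  differentiable (c' \o chart_inv c) (c p).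
Proof.
move=> ac ac' cp c'p; have [h _] := transition_Ck c c' 1 ac ac'.
by apply: h; exists p.
Qed.

Lemma tmap_comp c1 c2 c3 p v : atlas c1 -> atlas c2 -> atlas c3 ->
  chart_dom c1 p -> chart_dom c2 p -> chart_dom c3 p ->
  tmap c1 c3 p v = tmap c2 c3 p (tmap c1 c2 p v).
Proof.
move=> a1 a2 a3 p1 p2 p3; rewrite /tmap.
have d12 := transition_diff c1 c2 p a1 a2 p1 p2.
have d23 := transition_diff c2 c3 p a2 a3 p2 p3.
have e : (c2 \o chart_inv c1) (c1 p) = c2 p by rewrite /= chart_funK.
have [|_ h] := near_diff_comp _ _ _ _ _ (c3 \o chart_inv c1) _ _ e d12 d23; last exact: h.
have [d d0 hd] := chart_image_near c1 _ p (@chart_dom_open _ _ _ c2) p2 p1.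
apply/nbhs_eps; exists d => // y /hd[q [q2 q1] <-] /=.
by rewrite (chart_funK q1) (chart_funK q2).
Qed.

Lemma tmap_id c p v : chart_dom c p -> tmap c c p v = v.
Proof.
move=> cp; rewrite /tmap.
have hn : \forall y \near c p, id y = (c \o chart_inv c) y.
  have [d d0 hd] := open_eps _ _ _ (@chart_img_open _ _ _ c) (ex_intro2 _ _ p cp erefl : (c @` chart_dom c) (c p)).
  by apply/nbhs_eps; exists d => // y /hd /chart_invP[_].
have [di ei] := @is_diff_id R 'rV[R]_n (c p).
have [_ ->] := near_eq_diff _ _ _ _ _ hn di.
by rewrite ei.
Qed.

Lemma tmapK c c' p v : atlas c -> atlas c' -> chart_dom c p -> chart_dom c' p ->
  tmap c' c p (tmap c c' p v) = v.
Proof. by move=> a a' h h'; rewrite -(tmap_comp c c' c)// tmap_id. Qed.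

Lemma tmapD c c' p u v : tmap c c' p (u + v) = tmap c c' p u + tmap c c' p v.
Proof. by rewrite /tmap linearD. Qed.

Lemma tmapZ c c' p a v : tmap c c' p (a *: v) = a *: tmap c c' p v.
Proof. by rewrite /tmap linearZ. Qed.

Lemma tmap_sum c c' p m (v : 'I_m -> 'rV[R]_n) :
  tmap c c' p (\sum_(i < m) v i) = \sum_(i < m) tmap c c' p (v i).
Proof. by rewrite /tmap linear_sum. Qed.

Lemma local_repE c (X : M -> 'rV[R]_n) p : chart_dom c p ->
  local_rep c X (c p) = tmap (chart_at p) c p (X p).
Proof. by move=> cp; rewrite /local_rep chart_funK. Qed.

Lemma local_rep_transport c c' (X : M -> 'rV[R]_n) p : atlas c -> atlas c' ->
  chart_dom c p -> chart_dom c' p ->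
  local_rep c' X (c' p) = tmap c c' p (local_rep c X (c p)).
Proof.
move=> a a' h h'; rewrite !local_repE// -tmap_comp//.
- exact: chart_at_atlas.
- exact: chart_at_dom.
Qed.

Lemma curve_derive c c' (gam : R -> M) (t : R) (w : 'rV[R]_n) : atlas c -> atlas c' ->
  chart_dom c (gam t) -> chart_dom c' (gam t) -> {for t, continuous gam} ->
  is_derive t 1 (c \o gam) w -> is_derive t 1 (c' \o gam) (tmap c c' (gam t) w).
Proof.
move=> a a' h h' cg [/derivable1_diffP dg ew].
have dt := transition_diff c c' _ a a' h h'.
have [|d1 d2] := near_diff_comp _ _ _ (c \o gam) _ (c' \o gam) t _ erefl dg dt.
  have : \forall s \near t, chart_dom c (gam s).
    by apply: cg; apply: open_nbhs_nbhs; split=> //; exact: chart_dom_open.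
  by apply: filterS => s hs /=; rewrite chart_funK.
split; first exact/derivable1_diffP.
by rewrite (deriveE _ d1) d2 -ew (deriveE _ dg).
Qed.

End Charts.

Section Brackets.
Context {R : realType} {n : nat}.
Implicit Types (xi eta : 'rV[R]_n -> 'rV[R]_n) (U : set 'rV[R]_n).

Definition bracket xi eta (x : 'rV[R]_n) : 'rV[R]_n := 'd eta x (xi x) - 'd xi x (eta x).

Lemma diff_along m (f : 'rV[R]_n -> 'rV[R]_m) (w : 'rV[R]_n -> 'rV[R]_n) :
  (fun x => 'd f x (w x)) = (fun x => \sum_(j < n) w x ord0 j *: 'd f x (delta_mx ord0 j)).
Proof. by apply/funext => x; exact: (linear_basis _ ('d f x)). Qed.

Lemma coord_linear_continuous j : exists2 A : {linear 'rV[R]_n -> R}, continuous A & forall v, A v = v ord0 j.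
Proof.
have lin : linear (fun v : 'rV[R]_n => v ord0 j) by move=> a u v; rewrite !mxE.
pose A := GRing.isLinear.Build R 'rV[R]_n R _ (fun v : 'rV[R]_n => v ord0 j) lin.
pose B : {linear 'rV[R]_n -> R} := HB.pack (fun v : 'rV[R]_n => v ord0 j) A.
exists B => // x; apply/continuous_eps => e e0; exists e => // y yx.
by apply: le_lt_trans yx; have := rV_norm_coord (y - x) j; rewrite !mxE.
Qed.

Lemma Ck_coord k U (w : 'rV[R]_n -> 'rV[R]_n) j : open U -> Ck_on k U w ->
  Ck_on k U (fun x => w x ord0 j).
Proof.
move=> oU hw; have [A cA hA] := coord_linear_continuous j.
have -> : (fun x => w x ord0 j) = (fun x => A (w x)) by apply/funext => x; rewrite hA.
exact: Ck_on_linear.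
Qed.

Lemma Ck_on_along k m U (f : 'rV[R]_n -> 'rV[R]_m) w : open U -> Ck_on k.+1 U f -> Ck_on k U w ->
  Ck_on k U (fun x => 'd f x (w x)).
Proof.
move=> oU [_ hf] hw; rewrite diff_along; apply: Ck_on_sum => // j.
by apply: Ck_on_scale; [exact: oU|exact: Ck_coord|exact: hf].
Qed.

Lemma Ck_on_bracket k U xi eta : open U -> Ck_on k.+1 U xi -> Ck_on k.+1 U eta ->
  Ck_on k U (bracket xi eta).
Proof.
move=> oU hx he; apply: Ck_onD => //; first by apply: Ck_on_along => //; exact: Ck_onS.
have -> : (fun x => - 'd xi x (eta x)) = (fun x => (-1 : R) *: 'd xi x (eta x)).
  by apply/funext => x; rewrite scaleN1r.
apply: Ck_on_scale => //; first exact: Ck_on_cst.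
by apply: Ck_on_along => //; exact: Ck_onS.
Qed.

Lemma diff_along_diff m U (f : 'rV[R]_n -> 'rV[R]_m) w (x v : 'rV[R]_n) : open U -> U x ->
  Ck_on 2 U f -> differentiable w x ->
  differentiable (fun y => 'd f y (w y)) x /\
  'd (fun y => 'd f y (w y)) x v = 'd (fun y => 'd f y (w x)) x v + 'd f x ('d w x v).
Proof.
move=> oU Ux [df d2f] dw.
have dfj u : differentiable (fun y => 'd f y u) x by have [h _] := d2f u; exact: h.
have dwj j : differentiable (fun y => w y ord0 j) x /\
    'd (fun y => w y ord0 j) x v = 'd w x v ord0 j.
  have [A cA hA] := coord_linear_continuous j.
  have [h1 h2] := diff_linear_comp _ _ _ A w x cA dw.
  have e : (fun y => A (w y)) = (fun y => w y ord0 j) by apply/funext => y; rewrite hA.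
  by rewrite e in h1 h2; rewrite h2 hA.
have dsc j := diff_scale _ _ _ _ x (dwj j).1 (dfj (delta_mx ord0 j)).
have [s1 s2] := diff_sum n _ _ (fun j y => w y ord0 j *: 'd f y (delta_mx ord0 j)) x (fun j => (dsc j).1).
rewrite diff_along; split; first exact: s1.
have c1 : 'd (fun y => 'd f y (w x)) x v =
    \sum_(j < n) w x ord0 j *: 'd (fun y => 'd f y (delta_mx ord0 j)) x v.
  rewrite (diff_along m f (fun=> w x)).
  have dsc' j := diff_scale _ _ _ _ x (differentiable_cst (w x ord0 j) x) (dfj (delta_mx ord0 j)).
  have [_ h] := diff_sum n _ _ (fun j y => w x ord0 j *: 'd f y (delta_mx ord0 j)) x (fun j => (dsc' j).1).
  apply: etrans (h v) _; apply: eq_bigr => j _; apply: etrans ((dsc' j).2 v) _.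
  by rewrite [X in _ + X *: _](_ : _ = 0) ?scale0r ?addr0// diff_cst.
have c2 := linear_basis _ ('d f x) ('d w x v).
apply: etrans (s2 v) _; apply: etrans (esym (congr2 +%R c1 c2)).
rewrite -big_split/=; apply: eq_bigr => j _; apply: etrans ((dsc j).2 v) _.
by congr (_ + _ *: _); exact: (dwj j).2.
Qed.

(* The second derivatives of phi cancel by symmetry. *)
Lemma bracket_natural U (phi xi eta xi' eta' : 'rV[R]_n -> 'rV[R]_n) (x : 'rV[R]_n) :
  open U -> U x -> Ck_on 2 U phi -> differentiable xi x -> differentiable eta x ->
  differentiable xi' (phi x) -> differentiable eta' (phi x) ->
  (forall y, U y -> xi' (phi y) = 'd phi y (xi y)) ->
  (forall y, U y -> eta' (phi y) = 'd phi y (eta y)) ->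
  bracket xi' eta' (phi x) = 'd phi x (bracket xi eta x).
Proof.
move=> oU Ux hphi dx de dx' de' hx he.
have dphi : differentiable phi x by have [h _] := hphi; exact: h.
have main (w w' : 'rV[R]_n -> 'rV[R]_n) v : differentiable w x -> differentiable w' (phi x) ->
    (forall y, U y -> w' (phi y) = 'd phi y (w y)) ->
    'd w' (phi x) ('d phi x v) = 'd (fun y => 'd phi y (w x)) x v + 'd phi x ('d w x v).
  move=> dw dw' hw.
  have [h1 h3] := diff_along_diff n U phi w x v oU Ux hphi dw.
  have hn : \forall y \near x, w' (phi y) = 'd phi y (w y).
    have : \forall y \near x, U y by apply: open_nbhs_nbhs.
    by apply: filterS => y Uy; rewrite hw.
  have [_ h2] := near_diff_comp _ _ _ phi w' (fun y => 'd phi y (w y)) x _ erefl dphi dw' hn.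
  exact: etrans (esym (h2 v)) h3.
have m1 := main eta eta' (xi x) de de' he; have m2 := main xi xi' (eta x) dx dx' hx.
have sw := schwarz U phi x (eta x) (xi x) oU hphi Ux.
rewrite /bracket (hx x Ux) (he x Ux); apply: etrans (congr2 (fun a b => a - b) m1 m2) _.
have lb := linearB ('d phi x) ('d eta x (xi x)) ('d xi x (eta x)).
apply: etrans (esym lb).
have alg (a b r s : 'rV[R]_n) : a = b -> a + r - (b + s) = r - s.
  by move=> ->; rewrite opprD addrACA subrr add0r.
exact: alg.
Qed.

End Brackets.

(** * Sections and their integral curves *)

Section Fields.
Context {R : realType} {n : nat} {M : smoothManifold R n}.
Implicit Types (c : chart R n M) (p : M) (U : set M) (X Y W : M -> 'rV[R]_n).

Lemma smooth_field_sub U U' X : U' `<=` U -> smooth_field U X -> smooth_field U' X.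
Proof.
move=> UU hX c ac k; apply: Ck_on_sub (hX c ac k).
by move=> _ [p [Up cp] <-]; exists p => //; split=> //; exact: UU.
Qed.

Lemma smooth_field_diff U X c p : smooth_field U X -> atlas c -> U p -> chart_dom c p ->
  differentiable (local_rep c X) (c p).
Proof. by move=> hX ac Up cp; apply: smooth_on_differentiable (hX c ac) _; exists p. Qed.

(** The bracket at p is computed in [chart_at p], a chart that may vary with p in any manner.
    Naturality under the transition maps expresses it in one fixed chart, where its smoothness and
    continuity can be read. *)
Lemma local_rep_bracket U X Y c p : open U -> smooth_field U X -> smooth_field U Y -> atlas c ->
  U p -> chart_dom c p ->
  local_rep c (lie_bracket X Y) (c p) = bracket (local_rep c X) (local_rep c Y) (c p).
Proof.
move=> oU hX hY ac Up cp; rewrite local_repE//.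
set c0 := chart_at p; have c0p : chart_dom c0 p by exact: chart_at_dom.
have ac0 : atlas c0 by exact: chart_at_atlas.
pose D := c0 @` ((U `&` chart_dom c) `&` chart_dom c0).
have oD : open D.
  by apply: chart_image_open; apply: openI => //; exact: chart_dom_open.
have Dx : D (c0 p) by exists p.
have phix : (c \o chart_inv c0) (c0 p) = c p by rewrite /= chart_funK.
have hphi : Ck_on 2 D (c \o chart_inv c0).
  apply: Ck_on_sub (transition_Ck c0 c 2 ac0 ac).
  by move=> _ [q [[Uq cq] c0q] <-]; exists q.
have tr W : forall y, D y -> local_rep c W ((c \o chart_inv c0) y) = 'd (c \o chart_inv c0) y (local_rep c0 W y).
  move=> _ [q [[Uq cq] c0q] <-]; rewrite /= (chart_funK c0q).
  exact: local_rep_transport.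
have := bracket_natural D (c \o chart_inv c0) (local_rep c0 X) (local_rep c0 Y)
  (local_rep c X) (local_rep c Y) (c0 p) oD Dx hphi.
rewrite phix => h; symmetry; apply: h; try exact: tr.
- exact: smooth_field_diff hX ac0 Up c0p.
- exact: smooth_field_diff hY ac0 Up c0p.
- exact: smooth_field_diff hX ac Up cp.
- exact: smooth_field_diff hY ac Up cp.
Qed.

Lemma smooth_field_bracket U X Y : open U -> smooth_field U X -> smooth_field U Y ->
  smooth_field U (lie_bracket X Y).
Proof.
move=> oU hX hY c ac k.
have oI := chart_image_open c U oU.
apply: (Ck_on_ext _ _ _ _ (bracket (local_rep c X) (local_rep c Y))) => //.
  by move=> _ [p [Up cp] <-]; rewrite (local_rep_bracket U).
by apply: Ck_on_bracket => //; [exact: hX|exact: hY].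
Qed.

Lemma smooth_fieldD_sum U m X (Z : 'I_m -> M -> 'rV[R]_n) (u : 'I_m -> R) W : open U ->
  smooth_field U X -> (forall j, smooth_field U (Z j)) ->
  (forall p, U p -> W p = X p + \sum_(j < m) u j *: Z j p) -> smooth_field U W.
Proof.
move=> oU hX hZ hW c ac k; have oI := chart_image_open c U oU.
apply: (Ck_on_ext _ _ _ _ (fun y => local_rep c X y + \sum_(j < m) u j *: local_rep c (Z j) y)) => //.
  move=> _ [p [Up cp] <-]; rewrite !local_repE// (hW p Up) tmapD tmap_sum; congr (_ + _).
  by apply: eq_bigr => j _; rewrite local_repE// tmapZ.
apply: Ck_onD => //; first exact: hX.
apply: Ck_on_sum => // j; apply: Ck_on_scale => //; last exact: hZ.
exact: Ck_on_cst.
Qed.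

Variable Delta : M -> {vspace 'rV[R]_n}.

Lemma sections_sub U U' X : U' `<=` U -> sections Delta U X -> sections Delta U' X.
Proof.
by move=> UU [hX hD]; split; [exact: smooth_field_sub UU hX|move=> p /UU; exact: hD].
Qed.

Lemma flag_sub i U U' W : U' `<=` U -> flag Delta i U W -> flag Delta i U' W.
Proof.
move=> UU; rewrite /flag; elim: i.-1 W => [|k IH] W; first exact: sections_sub.
rewrite !iterS => -[X [m [Y [Z [hX hY hZ hW]]]]]; exists X, m, Y, Z; split.
- exact: IH.
- by move=> j; exact: sections_sub UU (hY j).
- by move=> j; exact: IH.
- by move=> p /UU; exact: hW.
Qed.

Lemma flag_smooth i U W : open U -> flag Delta i U W -> smooth_field U W.
Proof.
move=> oU; rewrite /flag; elim: i.-1 W => [|k IH] W; first by case.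
rewrite iterS => -[X [m [Y [Z [hX hY hZ hW]]]]].
apply: (smooth_fieldD_sum U m X (fun j => lie_bracket (Y j) (Z j)) (fun=> 1)) => //.
- exact: IH.
- by move=> j; apply: smooth_field_bracket => //; [case: (hY j)|exact: IH].
- by move=> p Up; rewrite hW//; congr (_ + _); apply: eq_bigr => j _; rewrite scale1r.
Qed.

Lemma flag_involutive (Om : set M) i U W : open U -> U `<=` Om ->
  (forall V X Y p, open V -> V `<=` Om -> sections Delta V X -> sections Delta V Y -> V p ->
     lie_bracket X Y p \in Delta p) ->
  flag Delta i U W -> sections Delta U W.
Proof.
move=> oU UO inv; rewrite /flag; elim: i.-1 W => [//|k IH] W.
rewrite iterS => -[X [m [Y [Z [hX hY hZ hW]]]]]; split.
  apply: (smooth_fieldD_sum U m X (fun j => lie_bracket (Y j) (Z j)) (fun=> 1)) => //.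
  - by have [] := IH _ hX.
  - move=> j; apply: smooth_field_bracket => //; [by case: (hY j)|].
    by have [] := IH _ (hZ j).
  - by move=> p Up; rewrite hW//; congr (_ + _); apply: eq_bigr => j _; rewrite scale1r.
move=> p Up; rewrite hW//; apply: rpredD; first by have [_ h] := IH _ hX; exact: h.
by apply: rpred_sum => j _; apply: (inv U) => //; exact: IH.
Qed.

End Fields.

Lemma lipschitz_abs_continuous {R : realType} (W : normedModType R) (f : R -> W) (a b K : R) :
  (forall u v, a <= u -> u <= v -> v <= b -> `|f v - f u| <= K * (v - u)) -> abs_continuous f a b.
Proof.
move=> hf e e0; have K1 : 0 < `|K| + 1 by rewrite ltr_wpDl.
exists (e / (`|K| + 1)); first by rewrite divr_gt0.
move=> m u v huv _ hd.
apply: le_lt_trans (_ : (`|K| + 1) * \sum_(i < m) (v i - u i) < _); last by rewrite mulrC -ltr_pdivlMr.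
rewrite mulr_sumr; apply: ler_sum => i _; have [h1 h2 h3] := huv i.
apply: le_trans (hf _ _ h1 h2 h3) _; apply: ler_wpM2r; first by rewrite subr_ge0.
by have := ler_norm K; lra.
Qed.

(* Measurability is not needed: the integral of a nonnegative function is defined as a supremum
   over the simple functions below it. *)
Lemma ge0_integral_le {R : realType} (A B : set R) (f g : R -> R) :
  (forall t, 0 <= f t) -> (forall t, 0 <= g t) -> A `<=` B -> (forall t, A t -> f t <= g t) ->
  (\int[@lebesgue_measure R]_(t in A) (f t)%:E <= \int[@lebesgue_measure R]_(t in B) (g t)%:E)%E.
Proof.
move=> f0 g0 AB fg.
rewrite ge0_integralE; last by move=> t _; rewrite lee_fin.
rewrite [leRHS]ge0_integralE; last by move=> t _; rewrite lee_fin.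
apply: le_ereal_sup => _ [h hh <-]; exists h => // t; apply: le_trans (hh t) _.
rewrite !patchE; case: ifPn; last by case: ifPn => // _ _; rewrite lee_fin.
rewrite inE => At; rewrite mem_set; last exact: AB.
by rewrite lee_fin; exact: fg.
Qed.

Section IntegralCurves.
Context {R : realType} {n : nat} {M : smoothManifold R n} (S : subRiemannian M).
Implicit Types (c : chart R n M) (U : set M).

Lemma integral_curve_derive c U X (sg : R -> 'rV[R]_n) (t : R) c' : atlas c -> atlas c' ->
  (c @` (U `&` chart_dom c)) (sg t) -> is_derive t 1 sg (local_rep c X (sg t)) ->
  chart_dom c' (chart_inv c (sg t)) ->
  is_derive t 1 (c' \o (chart_inv c \o sg)) (local_rep c' X (c' (chart_inv c (sg t)))) /\
  {for t, continuous (chart_inv c \o sg)}.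
Proof.
move=> ac ac' [p [Up cp] e] ds; rewrite -e (chart_funK cp) => c'p.
have csg : {for t, continuous sg}.
  by have [/derivable1_diffP/differentiable_continuous] := ds.
have cimg : (c @` chart_dom c) (sg t) by rewrite -e; exists p.
have cgam : {for t, continuous (chart_inv c \o sg)}.
  by apply: continuous_comp => //; exact: chart_inv_continuous_at.
split=> //.
have pE : (chart_inv c \o sg) t = p by rewrite /= -e chart_funK.
have hn : \forall s \near t, sg s = (c \o (chart_inv c \o sg)) s.
  have : \forall s \near t, (c @` chart_dom c) (sg s).
    by apply: csg; apply: open_nbhs_nbhs; split=> //; exact: chart_img_open.
  by apply: filterS => s /chart_invP[].
have [/derivable1_diffP dsg ew] := ds.
have [d1 d2] := near_eq_diff _ _ _ _ _ hn dsg.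
have d3 : is_derive t 1 (c \o (chart_inv c \o sg)) (local_rep c X (c p)).
  split; first exact/derivable1_diffP.
  by rewrite (deriveE _ d1) d2 -(deriveE _ dsg) ew e.
have e2 := local_rep_transport c c' X p ac ac' cp c'p.
have h1 : chart_dom c ((chart_inv c \o sg) t) by rewrite pE.
have h2 : chart_dom c' ((chart_inv c \o sg) t) by rewrite pE.
have h := curve_derive c c' (chart_inv c \o sg) t _ ac ac' h1 h2 cgam d3.
rewrite pE in h; exact: (eq_ind_r (fun w => is_derive t 1 (c' \o (chart_inv c \o sg)) w) h e2).
Qed.

Lemma integral_curve_length c U X (sg : R -> 'rV[R]_n) (T C : R) : atlas c -> 0 <= T -> 0 <= C ->
  open U -> sections (sr_distribution S) U X ->
  (forall t, 0 <= t <= T -> (c @` (U `&` chart_dom c)) (sg t) /\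
     is_derive t 1 sg (local_rep c X (sg t))) ->
  (forall t, 0 <= t <= T -> Num.sqrt (sr_metric S (chart_inv c (sg t))
     (X (chart_inv c (sg t))) (X (chart_inv c (sg t)))) <= C) ->
  (cc_dist S (chart_inv c (sg 0%R)) (chart_inv c (sg T)) <= (C * T)%:E)%E.
Proof.
move=> ac T0 C0 oU [sX XD] hsg hC.
pose gam := chart_inv c \o sg.
have gU t : 0 <= t <= T -> U (gam t).
  by move=> /hsg[[p [Up cp] e] _]; rewrite /gam /= -e (chart_funK cp).
have hd c' t : atlas c' -> 0 <= t <= T -> chart_dom c' (gam t) ->
    is_derive t 1 (c' \o gam) (local_rep c' X (c' (gam t))) /\ {for t, continuous gam}.
  move=> ac' tT c't; have [h1 h2] := hsg t tT.
  exact: (integral_curve_derive c U X sg t c').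
have vel t : 0 <= t <= T -> derivable (chart_at (gam t) \o gam) t 1 /\ velocity gam t = X (gam t).
  move=> tT; have [[d1 d2] _] := hd _ t (chart_at_atlas (gam t)) tT (chart_at_dom (gam t)).
  split=> //; rewrite /velocity derive1E d2 local_repE; last exact: chart_at_dom.
  by rewrite tmap_id//; exact: chart_at_dom.
apply: le_trans (_ : (curve_length S gam 0%R T <= _)%E).
  apply: ereal_inf_lbound; exists 0, T, gam; split=> //; split; first split.
  - apply: continuous_in_subspaceT => t; rewrite inE/= in_itv/= => tT.
    by have [_] := hd _ t (chart_at_atlas (gam t)) tT (chart_at_dom (gam t)).
  - move=> c' ac' s t s0 st tT hdom.
    have dom u : s <= u <= t -> chart_dom c' (gam u) by move=> hu; apply: hdom; exists u.
    have in0 u : s <= u <= t -> 0 <= u <= T.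
      by move=> /andP[su ut]; rewrite (le_trans s0 su) (le_trans ut tT).
    (* In any chart containing the arc, the velocity is continuous on the compact time interval; the
       arc is therefore Lipschitz, hence absolutely continuous. *)
    have cN : {within `[s, t], continuous (fun u => `|local_rep c' X (c' (gam u))|)}.
      apply: continuous_in_subspaceT => u; rewrite inE/= in_itv/= => ust.
      have c'u := dom u ust; have [[d1 _] _] := hd c' u ac' (in0 u ust) c'u.
      have cu : {for u, continuous (c' \o gam)} by apply: differentiable_continuous; exact/derivable1_diffP.
      apply: (@continuous_comp _ _ _ (fun u => local_rep c' X (c' (gam u))) Num.norm); last exact: norm_continuous.
      apply: (@continuous_comp _ _ _ (c' \o gam) (local_rep c' X)) => //.
      apply: differentiable_continuous; apply: smooth_field_diff sX ac' _ c'u.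
      exact/gU/in0.
    have [u0 _ hu0] := EVT_max st cN.
    apply: (lipschitz_abs_continuous _ _ _ _ `|local_rep c' X (c' (gam u0))|) => u v su uv vt.
    rewrite mulrC; apply: (@derive_bound_rV R n (c' \o gam) (fun u => local_rep c' X (c' (gam u)))) => //.
      move=> w /andP[uw wv]; have wst : s <= w <= t by rewrite (le_trans su uw) (le_trans wv vt).
      by have [h _] := hd c' w ac' (in0 w wst) (dom w wst).
    by move=> w /andP[uw wv]; apply: hu0; rewrite in_itv/= (le_trans su uw) (le_trans wv vt).
  - apply: aeW => t; rewrite in_itv/= => tT; have [h1 ->] := vel t tT; split=> //.
    exact/XD/gU.
rewrite /curve_length.
apply: le_trans (_ : (\int[@lebesgue_measure R]_(t in `[0%R, T]) C%:E)%E <= _)%E.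
  apply: (ge0_integral_le `[0, T]%classic `[0, T]%classic _ (fun=> C)) => // t.
  by rewrite /= in_itv/= => tT; rewrite (vel t tT).2; exact: hC.
rewrite integral_cst; last exact: measurable_itv.
have := @lebesgue_measure_itv R `[0, T]; rewrite /= => ->.
rewrite lte_fin; case: ltP => _; last by rewrite mule0 lee_fin mulr_ge0.
by rewrite -EFinD subr0 -EFinM.
Qed.

End IntegralCurves.

(** * Horizontal curves *)

Lemma mulmx_continuous {R : realType} {n m : nat} (w : 'M[R]_(n, m)) :
  continuous (fun v : 'rV[R]_n => v *m w).
Proof.
have [a a0 ha] := mx_bound w.
have a1 : 0 < a + 1 by rewrite ltr_wpDl.
move=> x; apply/continuous_eps => e e0; exists (e / (a + 1)); first by rewrite divr_gt0.
move=> y; rewrite ltr_pdivlMr// -mulmxBl => h; apply: le_lt_trans (ha _) _.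
have := normr_ge0 (y - x); lra.
Qed.

Lemma is_derive_mulmx {R : realType} {n m : nat} (w : 'M[R]_(n, m)) (g : R -> 'rV[R]_n) (t : R) (d : 'rV[R]_n) :
  is_derive t 1 g d -> is_derive t 1 (fun u => g u *m w) (d *m w).
Proof.
move=> [/derivable1_diffP dg <-].
have [h1 h2] := diff_linear_comp _ _ _ (mulmxr w) g t (mulmx_continuous w) dg.
split; first exact/derivable1_diffP.
by rewrite (deriveE _ h1) (deriveE _ dg); exact: h2.
Qed.

Lemma mx11_norm {R : realType} (A : 'rV[R]_1) : `|A| = `|A ord0 ord0|.
Proof.
apply/le_anti/andP; split; last exact: rV_norm_coord.
by apply/rV_norm_le => // j; rewrite (ord1 j).
Qed.

Lemma within_eps {R : realType} {T : topologicalType} (f : R -> T) (a b u : R) (N : set T) :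
  {within `[a, b], continuous f} -> a <= u <= b -> nbhs (f u) N ->
  exists2 d, 0 < d & forall v, a <= v <= b -> `|v - u| < d -> N (f v).
Proof.
move=> cf uab nN.
move/subspace_continuousP: cf => /(_ u); rewrite /= in_itv/= => /(_ uab _ nN).
rewrite /= /within/= => /(@nbhs_eps R R^o)[d d0 hd]; exists d => // v vab vu.
by apply: hd => //; rewrite /= in_itv.
Qed.

Lemma within_interior {R : realType} {T : topologicalType} (f : R -> T) (a b u : R) :
  {within `[a, b], continuous f} -> a < u < b -> {for u, continuous f}.
Proof.
move=> cf /andP[au ub] N nN.
have [|d d0 hd] := within_eps f a b u N cf _ nN; first by rewrite !ltW.
apply/(@nbhs_eps R R^o); exists (Num.min d (Num.min (u - a) (b - u))).
  by rewrite !lt_min d0 !subr_gt0 au.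
move=> v; rewrite !lt_min => /andP[v1 /andP[v2 v3]]; apply: hd => //.
move: v2 v3; rewrite !ltr_norml => /andP[h1 _] /andP[_ h2]; apply/andP; split; lra.
Qed.

Section HorizontalCurves.
Context {R : realType} {n : nat} {M : smoothManifold R n} (S : subRiemannian M).
Implicit Types (c : chart R n M) (U : set M).
Notation Delta := (sr_distribution S).
Notation mu := (@lebesgue_measure R).

Definition speed (p : M) (v : 'rV[R]_n) : R := Num.sqrt (sr_metric S p v v).

(** The coordinate along w, divided by K, is absolutely continuous with derivative at most the speed
    almost everywhere, so its increment is at most the length. The sign [sgn] yields both halves of
    the absolute value. *)
Lemma horizontal_increment c (gam : R -> M) (a b s t l K : R) (w : 'cV[R]_n) : atlas c ->
  horizontal S gam a b -> (curve_length S gam a b <= l%:E)%E ->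
  a <= s -> s <= t -> t <= b -> gam @` `[s, t] `<=` chart_dom c -> 0 < K ->
  (forall u, s <= u <= t -> forall v, v \in Delta (gam u) ->
     `|tmap (chart_at (gam u)) c (gam u) v *m w| <= K * speed (gam u) v) ->
  `|(c (gam t) - c (gam s)) *m w| <= K * l.
Proof.
move=> ac [[cg AC] [N [mN N0 hN]]] len as_ st tb dom K0 hK.
have dom' u : s <= u <= t -> chart_dom c (gam u) by move=> hu; apply: dom; exists u.
have [C C0 hC] := mx_bound w.
pose phi u := Num.sqrt (sr_metric S (gam u) (velocity gam u) (velocity gam u)).
have phi0 u : 0 <= phi u by exact: sqrtr_ge0.
have intphi : (\int[mu]_(u in `[s, t]) (phi u)%:E <= l%:E)%E.
  apply: le_trans len; apply: ge0_integral_le => //.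
  move=> u; rewrite /= !in_itv/= => /andP[su ut].
  by rewrite (le_trans as_ su) (le_trans ut tb).
have one (sgn : R) : `|sgn| = 1 -> sgn * ((c (gam t) - c (gam s)) *m w) ord0 ord0 <= K * l.
  move=> sg1.
  pose H u := sgn / K * (c (gam u) *m w) ord0 ord0.
  have nsg : `|sgn / K| = K^-1 by rewrite normrM sg1 mul1r gtr0_norm ?invr_gt0.
  have acH : abs_continuous H s t.
    move=> e e0.
    have C1 : 0 < C + 1 by rewrite ltr_wpDl.
    have [|d d0 hd] := AC c ac s t as_ st tb dom (e * K / (C + 1)).
      by rewrite divr_gt0// mulr_gt0.
    exists d => // m u v huv dis hs; have {}hd := hd m u v huv dis hs.
    apply: le_lt_trans (_ : (C + 1) / K * \sum_(i < m) `|c (gam (v i)) - c (gam (u i))| < _).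
      rewrite mulr_sumr; apply: ler_sum => i _.
      rewrite -mulrBr normrM nsg mulrC mulrAC ler_pM2r ?invr_gt0//.
      have := rV_norm_coord ((c (gam (v i)) - c (gam (u i))) *m w) ord0.
      rewrite mulmxBl !mxE -mulmxBl => h; apply: le_trans h _.
      apply: le_trans (hC _) _; apply: ler_wpM2r => //; lra.
    have := hd; rewrite /= -(ltr_pM2l (divr_gt0 C1 K0)) => h; apply: lt_le_trans h _.
    have -> : (C + 1) / K * (e * K / (C + 1)) = e; last by [].
    by field; rewrite !gt_eqF.
  have hH : {ae mu, forall u, u \in `[s, t] -> derivable H u 1 /\ `|'D_1 H u| <= phi u}.
    have : mu.-negligible (N `|` [set a] `|` [set b]).
      apply: negligibleU; last by exists [set b]; split=> //; exact: lebesgue_measure_set1.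
      apply: negligibleU; last by exists [set a]; split=> //; exact: lebesgue_measure_set1.
      by exists N; split.
    apply: negligibleS => u /= hu; apply: contrapT => hNab; apply: hu.
    rewrite in_itv/= => ust; have [su ut] := andP ust.
    have au := le_trans as_ su; have ub := le_trans ut tb.
    have uab : a < u < b.
      rewrite !lt_neqAle au ub !andbT; apply/andP; split; apply/eqP => uE; apply: hNab.
        by left; right.
      by right.
    have [d1 d2] : derivable (chart_at (gam u) \o gam) u 1 /\ velocity gam u \in Delta (gam u).
      apply: contrapT => h; apply: hNab; left; left; apply: hN => /= h'; apply: h; apply: h'.
      by rewrite in_itv/= au ub.
    have cu := within_interior gam a b u cg uab.
    have dc : is_derive u 1 (chart_at (gam u) \o gam) (velocity gam u).
      by rewrite /velocity derive1E; exact: DeriveDef d1 erefl.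
    have dcg := curve_derive (chart_at (gam u)) c gam u _ (chart_at_atlas _) ac (chart_at_dom _)
      (dom' u ust) cu dc.
    have dw := is_derive_coord _ _ _ ord0 (is_derive_mulmx w _ _ _ dcg).
    have dH : is_derive u 1 H (sgn / K * (tmap (chart_at (gam u)) c (gam u) (velocity gam u) *m w) ord0 ord0).
      exact: is_deriveZ.
    have [dH1 dH2] := dH; split; first exact: dH1.
    rewrite dH2 normrM nsg mulrC ler_pdivrMr// mulrC.
    by rewrite -mx11_norm; exact: hK.
  have := ac_le_integral H phi s t l st acH phi0 hH intphi.
  rewrite /H -mulrBr -(ler_pM2l K0) mulrA [K * (sgn / K)]mulrC divfK ?gt_eqF//.
  by rewrite mulmxBl !mxE.
rewrite mx11_norm ler_norml; apply/andP; split.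
  have := one (-1); rewrite normrN normr1 mulN1r => /(_ erefl); lra.
by have := one 1; rewrite normr1 mul1r => /(_ erefl).
Qed.

Variables (c : chart R n M) (z : M) (U : set M) (m : nat) (X : 'I_m -> M -> 'rV[R]_n).
Variables (r C0 Lp : R).
Hypothesis ac : atlas c.
Hypothesis cz : chart_dom c z.
Hypothesis r0 : 0 < r.
Hypothesis gen : generates Delta (sr_metric S) U X.
Hypothesis hball : forall y, `|y - c z| < r -> (c @` (U `&` chart_dom c)) y.
Hypothesis C00 : 0 < C0.
Hypothesis Lp0 : 0 <= Lp.
Hypothesis hC0 : forall i y, `|y - c z| < r -> `|local_rep c (X i) y| <= C0.
Hypothesis hLp : forall i y y', `|y - c z| < r -> `|y' - c z| < r ->
  `|local_rep c (X i) y - local_rep c (X i) y'| <= Lp * `|y - y'|.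

Let ball_point p : chart_dom c p -> `|c p - c z| < r -> U p.
Proof. by move=> cp /hball[q [Uq cq] e]; rewrite -(chart_funK cp) -e (chart_funK cq). Qed.

(** The squares of the minimizing coefficients sum to the squared speed, so none of them exceeds the
    speed. Hence bounds on the finitely many generators become bounds on all horizontal vectors. *)
Lemma generated_vector p v : chart_dom c p -> `|c p - c z| < r -> v \in Delta p ->
  exists u : 'I_m -> R, tmap (chart_at p) c p v = \sum_(i < m) u i *: local_rep c (X i) (c p) /\
    forall i, `|u i| <= speed p v.
Proof.
move=> cp cpr vD; have [_ h] := gen; have [_ h2] := h p (ball_point p cp cpr).
have [[u vE gE] _] := h2 v vD; exists u; split.
  rewrite vE tmap_sum; apply: eq_bigr => i _; by rewrite tmapZ local_repE.
move=> i; rewrite /speed gE -sqrtr_sqr ler_wsqrtr//.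
by rewrite (bigD1 i)//= lerDl; apply: sumr_ge0 => j _; exact: sqr_ge0.
Qed.

Lemma vector_functional_bound p v (w : 'cV[R]_n) (k : R) : chart_dom c p -> `|c p - c z| < r ->
  v \in Delta p -> 0 <= k -> (forall i, `|local_rep c (X i) (c p) *m w| <= k) ->
  `|tmap (chart_at p) c p v *m w| <= m%:R * k * speed p v.
Proof.
move=> cp cpr vD k0 hk; have [u [-> hu]] := generated_vector p v cp cpr vD.
rewrite mulmx_suml; apply: le_trans (ler_norm_sum _ _ _) _.
apply: le_trans (_ : \sum_(i < m) k * speed p v <= _); last first.
  by rewrite sumr_const card_ord -mulrA mulr_natl.
by apply: ler_sum => i _; rewrite -scalemxAl normrZ mulrC; apply: ler_pM.
Qed.

Let C2 := m.+1%:R * C0.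

Let C20 : 0 < C2. Proof. by rewrite mulr_gt0. Qed.

Lemma ball_increment (gam : R -> M) (a b s t l : R) :
  horizontal S gam a b -> (curve_length S gam a b <= l%:E)%E ->
  a <= s -> s <= t -> t <= b ->
  (forall u, s <= u <= t -> chart_dom c (gam u) /\ `|c (gam u) - c z| < r) ->
  0 <= l -> `|c (gam t) - c (gam s)| <= C2 * l.
Proof.
move=> hor len as_ st tb hu l0.
apply/rV_norm_le => [|j]; first by rewrite mulr_ge0// ltW.
pose w : 'cV[R]_n := delta_mx j ord0.
have wE (x : 'rV[R]_n) : (x *m w) ord0 ord0 = x ord0 j.
  rewrite mxE (bigD1 j)//= big1 ?addr0; first by rewrite !mxE !eqxx mulr1.
  by move=> i ij; rewrite !mxE (negbTE ij) mulr0.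
have := horizontal_increment c gam a b s t l C2 w ac hor len as_ st tb.
rewrite mx11_norm wE; apply => //.
  by move=> _ [u + <-]; rewrite /= in_itv/= => /hu[].
move=> u /hu[h1 h2] v vD.
apply: le_trans (vector_functional_bound _ v w C0 h1 h2 vD (ltW C00) _) _.
  by move=> i; rewrite mx11_norm wE; apply: le_trans (rV_norm_coord _ _) _; exact: hC0.
apply: ler_wpM2r; first exact: sqrtr_ge0.
by apply: ler_wpM2r; [exact: ltW|rewrite ler_nat].
Qed.

(** A compact subset of a Hausdorff space. This prevents a curve from leaving the domain of the
    chart while its coordinates still lie in the ball. *)
Lemma ball_image_closed (d : R) : 0 <= d -> d < r ->
  closed (chart_inv c @` [set y | `|y - c z| <= d]).
Proof.
move=> d0 dr; apply: compact_closed; first exact: manifold_hausdorff.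
apply: continuous_compact; last first.
  apply: bounded_closed_compact.
    exists (d + `|c z|); split; first exact: num_real.
    move=> x hx y /= yB; apply: ltW; apply: le_lt_trans hx.
    by rewrite -[y](subrK (c z)); apply: le_trans (ler_normD _ _) _; rewrite lerD2r.
  apply: (@preimage_closed _ _ (fun y : 'rV[R]_n => `|y - c z|) [set x | x <= d]); last exact: closed_le.
  move=> y _; apply/continuous_eps => t t0; exists t => // x xy.
  by apply: le_lt_trans (ler_dist_dist _ _) _; rewrite opprB addrA subrK.
apply: continuous_in_subspaceT => y; rewrite inE/= => yd.
apply: chart_inv_continuous_at; have [p [_ cp] e] := hball y (le_lt_trans yd dr).
by exists p.
Qed.

(** A continuity argument on the last time s up to which the curve lies in the closed half ball. It
    is still there at s by closedness, hence in the open ball a little later, and the length bound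
    brings it back within r / 4 + r / 4 of the centre. *)
Lemma short_curve_stays (gam : R -> M) (a b l : R) : a <= b ->
  horizontal S gam a b -> (curve_length S gam a b <= l%:E)%E -> 0 <= l ->
  chart_dom c (gam a) -> `|c (gam a) - c z| <= r / 4 -> C2 * l <= r / 4 ->
  forall u, a <= u <= b -> chart_dom c (gam u) /\ `|c (gam u) - c z| < r.
Proof.
move=> ab hor len l0 ca caz C2l.
have rp : 0 < r := r0.
have [[cg _] _] := hor.
pose good u := chart_dom c (gam u) /\ `|c (gam u) - c z| <= r / 2.
pose T : set R := [set t | a <= t <= b /\ forall u, a <= u <= t -> good u].
have Ta : T a.
  split; first by rewrite lexx.
  move=> u au; have -> : u = a by apply/le_anti; rewrite andbC.
  by split=> //; apply: le_trans caz _; lra.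
have supT : has_sup T by split; [exists a|exists b => x [/andP[]]].
pose s := sup T.
have as_ : a <= s by apply: ub_le_sup => //; exact: supT.2.
have sb : s <= b by apply: ge_sup; [exists a|move=> x [/andP[]]].
have asb : a <= s <= b by rewrite as_ sb.
have before u : a <= u -> u < s -> good u.
  move=> au us; have su : 0 < s - u by rewrite subr_gt0.
  have [t [_ ht] hts] := sup_adherent su supT; apply: ht; rewrite au/=.
  by move: hts; rewrite -/s; lra.
have r2 : 0 <= r / 2 by lra.
have r2r : r / 2 < r by lra.
have cl := ball_image_closed (r / 2) r2 r2r.
have goodE u : good u <-> (chart_inv c @` [set y | `|y - c z| <= r / 2]) (gam u).
  split=> [[h1 h2]|[y yr e]]; first by exists (c (gam u)) => //; exact: chart_funK.
  have [p [_ cp] ey] := hball y (le_lt_trans yr r2r).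
  by rewrite /good -e -ey (chart_funK cp); split=> //; rewrite ey.
have goods : good s.
  apply/goodE; apply: contrapT => hn.
  have [d d0 hd] := within_eps gam a b s _ cg asb (open_nbhs_nbhs (conj (closed_openC cl) hn)).
  have [t [tab ht] hts] := sup_adherent d0 supT.
  have ts : t <= s by apply: ub_le_sup; [exact: supT.2|split].
  have ts' : `|t - s| < d by rewrite ler0_norm ?subr_le0// opprB; move: hts; rewrite -/s; lra.
  by apply: (hd t tab ts'); apply/goodE; apply: ht; rewrite lexx andbT; case/andP: tab.
have Ts : T s.
  split=> // u /andP[au]; rewrite le_eqVlt => /orP[/eqP->//|us]; exact: before.
suff sE : s = b.
  by move=> u uab; have [h1 h2] := Ts.2 u ltac:(by rewrite sE); split=> //; lra.
apply: contrapT => /eqP nsb.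
have {}nsb : s < b by rewrite lt_neqAle nsb.
have bd : forall y, `|y - c z| < r -> (c @` chart_dom c) y.
  by move=> y /hball[p [_ cp] e]; exists p.
have oB := chart_ball_open c z r cz bd.
have Bs : (chart_dom c `&` [set q | `|c q - c z| < r]) (gam s).
  by have [h1 h2] := goods; split=> //=; lra.
have [d d0 hd] := within_eps gam a b s _ cg asb (open_nbhs_nbhs (conj oB Bs)).
pose t := Num.min b (s + d / 2).
have tb : t <= b by rewrite /t ge_min lexx.
have st : s < t by rewrite /t lt_min nsb ltrDl divr_gt0.
have td : t < s + d by rewrite /t gt_min ltrD2l ltr_pdivrMr// ltr_pMr// ltr1n orbT.
have inB u : a <= u <= t -> chart_dom c (gam u) /\ `|c (gam u) - c z| < r.
  move=> /andP[au ut]; have [us|su] := ltP u s.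
    by have [h1 h2] := before u au us; split=> //; lra.
  apply: hd; first by rewrite au (le_trans ut tb).
  by rewrite ger0_norm ?subr_ge0//; lra.
have Tt : T t.
  split; first by rewrite tb (le_trans as_ (ltW st)).
  move=> u /andP[au ut]; split; first by have [] := inB u ltac:(by rewrite au).
  have h := ball_increment gam a b a u l hor len (lexx _) au (le_trans ut tb).
  have {}h : `|c (gam u) - c (gam a)| <= C2 * l.
    by apply: h => // v /andP[av vu]; apply: inB; rewrite av (le_trans vu ut).
  rewrite -(subrKA (c (gam a))); apply: le_trans (ler_normD _ _) _; lra.
have : t <= s by apply: ub_le_sup; [exact: supT.2|].
by rewrite leNgt st.
Qed.

(** The covector w kills the generators at the starting point. On a curve of length l they change by
    at most Lp C2 l, so the component of the velocity along w is O(l) times the speed; integration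
    gives O(l^2). *)
Lemma transverse_displacement (gam : R -> M) (a b l Cw : R) (w : 'cV[R]_n) : a <= b ->
  horizontal S gam a b -> (curve_length S gam a b <= l%:E)%E -> 0 < l ->
  chart_dom c (gam a) -> `|c (gam a) - c z| <= r / 4 -> C2 * l <= r / 4 -> 0 <= Cw ->
  (forall v : 'rV[R]_n, `|v *m w| <= Cw * `|v|) ->
  (forall i, local_rep c (X i) (c (gam a)) *m w = 0) ->
  `|(c (gam b) - c (gam a)) *m w| <= (m.+1%:R * (Cw * Lp * C2 + 1)) * l ^+ 2.
Proof.
move=> ab hor len l0 ca caz C2l Cw0 hw hwa.
have l0' := ltW l0; have rp : 0 < r := r0.
have stays := short_curve_stays gam a b l ab hor len l0' ca caz C2l.
pose K := m.+1%:R * (Cw * Lp * C2 + 1) * l.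
have k0 : 0 < Cw * Lp * C2 + 1 by rewrite ltr_wpDl// !mulr_ge0// ltW.
have K0 : 0 < K by rewrite !mulr_gt0.
have -> : (m.+1%:R * (Cw * Lp * C2 + 1)) * l ^+ 2 = K * l by rewrite /K expr2 !mulrA.
apply: (horizontal_increment c gam a b a b l K w ac hor len (lexx _) ab (lexx _)) => //.
  by move=> _ [u + <-]; rewrite /= in_itv/= => /stays[].
move=> u uab v vD; have [h1 h2] := stays u uab; have [au ub] := andP uab.
have inc : `|c (gam u) - c (gam a)| <= C2 * l.
  apply: (ball_increment gam a b a u l hor len (lexx _) au ub) => // x /andP[ax xu].
  by apply: stays; rewrite ax (le_trans xu ub).
have kl : 0 <= Cw * (Lp * (C2 * l)) by rewrite !mulr_ge0// ltW.
have ca' : `|c (gam a) - c z| < r by apply: le_lt_trans caz _; lra.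
apply: le_trans (vector_functional_bound _ v w (Cw * (Lp * (C2 * l))) h1 h2 vD kl _) _.
  move=> i; rewrite -[local_rep c (X i) (c (gam u)) *m w]subr0 -(hwa i) -mulmxBl.
  apply: le_trans (hw _) _; apply: ler_wpM2l => //.
  by apply: le_trans (hLp i _ _ h2 ca') _; apply: ler_wpM2l.
apply: ler_wpM2r; first exact: sqrtr_ge0.
rewrite /K -mulrA; apply: ler_pM => //; first by rewrite ler_nat.
have -> : Cw * (Lp * (C2 * l)) = Cw * Lp * C2 * l by ring.
rewrite mulrDl mul1r; lra.
Qed.

End HorizontalCurves.

(** * Adapted frames *)

Lemma near_identity {R : realType} {k : nat} (P : 'M[R]_k) :
  (forall u : 'rV[R]_k, `|u *m P - u| <= 2^-1 * `|u|) ->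
  P \in unitmx /\ forall u : 'rV[R]_k, `|u *m invmx P| <= 2 * `|u|.
Proof.
move=> hP.
have low (u : 'rV[R]_k) : `|u| <= 2 * `|u *m P|.
  have : `|u| <= `|u *m P| + `|u *m P - u|.
    by rewrite -{1}(subKr (u *m P) u); exact: ler_normB.
  have := hP u; lra.
have uP : P \in unitmx.
  rewrite -row_free_unit; apply: inj_row_free => v v0.
  have := low v; rewrite v0 normr0 mulr0 => h.
  by apply/eqP; rewrite -normr_le0.
by split=> // u; have := low (u *m invmx P); rewrite mulmxKV.
Qed.

(** With A y the matrix of rows e i y and C0 a right inverse of A q, the matrix A y C0 is near the
    identity and C0 (A y C0)^-1 is a right inverse of A y. Its columns are covectors dual to the
    frame. *)
Lemma moving_frame {R : realType} {n k : nat} (e : 'I_k -> 'rV[R]_n -> 'rV[R]_n) (q : 'rV[R]_n) :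
  (forall i, {for q, continuous (e i)}) ->
  (forall u : 'rV[R]_k, \sum_(i < k) u ord0 i *: e i q = 0 -> u = 0) ->
  exists (rho C : R) (Th : 'rV[R]_n -> 'M[R]_(n, k)), [/\ 0 < rho, 0 <= C &
    forall y, `|y - q| < rho -> (forall v : 'rV[R]_n, `|v *m Th y| <= C * `|v|) /\
      forall i, e i y *m Th y = delta_mx ord0 i].
Proof.
move=> ce free.
pose A y : 'M[R]_(k, n) := \matrix_(i, j) e i y ord0 j.
have AE (u : 'rV[R]_k) y : u *m A y = \sum_(i < k) u ord0 i *: e i y.
  apply/rowP => j; rewrite mxE summxE; apply: eq_bigr => i _; by rewrite !mxE.
have fA : row_free (A q) by apply: inj_row_free => v; rewrite AE; exact: free.
pose C0 := pinvmx (A q).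
have AC : A q *m C0 = 1%:M by exact: mulmxVp.
have [c c0 hc] := mx_bound C0.
pose d := (2 * (c + 1) * k.+1%:R)^-1 : R.
have c1 : 0 < c + 1 by rewrite ltr_wpDl.
have d0 : 0 < d by rewrite invr_gt0 !mulr_gt0.
have /choice[del hdel] : forall i, exists r, 0 < r /\ forall y, `|y - q| < r -> `|e i y - e i q| < d.
  by move=> i; have [r r0 hr] := (continuous_eps _ _ _ _).1 (ce i) _ d0; exists r.
have [rho rho0 /allP hrho] := @positive_lower_bound R [seq del i | i <- enum 'I_k]
  ltac:(by apply/allP => _ /mapP[i _ ->]; case: (hdel i)).
exists rho, (2 * c), (fun y => C0 *m invmx (A y *m C0)); split=> //.
  by rewrite mulr_ge0.
move=> y yq.
have [uP iP] : A y *m C0 \in unitmx /\ forall u : 'rV[R]_k, `|u *m invmx (A y *m C0)| <= 2 * `|u|.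
  apply: near_identity => u.
  have -> : u *m (A y *m C0) - u = (u *m A y - u *m A q) *m C0.
    by rewrite mulmxBl -!mulmxA AC mulmx1.
  rewrite !AE -sumrB; apply: le_trans (hc _) _.
  have : `|\sum_(i < k) (u ord0 i *: e i y - u ord0 i *: e i q)| <= `|u| * (k%:R * d).
    apply: le_trans (ler_norm_sum _ _ _) _.
    apply: le_trans (_ : \sum_(i < k) `|u| * d <= _); last first.
      by rewrite sumr_const card_ord mulrCA mulr_natl.
    apply: ler_sum => i _; rewrite -scalerBr normrZ; apply: ler_pM => //.
      exact: rV_norm_coord.
    apply/ltW; have [_ h] := hdel i; apply: h; apply: lt_le_trans yq _.
    by apply: hrho; apply: map_f; rewrite mem_enum.
  move=> /(ler_wpM2l c0) h; apply: le_trans h _.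
  rewrite mulrCA [leRHS]mulrC; apply: ler_wpM2l => //.
  have -> : c * (k%:R * d) = (c / (c + 1)) * (k%:R / k.+1%:R) / 2.
    have k1 : 0 < k.+1%:R :> R by rewrite ltr0n.
    by rewrite /d; move: (k.+1%:R) k1 (k%:R) => x x0 y'; field; rewrite !gt_eqF.
  rewrite ler_pdivrMr// mulVf//; apply: le_trans (_ : 1 * 1 <= _); last by rewrite mulr1.
  apply: ler_pM; rewrite ?divr_ge0//; first by rewrite ltW.
    by rewrite ler_pdivrMr// mul1r lerDl.
  by rewrite ler_pdivrMr// mul1r ler_nat.
split=> [v|i].
  rewrite mulmxA; apply: le_trans (iP _) _; rewrite -mulrA; apply: ler_wpM2l => //.
have -> : e i y = delta_mx ord0 i *m A y.
  rewrite AE (bigD1 i)//= big1 ?addr0; first by rewrite mxE !eqxx scale1r.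
  by move=> j ji; rewrite mxE (negbTE ji) andbF scale0r.
by rewrite -mulmxA (mulmxA (A y)) mulmxV// mulmx1.
Qed.

(** * Rank of the distribution and speed of its sections *)

Section Distributions.
Context {R : realType} {n : nat} {M : smoothManifold R n} (S : subRiemannian M).
Implicit Types (c : chart R n M) (U : set M) (p q : M).
Notation Delta := (sr_distribution S).
Notation met := (sr_metric S).

Lemma generated_section U r (X : 'I_r -> M -> 'rV[R]_n) (u : 'I_r -> R) : open U ->
  generates Delta met U X -> sections Delta U (fun p => \sum_(i < r) u i *: X i p).
Proof.
move=> oU [sX hX].
split.
  apply: (smooth_fieldD_sum U r (fun=> 0) X u) => //; last by move=> p _; rewrite add0r.
  move=> c ac k; apply: (Ck_on_ext _ _ _ _ (cst 0)); [exact: chart_image_open| |exact: Ck_on_cst].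
  by move=> y _; rewrite /local_rep linear0.
move=> p Up; have [-> _] := hX p Up; apply: rpred_sum => i _; apply: rpredZ.
by apply: (subvP (sumv_sup i _ (subvv _))) => //; exact: memv_line.
Qed.

Lemma flag_at1 p : flag_at Delta 1 p = [set` Delta p].
Proof.
apply/seteqP; split=> v /=.
  by move=> [U [X [oU Up [_ hX] <-]]]; exact: hX.
move=> vD; have [U [r [X [oU Up gX]]]] := locally_generated S p.
have [_ h] := gX; have [_ /(_ v vD)[[u vE _] _]] := h p Up.
exists U, (fun q => \sum_(i < r) u i *: X i q); split=> //.
exact: generated_section.
Qed.

(** The basis vectors are combinations of the generators with constant coefficients [a], so the same
    combinations are sections near p. *)
Lemma local_basis p : exists U r (X : 'I_r -> M -> 'rV[R]_n) (a : 'M[R]_(\dim (Delta p), r)),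
  [/\ open U, U p, generates Delta met U X &
    forall u : 'rV[R]_(\dim (Delta p)),
      \sum_(k < \dim (Delta p)) u ord0 k *: (\sum_(i < r) a k i *: X i p) = 0 -> u = 0].
Proof.
have [U [r [X [oU Up gX]]]] := locally_generated S p.
have [_ h] := gX; have [_ hp] := h p Up.
have /choice[a ha] : forall k : 'I_(\dim (Delta p)), exists a : 'I_r -> R,
    (vbasis (Delta p))`_k = \sum_(i < r) a i *: X i p.
  move=> k; have [|[u uE _] _] := hp (vbasis (Delta p))`_k; last by exists u.
  by apply: vbasis_mem; apply: mem_nth; rewrite size_tuple.
exists U, r, X, (\matrix_(k, i) a k i); split=> // u hu.
have /freeP fr : free (vbasis (Delta p)) by exact: (basis_free (vbasisP _)).
apply/rowP => k; rewrite mxE; apply: (fr (fun k => u ord0 k)).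
rewrite -[RHS]hu; apply: eq_bigr => j _; rewrite ha; congr (_ *: _).
by apply: eq_bigr => i _; rewrite mxE.
Qed.

Lemma independent_dim (V : {vspace 'rV[R]_n}) d (b : 'I_d -> 'rV[R]_n) :
  (forall k, b k \in V) -> (forall u : 'rV[R]_d, \sum_(k < d) u ord0 k *: b k = 0 -> u = 0) ->
  (d <= \dim V)%N /\ (\dim V = d -> forall v, v \in V -> exists u : 'rV[R]_d, v = \sum_(k < d) u ord0 k *: b k).
Proof.
move=> bV free_b.
pose B := [tuple b k | k < d].
have fB : free B.
  apply/freeP => k hk i.
  have := free_b (\row_j k j); have -> : \sum_(j < d) (\row_j k j) ord0 j *: b j = 0.
    by rewrite -[RHS]hk; apply: eq_bigr => j _; rewrite mxE -tnth_nth tnth_mktuple.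
  by move=> /(_ erefl)/rowP/(_ i); rewrite !mxE.
have sB : (<<B>> <= V)%VS by apply/span_subvP => _ /mapP[k _ ->]; exact: bV.
have dB : \dim <<B>>%VS = d by have := fB; rewrite /free size_tuple => /eqP.
split; first by rewrite -dB dimvS.
move=> dV v vV.
have BV : <<B>>%VS = V by apply/eqP; rewrite eqEdim sB dB dV leqnn.
have vB : v \in <<B>>%VS by rewrite BV.
exists (\row_k coord B k v); rewrite {1}(coord_span vB).
by apply: eq_bigr => k _; rewrite !mxE -tnth_nth tnth_mktuple.
Qed.

Lemma tmap0_inj c p v : atlas c -> chart_dom c p -> tmap (chart_at p) c p v = 0 -> v = 0.
Proof.
move=> ac cp h; rewrite -(tmapK (chart_at p) c p v)//; first by rewrite h /tmap linear0.
- exact: chart_at_atlas.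
- exact: chart_at_dom.
Qed.

Lemma smooth_field_continuous U (W : M -> 'rV[R]_n) c p : smooth_field U W -> atlas c -> U p ->
  chart_dom c p -> {for c p, continuous (local_rep c W)}.
Proof. by move=> sW ac Up cp; apply: differentiable_continuous; exact: smooth_field_diff sW ac Up cp. Qed.

Lemma frame_at c p U k (W : 'I_k -> M -> 'rV[R]_n) : atlas c -> chart_dom c p -> open U -> U p ->
  (forall i, smooth_field U (W i)) ->
  (forall u : 'rV[R]_k, \sum_(i < k) u ord0 i *: W i p = 0 -> u = 0) ->
  exists (rho C : R) (Th : 'rV[R]_n -> 'M[R]_(n, k)), [/\ 0 < rho, 0 <= C,
    forall y, `|y - c p| < rho -> (c @` (U `&` chart_dom c)) y &
    forall q, chart_dom c q -> `|c q - c p| < rho ->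
      (forall v : 'rV[R]_n, `|v *m Th (c q)| <= C * `|v|) /\
      forall i, tmap (chart_at q) c q (W i q) *m Th (c q) = delta_mx ord0 i].
Proof.
move=> ac cp oU Up sW indep.
have [|u hu|rho [C [Th [rho0 C0 hTh]]]] := moving_frame (fun i => local_rep c (W i)) (c p).
- by move=> i; exact: smooth_field_continuous (sW i) ac Up cp.
- have h : tmap (chart_at p) c p (\sum_(i < k) u ord0 i *: W i p) = 0.
    by rewrite tmap_sum -[RHS]hu; apply: eq_bigr => i _; rewrite tmapZ local_repE.
  exact: indep (tmap0_inj c p _ ac cp h).
have [d d0 hd] := chart_image_near c U p oU Up cp.
exists (Num.min rho d), C, Th; split=> //.
- by rewrite lt_min rho0.
- by move=> y; rewrite lt_min => /andP[_]; exact: hd.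
move=> q cq; rewrite lt_min => /andP[qr _]; have [h1 h2] := hTh _ qr; split=> // i.
by rewrite -local_repE.
Qed.

Lemma frame_independent c k (W : 'I_k -> M -> 'rV[R]_n) (Th : 'M[R]_(n, k)) q :
  (forall i, tmap (chart_at q) c q (W i q) *m Th = delta_mx ord0 i) ->
  forall u : 'rV[R]_k, tmap (chart_at q) c q (\sum_(i < k) u ord0 i *: W i q) *m Th = u.
Proof.
move=> h u; rewrite tmap_sum mulmx_suml [RHS]rV_basis; apply: eq_bigr => i _.
by rewrite tmapZ -scalemxAl h.
Qed.

Lemma dim_lower_semicontinuous p : exists U, [/\ open U, U p &
  forall q, U q -> (\dim (Delta p) <= \dim (Delta q))%N].
Proof.
have [U [r [X [a [oU Up gX ind]]]]] := local_basis p.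
pose c := chart_at p; have ac : atlas c by exact: chart_at_atlas.
have cp : chart_dom c p by exact: chart_at_dom.
have sB k := generated_section U r X (a k) oU gX.
have [rho [C [Th [rho0 C0 himg hTh]]]] := frame_at c p U _ _ ac cp oU Up (fun k => (sB k).1) ind.
have hb y : `|y - c p| < rho -> (c @` chart_dom c) y.
  by move=> /himg[q [_ cq] e]; exists q.
exists (chart_dom c `&` [set q | `|c q - c p| < rho]); split.
- exact: chart_ball_open.
- by split=> //=; rewrite subrr normr0.
move=> q [cq /= qr]; have [h1 h2] := hTh q cq qr.
have Uq : U q by have [q' [Uq' cq'] e] := himg _ qr; rewrite -(chart_funK cq) -e (chart_funK cq').
have [|u hu|//] := independent_dim (Delta q) _ (fun k => \sum_(i < r) a k i *: X i q).
- by move=> k; exact: (sB k).2.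
rewrite -(frame_independent c _ (fun k q => \sum_(i < r) a k i *: X i q) _ q h2 u) hu.
by rewrite /tmap linear0 mul0mx.
Qed.

(** With constant rank, the sections extending a basis at p span the distribution nearby, and the
    dual frame bounds the coefficients of v by its coordinates; the metric is at most the sum of
    squares of any coefficients. Where the rank jumps this fails: if the generators are d/dx and x^2
    d/dy, the vector x d/dy has speed 1 / |x|. *)
Lemma speed_bound c p : atlas c -> chart_dom c p ->
  (exists V, [/\ open V, V p & forall q, V q -> \dim (Delta q) = \dim (Delta p)]) ->
  exists2 rho : R, 0 < rho & exists2 C : R, 0 <= C & forall q, chart_dom c q -> `|c q - c p| < rho ->
    forall v, v \in Delta q -> speed S q v <= C * `|tmap (chart_at q) c q v|.
Proof.
move=> ac cp [V [oV Vp hV]].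
have [U [r [X [a [oU Up gX ind]]]]] := local_basis p.
have sB k := generated_section U r X (a k) oU gX.
have oUV := openI oU oV.
have UVU : U `&` V `<=` U by move=> q [].
have [rho [C [Th [rho0 C0 himg hTh]]]] := frame_at c p (U `&` V) _ _ ac cp oUV (conj Up Vp)
  (fun k => smooth_field_sub _ _ _ UVU (sB k).1) ind.
have [ca ca0 hca] := mx_bound a.
exists rho => //; exists (r.+1%:R * (ca * C)); first by rewrite !mulr_ge0.
move=> q cq qr v vD; have [h1 h2] := hTh q cq qr.
have [Uq Vq] : (U `&` V) q.
  by have [q' [Uq' cq'] e] := himg _ qr; rewrite -(chart_funK cq) -e (chart_funK cq').
pose B k := \sum_(i < r) a k i *: X i q.
have fi := frame_independent c _ (fun k q => \sum_(i < r) a k i *: X i q) _ q h2.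
have [|u hu|_ /(_ (hV q Vq) v vD)[u vE]] := independent_dim (Delta q) _ B.
- by move=> k; exact: (sB k).2.
- by rewrite -(fi u) -/B hu /tmap linear0 mul0mx.
have ub : `|u| <= C * `|tmap (chart_at q) c q v|.
  by rewrite -[u]fi -/B -vE; exact: h1.
have vE' : v = \sum_(i < r) (u *m a) ord0 i *: X i q.
  rewrite vE; under eq_bigr do rewrite scaler_sumr; rewrite exchange_big/=.
  by apply: eq_bigr => i _; rewrite mxE scaler_suml; apply: eq_bigr => k _; rewrite scalerA.
have [_ hg] := gX; have [_ /(_ v vD)[_ /(_ (fun i => (u *m a) ord0 i) vE') hle]] := hg q Uq.
have ua := hca u.
have ca1 : 0 <= ca * `|u| by rewrite mulr_ge0.
have s1 : \sum_(i < r) ((u *m a) ord0 i) ^+ 2 <= (r.+1%:R * (ca * `|u|)) ^+ 2.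
  apply: le_trans (_ : \sum_(i < r) (ca * `|u|) ^+ 2 <= _).
    apply: ler_sum => i _; rewrite -real_normK ?num_real// ler_pXn2r ?nnegrE//.
    exact: le_trans (rV_norm_coord _ _) ua.
  rewrite sumr_const card_ord -[_ *+ r]mulr_natl [leRHS]exprMn; apply: ler_wpM2r; first exact: sqr_ge0.
  by rewrite -natrX ler_nat (leq_trans (leqnSn _))// leq_pmulr.
rewrite /speed; apply: le_trans (_ : Num.sqrt ((r.+1%:R * (ca * `|u|)) ^+ 2) <= _).
  by rewrite ler_wsqrtr// (le_trans hle s1).
rewrite sqrtr_sqr ger0_norm ?mulr_ge0// -!mulrA; apply: ler_wpM2l => //.
exact: ler_wpM2l.
Qed.

End Distributions.

(** * Continuity of the embedding *)

Lemma noninvolutive_point {R : realType} {n : nat} {M : smoothManifold R n} (S : subRiemannian M)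
    (Delta := sr_distribution S) :
  [set: M] !=set0 -> generic_degree_ge Delta 2 ->
  exists (z : M) (Om : set M) (X Y : M -> 'rV[R]_n), [/\ open Om, Om z,
    forall q, Om q -> \dim (Delta q) = \dim (Delta z),
    sections Delta Om X /\ sections Delta Om Y & lie_bracket X Y z \notin Delta z].
Proof.
move=> [p0 _] deg.
pose P k := `[< exists p, \dim (Delta p) = k >].
have exP : exists k, P k by exists (\dim (Delta p0)); apply/asboolP; exists p0.
have boundP k : P k -> (k <= \dim {: 'rV[R]_n})%N by move=> /asboolP[p <-]; exact: dimvS (subvf _).
case: (ex_maxnP exP boundP) => d /asboolP[p dp] dmax.
have [Om [oOm Omp hOm]] := dim_lower_semicontinuous S p.
have dimOm q : Om q -> \dim (Delta q) = d.
  move=> Oq; apply/eqP; rewrite eqn_leq; apply/andP; split.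
    by apply: dmax; apply/asboolP; exists q.
  by rewrite -dp; exact: hOm.
have full (q : M) : \dim (Delta q) = \dim {: 'rV[R]_n} -> Delta q = fullv.
  by move=> h; apply/eqP; rewrite eqEdim subvf h leqnn.
have setT_full : [set` (fullv : {vspace 'rV[R]_n})] = setT.
  by apply/seteqP; split=> // v _ /=; exact: memvf.
have dlt : (d < \dim {: 'rV[R]_n})%N.
  rewrite ltn_neqAle boundP ?andbT; last by apply/asboolP; exists p.
  apply/eqP => dE.
  have flag1 q : Om q -> flag_at Delta 1 q = [set` (fullv : {vspace 'rV[R]_n})].
    by move=> Oq; rewrite flag_at1 -/Delta full// dimOm.
  have nd : nonholonomy_degree Delta p 1.
    by split=> //; [rewrite flag1|move=> [|j] //; rewrite ltnS andbC; case: j].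
  suff /deg/(_ nd) : regular_point Delta p by [].
  exists 1%N => // i /andP[i1 i2]; have -> : i = 1%N by apply/eqP; rewrite eqn_leq i2.
  exists (\dim {: 'rV[R]_n}); apply: (filterS (P := Om)); last exact: open_nbhs_nbhs.
  by move=> q Oq; exists fullv => //; exact: flag1.
apply: contrapT => hno.
have inv V X Y q : open V -> V `<=` Om -> sections Delta V X -> sections Delta V Y -> V q ->
    lie_bracket X Y q \in Delta q.
  move=> oV VO sX sY Vq; apply: contrapT => /negP h; apply: hno.
  exists q, V, X, Y; split=> // q' Vq'.
  by rewrite !dimOm//; exact: VO.
have [k k1 flk] := sr_distribution_bracket_generating S p.
have : Delta p = fullv.
  apply/vspaceP => v; rewrite memvf; apply/idP.
  have : flag_at Delta k p v by rewrite flk.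
  move=> [U [W [oU Up hW <-]]].
  have oUO := openI oU oOm.
  have UO : U `&` Om `<=` Om by move=> q [].
  have UU : U `&` Om `<=` U by move=> q [].
  have [_ h] := flag_involutive Delta Om k (U `&` Om) W oUO UO inv (flag_sub _ _ _ _ _ UU hW).
  exact: h.
move=> h; move: dlt; rewrite -dp -/Delta h; by rewrite ltnn.
Qed.

Section Embedding.
Context {R : realType} {n : nat} {M : smoothManifold R n} (S : subRiemannian M).
Context {V : normedModType R}.
Variables (f : M -> V) (L : R).
Hypothesis L0 : 0 <= L.
Hypothesis hf : forall x y, (`|f x - f y|%:E <= L%:E * cc_dist S x y)%E.
Variables (c : chart R n M) (Om : set M) (d : nat).
Hypothesis ac : atlas c.
Hypothesis oOm : open Om.
Notation Delta := (sr_distribution S).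
Hypothesis dimOm : forall q, Om q -> \dim (Delta q) = d.
Let F (y : 'rV[R]_n) : V := f (chart_inv c y).

(** Near a point of locally constant rank the section has bounded speed, so an arc of duration T has
    length at most a multiple of T. *)
Lemma section_lipschitz U Y p : open U -> sections Delta U Y -> U p -> Om p -> chart_dom c p ->
  exists2 rho : R, 0 < rho & exists2 K : R, 0 <= K & forall sg T, 0 <= T ->
    ltraj (local_rep c Y) (c p) rho sg T -> `|F (sg T) - F (sg 0)| <= K * T.
Proof.
move=> oU sY Up Op cp.
have [|r1 r10 [C C0 hC]] := speed_bound S c p ac cp.
  by exists Om; split=> // q Oq; rewrite !dimOm.
have [r2 r20 hr2] := (continuous_eps _ _ _ _).1 (smooth_field_continuous U Y c p sY.1 ac Up cp) _ ltr01.
have [r3 r30 hr3] := chart_image_near c U p oU Up cp.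
pose K := C * (`|local_rep c Y (c p)| + 1).
have K0 : 0 <= K by rewrite mulr_ge0// addr_ge0.
have [rho rho0 /= /and4P[h1 h2 h3 _]] := @positive_lower_bound R [:: r1 / 2; r2 / 2; r3 / 2]
  ltac:(by rewrite /= !divr_gt0).
exists rho => //; exists (L * K) => [|sg T T0 tr]; first by rewrite mulr_ge0.
have near t r : 0 < r -> rho <= r / 2 -> 0 <= t <= T -> `|sg t - c p| < r.
  by move=> r0 hr tT; have [h _] := tr t tT; apply: le_lt_trans h _; lra.
have img t : 0 <= t <= T -> (c @` (U `&` chart_dom c)) (sg t).
  by move=> tT; apply: hr3; apply: near r30 h3 tT.
have len : (cc_dist S (chart_inv c (sg 0%R)) (chart_inv c (sg T)) <= (K * T)%:E)%E.
  apply: (integral_curve_length S c U Y sg T K ac T0 K0 oU sY).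
    by move=> t tT; split; [exact: img|have [_] := tr t tT].
  move=> t tT; have [q [Uq cq] e] := img t tT.
  rewrite -e (chart_funK cq).
  have h : speed S q (Y q) <= C * `|tmap (chart_at q) c q (Y q)|.
    apply: hC => //; last exact: sY.2.
    by rewrite e; apply: near r10 h1 tT.
  apply: le_trans h _; apply: ler_wpM2l => //; rewrite -local_repE// e.
  rewrite -[X in `|X| <= _](subrK (local_rep c Y (c p))) addrC; apply: le_trans (ler_normD _ _) _.
  by rewrite lerD2l; apply/ltW/hr2; apply: near r20 h2 tT.
have L0' : (0%:E <= L%:E)%E by rewrite lee_fin.
have := le_trans (hf _ _) (lee_wpmul2l L0' len).
by rewrite -EFinM lee_fin distrC mulrA.
Qed.

Lemma smooth_sdiff U (Y : M -> 'rV[R]_n) p : open U -> smooth_field U Y -> U p -> chart_dom c p ->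
  sdiff (local_rep c Y) (c p) (lin1_mx ('d (local_rep c Y) (c p))).
Proof.
move=> oU sY Up cp k k0.
have Vp : (c @` (U `&` chart_dom c)) (c p) by exists p.
have [e e0 he] := strict_diff _ _ _ (chart_image_open c U oU) (sY c ac 1%N) Vp k k0.
by exists e => // y y' hy hy'; rewrite mul_rV_lin1; exact: he.
Qed.

Lemma tangent_section U Y p : open U -> sections Delta U Y -> U p -> Om p -> chart_dom c p ->
  forall e, 0 < e -> tangent F e (c p) (local_rep c Y (c p)).
Proof.
move=> oU sY Up Op cp e e0.
have [rho rho0 [K K0 hK]] := section_lipschitz U Y p oU sY Up Op cp.
have [Lp [Lp0 [r r0 hr]]] := sdiff_lipschitz _ _ _ (smooth_sdiff U Y p oU sY.1 Up cp).
have [r' r'0 /= /and3P[h1 h2 _]] := @positive_lower_bound R [:: rho; r / 2] ltac:(by rewrite /= rho0 divr_gt0).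
apply: (tangent_flow F (local_rep c Y) (c p) r' K Lp e) => //.
  by move=> x x' hx hx'; apply: hr; [apply: le_lt_trans hx _|apply: le_lt_trans hx' _]; lra.
move=> sg T T0 tr; apply: hK => // t tT; have [a b] := tr t tT; split=> //.
exact: le_trans a h1.
Qed.

Lemma tangent_sum m (q : 'rV[R]_n) (w : 'I_m -> 'rV[R]_n) :
  (forall j e, 0 < e -> tangent F e q (w j)) -> forall e, 0 < e -> tangent F e q (\sum_(j < m) w j).
Proof.
elim: m w => [|m IH] w hw e e0; first by rewrite big_ord0; apply: tangent0; exact: ltW.
rewrite big_ord_recr/= [e](splitr e).
have e2 : 0 < e / 2 by rewrite divr_gt0.
by apply: tangentD; [apply: IH => // j; exact: hw|exact: hw].
Qed.

(** Each bracket in the flag joins a section, along whose flow F is Lipschitz, to a field already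
    known to be tangent at all nearby points. [tangent_bracket] asks for exactly this asymmetric
    information. *)
Lemma tangent_flag i U W : open U -> flag Delta i U W ->
  forall p, U p -> Om p -> chart_dom c p -> forall e, 0 < e -> tangent F e (c p) (local_rep c W (c p)).
Proof.
move=> oU hW0; have := flag_smooth Delta i U W oU hW0; move: hW0.
rewrite /flag; elim: i.-1 W => [|k IH] W; first by move=> sW _ p; exact: tangent_section.
rewrite iterS => -[X [m [Y [Z [hX hY hZ hW]]]]] _ p Up Op cp e e0.
have sX := flag_smooth Delta k.+1 U X oU hX.
have sZ j := flag_smooth Delta k.+1 U (Z j) oU (hZ j).
have sY j := (hY j).1.
have -> : local_rep c W (c p) = local_rep c X (c p) +
    \sum_(j < m) (local_rep c (Y j) (c p) *m lin1_mx ('d (local_rep c (Z j)) (c p)) -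
                  local_rep c (Z j) (c p) *m lin1_mx ('d (local_rep c (Y j)) (c p))).
  rewrite !local_repE// (hW p Up) tmapD tmap_sum; congr (_ + _).
  apply: eq_bigr => j _; rewrite -local_repE// (local_rep_bracket U)//.
  by rewrite /bracket !mul_rV_lin1.
rewrite [e](splitr e); have e2 : 0 < e / 2 by rewrite divr_gt0.
apply: tangentD; first exact: IH.
apply: tangent_sum => // j e' e'0.
have [rho rho0 [K K0 hK]] := section_lipschitz U (Y j) p oU (hY j) Up Op cp.
have [r r0 hr] := chart_image_near c (U `&` Om) p (openI oU oOm) (conj Up Op) cp.
have [r' r'0 /= /and3P[h1 h2 _]] := @positive_lower_bound R [:: rho; r / 2] ltac:(by rewrite /= rho0 divr_gt0).
apply: (tangent_bracket F (local_rep c (Y j)) (local_rep c (Z j)) (c p) _ _ r' K) => //.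
- exact: smooth_sdiff (sY j) Up cp.
- exact: smooth_sdiff (sZ j) Up cp.
- move=> sg T T0 tr; apply: hK => // t tT; have [a b] := tr t tT; split=> //.
  exact: le_trans a h1.
move=> y yr e'' e''0; have [|q [[Uq Oq] cq] <-] := hr y; last exact: (IH (Z j)).
by apply: le_lt_trans yr _; lra.
Qed.

Lemma embedding_continuous p : Om p -> chart_dom c p -> forall e, 0 < e -> exists2 r, 0 < r &
  forall y, `|y - c p| < r -> `|F y - F (c p)| <= e.
Proof.
move=> Op cp e e0.
(* [tangent_continuous] spends its error once for each of the n coordinates; [n.+1] avoids division
   by 0. *)
pose e' := e / n.+1%:R.
have e'0 : 0 < e' by rewrite divr_gt0.
have [|r r0 hr] := tangent_continuous F (c p) e' (ltW e'0).
  move=> w; have [k k1 flk] := sr_distribution_bracket_generating S p.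
  have : flag_at Delta k p (tmap c (chart_at p) p w) by rewrite flk.
  move=> [U [W [oU Up hW We]]].
  have -> : w = local_rep c W (c p).
    rewrite local_repE// We tmapK//; [exact: chart_at_atlas|exact: chart_at_dom].
  exact: (tangent_flag k U W oU hW p).
exists r => // y yr; apply: le_trans (hr y yr) _.
rewrite /e' mulrCA; apply: ler_piMr; first exact: ltW.
by rewrite ler_pdivrMr// mul1r ler_nat.
Qed.

End Embedding.

(** * Transverse displacements *)

Section LowerBound.
Context {R : realType} {n : nat} {M : smoothManifold R n} (S : subRiemannian M).
Implicit Types (c : chart R n M) (U : set M).
Notation Delta := (sr_distribution S).
Notation met := (sr_metric S).

Lemma generator_bounds c z U m (X : 'I_m -> M -> 'rV[R]_n) : atlas c -> chart_dom c z -> open U -> U z ->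
  generates Delta met U X -> exists r C0 Lp : R, [/\ 0 < r, 0 < C0, 0 <= Lp,
    forall y, `|y - c z| < r -> (c @` (U `&` chart_dom c)) y &
    (forall i y, `|y - c z| < r -> `|local_rep c (X i) y| <= C0) /\
    (forall i y y', `|y - c z| < r -> `|y' - c z| < r ->
      `|local_rep c (X i) y - local_rep c (X i) y'| <= Lp * `|y - y'|)].
Proof.
move=> ac cz oU Uz [sX _].
have /choice[Lp hLp] : forall i, exists Lp : R, 0 < Lp /\ exists2 d : R, 0 < d & forall y y',
    `|y - c z| < d -> `|y' - c z| < d -> `|local_rep c (X i) y - local_rep c (X i) y'| <= Lp * `|y - y'|.
  move=> i; have [Lp [Lp0 h]] := sdiff_lipschitz _ _ _ (smooth_sdiff c ac U (X i) z oU (sX i) Uz cz).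
  by exists Lp.
have /choice[del hdel] : forall i, exists d : R, 0 < d /\ forall y y',
    `|y - c z| < d -> `|y' - c z| < d -> `|local_rep c (X i) y - local_rep c (X i) y'| <= Lp i * `|y - y'|.
  by move=> i; have [_ [d d0 hd]] := hLp i; exists d.
have [r1 r10 hr1] := chart_image_near c U z oU Uz cz.
have [r r0 /allP hr] := @positive_lower_bound R (r1 :: 1 :: [seq del i | i <- enum 'I_m])
  ltac:(by rewrite /= r10 ltr01; apply/allP => _ /mapP[i _ ->]; case: (hdel i)).
have rr1 : r <= r1 by apply: hr; rewrite inE eqxx.
have rr : r <= 1 by apply: hr; rewrite !inE eqxx orbT.
have rd i : r <= del i by apply: hr; rewrite !inE; apply/orP; right; apply/orP; right; apply: map_f; rewrite mem_enum.
have Lp0 i : 0 <= Lp i by have [/ltW] := hLp i.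
pose LL := \sum_(i < m) Lp i.
have LL0 : 0 <= LL by apply: sumr_ge0.
have leL i : Lp i <= LL by rewrite /LL (bigD1 i)//= lerDl; apply: sumr_ge0.
pose C := \sum_(i < m) `|local_rep c (X i) (c z)|.
have leC i : `|local_rep c (X i) (c z)| <= C by rewrite /C (bigD1 i)//= lerDl; apply: sumr_ge0.
have C0 : 0 <= C by apply: sumr_ge0.
have lip i y y' : `|y - c z| < r -> `|y' - c z| < r ->
    `|local_rep c (X i) y - local_rep c (X i) y'| <= LL * `|y - y'|.
  move=> hy hy'; have [_ h] := hdel i.
  apply: le_trans (h y y' (lt_le_trans hy (rd i)) (lt_le_trans hy' (rd i))) _.
  exact: ler_wpM2r.
exists r, (C + LL + 1), LL; split=> //.
- by rewrite ltr_wpDl// addr_ge0.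
- by move=> y yr; apply: hr1; apply: lt_le_trans yr rr1.
split=> // i y yr.
have zr : `|c z - c z| < r by rewrite subrr normr0.
have := lip i y (c z) yr zr => h.
rewrite -[X in `|X| <= _](subrK (local_rep c (X i) (c z))); apply: le_trans (ler_normD _ _) _.
have h2 : LL * `|y - c z| <= LL by rewrite ler_piMr// ltW// (lt_le_trans yr rr).
have := leC i; lra.
Qed.

(** Short curves obey the quadratic bound of [transverse_displacement], whence Q1. A curve too long
    to be confined to the ball has length at least l0, while the displacement between the two points
    is at most r / 2, so the quadratic bound holds with Q2. *)
Lemma cc_dist_lower c z U m (X : 'I_m -> M -> 'rV[R]_n) (r C0 Lp Cw : R) : atlas c -> chart_dom c z ->
  0 < r -> generates Delta met U X ->
  (forall y, `|y - c z| < r -> (c @` (U `&` chart_dom c)) y) -> 0 < C0 -> 0 <= Lp ->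
  (forall i y, `|y - c z| < r -> `|local_rep c (X i) y| <= C0) ->
  (forall i y y', `|y - c z| < r -> `|y' - c z| < r ->
      `|local_rep c (X i) y - local_rep c (X i) y'| <= Lp * `|y - y'|) -> 0 <= Cw ->
  exists2 Q : R, 0 < Q & forall p q (w : 'cV[R]_n), chart_dom c p -> chart_dom c q ->
    `|c p - c z| <= r / 4 -> `|c q - c z| <= r / 4 ->
    (forall v : 'rV[R]_n, `|v *m w| <= Cw * `|v|) ->
    (forall i, local_rep c (X i) (c p) *m w = 0) ->
    ((Num.sqrt (`|(c q - c p) *m w| / Q))%:E <= cc_dist S p q)%E.
Proof.
move=> ac cz r0 gX hball C00 Lp0 hC0 hLp Cw0.
pose C2 := m.+1%:R * C0.
have C20 : 0 < C2 by rewrite mulr_gt0.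
pose Q1 := m.+1%:R * (Cw * Lp * C2 + 1).
have Q10 : 0 <= Q1 by rewrite !mulr_ge0// addr_ge0// !mulr_ge0// ltW.
pose l0 := r / 4 / C2.
have l00 : 0 < l0 by rewrite !divr_gt0.
pose Q2 := (Cw * (r / 2) + 1) / l0 ^+ 2.
have Q20 : 0 < Q2 by rewrite divr_gt0 ?exprn_gt0// ltr_wpDl// mulr_ge0// ltW// divr_gt0.
exists (Q1 + Q2); first by rewrite ltr_wpDl.
have Q0 : 0 < Q1 + Q2 by rewrite ltr_wpDl.
move=> p q w cp cq pr qr hw hwX.
have Dr : `|c q - c p| <= r / 2.
  rewrite -(subrKA (c z)); apply: le_trans (ler_normD _ _) _.
  by rewrite [`|c z - _|]distrC; lra.
apply/ereal_infP => _ [a [b [gam [ab hor ga gb ->]]]].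
have len0 : (0 <= curve_length S gam a b)%E.
  by apply: integral_ge0 => t _; rewrite lee_fin sqrtr_ge0.
case E : (curve_length S gam a b) len0 => [lam| |] // lam0; last by rewrite leey.
(* The length may be 0, whereas the quadratic estimate asks for a positive bound on it. *)
rewrite lee_fin; apply/ler_addgt0Pr => e e0.
have l_gt0 : 0 < lam + e by move: lam0; rewrite lee_fin => lam0; rewrite ltr_wpDl.
have len : (curve_length S gam a b <= (lam + e)%:E)%E by rewrite E lee_fin lerDl ltW.
suff D : `|(c q - c p) *m w| <= (Q1 + Q2) * (lam + e) ^+ 2.
  apply: le_trans (_ : Num.sqrt ((lam + e) ^+ 2) <= _); last by rewrite sqrtr_sqr gtr0_norm.
  by rewrite ler_wsqrtr// ler_pdivrMr// mulrC.
have s0 : 0 <= (lam + e) ^+ 2 by exact: sqr_ge0.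
have [hl|hl] := leP (C2 * (lam + e)) (r / 4).
  have := transverse_displacement S c z U m X r C0 Lp ac cz r0 gX hball C00 Lp0 hC0 hLp gam a b
    (lam + e) Cw w ab hor len l_gt0.
  rewrite ga gb => /(_ cp pr hl Cw0 hw hwX) h; apply: le_trans h _.
  by apply: ler_wpM2r => //; rewrite lerDl ltW.
apply: le_trans (hw _) _; apply: le_trans (_ : Cw * (r / 2) <= _); first exact: ler_wpM2l.
have l0l : l0 <= lam + e by rewrite /l0 ler_pdivrMr// [leRHS]mulrC ltW.
have l2 : l0 ^+ 2 <= (lam + e) ^+ 2 by rewrite ler_pXn2r// nnegrE ltW.
apply: le_trans (_ : Q2 * l0 ^+ 2 <= _).
  by rewrite /Q2 divfK ?gt_eqF ?exprn_gt0// lerDl.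
apply: le_trans (_ : Q2 * (lam + e) ^+ 2 <= _); first by rewrite ler_pM2l.
by apply: ler_wpM2r => //; rewrite lerDr.
Qed.

(* The covector is dual to the last vector of a frame made of a basis of Delta followed by Z. *)
Lemma transverse_covector c z Om (Z : M -> 'rV[R]_n) : atlas c -> chart_dom c z -> open Om -> Om z ->
  (forall q, Om q -> \dim (Delta q) = \dim (Delta z)) -> smooth_field Om Z -> Z z \notin Delta z ->
  exists (rho C : R) (th : 'rV[R]_n -> 'cV[R]_n), [/\ 0 < rho, 0 <= C,
    forall y, `|y - c z| < rho -> (c @` (Om `&` chart_dom c)) y &
    forall q, chart_dom c q -> `|c q - c z| < rho ->
      [/\ forall v : 'rV[R]_n, `|v *m th (c q)| <= C * `|v|,
          forall v, v \in Delta q -> tmap (chart_at q) c q v *m th (c q) = 0 &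
          tmap (chart_at q) c q (Z q) *m th (c q) = 1]].
Proof.
move=> ac cz oOm Oz dimO sZ nZ.
have [U [r [X [a [oU Uz gX ind]]]]] := local_basis S z.
set d := \dim (Delta z) in a ind dimO.
pose B k q : 'rV[R]_n := \sum_(i < r) a k i *: X i q.
have sB k : sections Delta U (B k) := generated_section S U r X (a k) oU gX.
pose W (i : 'I_d.+1) q := if insub (val i) is Some j then B j q else Z q.
have Wl (j : 'I_d) : W (widen_ord (leqnSn d) j) = B j.
  by apply/funext => q; rewrite /W /= valK.
have Wm : W ord_max = Z by apply/funext => q; rewrite /W /= insubF// ltnn.
have oUO := openI oU oOm.
have UU : U `&` Om `<=` U by move=> q [].
have UO : U `&` Om `<=` Om by move=> q [].
have sW i : smooth_field (U `&` Om) (W i).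
  have [->|im] := eqVneq i ord_max; first by rewrite Wm; exact: smooth_field_sub UO sZ.
  have id_ : (i < d)%N.
    by rewrite ltn_neqAle -ltnS ltn_ord andbT; apply: contra im => /eqP e; apply/eqP/val_inj.
  have -> : i = widen_ord (leqnSn d) (Ordinal id_) by apply: val_inj.
  by rewrite Wl; exact: smooth_field_sub UU (sB _).1.
have indW (u : 'rV[R]_d.+1) : \sum_(i < d.+1) u ord0 i *: W i z = 0 -> u = 0.
  rewrite big_ord_recr/= Wm; under eq_bigr do rewrite Wl.
  set s := \sum_(i < d) _ => h.
  have sD : s \in Delta z by apply: rpred_sum => j _; apply: rpredZ; exact: (sB j).2.
  (* A nonzero last coefficient would put [Z z] into the distribution. *)
  have um : u ord0 ord_max = 0.
    apply/eqP; apply: contraT => um; move: nZ; rewrite -(scale1r (Z z)) -(mulVf um) -scalerA.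
    by rewrite memvZ// -[_ *: Z z](addKr s) h addr0 rpredN.
  have us : \row_(i < d) u ord0 (widen_ord (leqnSn d) i) = 0.
    apply: ind; rewrite -[RHS]h um scale0r addr0; apply: eq_bigr => j _.
    by rewrite mxE.
  apply/rowP => i; rewrite mxE.
  have [->//|im] := eqVneq i ord_max.
  have id_ : (i < d)%N.
    by rewrite ltn_neqAle -ltnS ltn_ord andbT; apply: contra im => /eqP e; apply/eqP/val_inj.
  have -> : i = widen_ord (leqnSn d) (Ordinal id_) by apply: val_inj.
  by move/rowP: us => /(_ (Ordinal id_)); rewrite !mxE.
have [rho [C [Th [rho0 C0 himg hTh]]]] := frame_at c z (U `&` Om) _ W ac cz oUO (conj Uz Oz) sW indW.
exists rho, C, (fun y => Th y *m delta_mx ord_max ord0); split=> //.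
  by move=> y /himg[q [[_ Oq] cq] e]; exists q.
move=> q cq qr; have [h1 h2] := hTh q cq qr.
have [Uq Oq] : (U `&` Om) q.
  by have [q' [Uq' cq'] e] := himg _ qr; rewrite -(chart_funK cq) -e (chart_funK cq').
have last_ (x : 'rV[R]_d.+1) : x *m (delta_mx ord_max ord0 : 'cV[R]_d.+1) = (x ord0 ord_max)%:M.
  apply/matrixP => i j; rewrite !mxE (bigD1 ord_max)//= big1 ?addr0.
    by rewrite !mxE !ord1 !eqxx mulr1.
  by move=> k km; rewrite !mxE (negbTE km) mulr0.
have hB j : tmap (chart_at q) c q (B j q) *m Th (c q) = delta_mx ord0 (widen_ord (leqnSn d) j).
  by rewrite -h2 Wl.
split.
- move=> v; rewrite mulmxA last_; apply: le_trans (h1 v).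
  by rewrite mx11_norm mxE eqxx mulr1n; exact: rV_norm_coord.
- move=> v vD.
  have [|u hu|_ /(_ (dimO q Oq) v vD)[u ->]] := independent_dim (Delta q) d (fun k => B k q).
  + by move=> k; exact: (sB k).2.
  + have h : \sum_(k < d) u ord0 k *: (delta_mx ord0 (widen_ord (leqnSn d) k) : 'rV[R]_d.+1) = 0.
      rewrite -[RHS](mul0mx _ (Th (c q))) -(linear0 ('d (c \o chart_inv (chart_at q)) (chart_at q q))).
      rewrite -/(tmap _ _ _ _) -hu tmap_sum mulmx_suml; apply: eq_bigr => k _.
      by rewrite tmapZ -scalemxAl hB.
    apply/rowP => j; move/rowP: h => /(_ (widen_ord (leqnSn d) j)); rewrite summxE (bigD1 j)//= big1 ?addr0.
      by rewrite !mxE !eqxx mulr1.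
    move=> k kj; rewrite !mxE.
    have -> : (widen_ord (leqnSn d) j == widen_ord (leqnSn d) k) = false.
      by apply/negP => /eqP/(congr1 val)/= e; move/eqP: kj; apply; apply: val_inj.
    by rewrite andbF mulr0.
  + rewrite tmap_sum mulmx_suml big1// => k _; rewrite tmapZ -scalemxAl mulmxA hB last_ mxE.
    have -> : (ord_max == widen_ord (leqnSn d) k :> 'I_d.+1) = false.
      by apply/negP => /eqP/(congr1 val)/= e; have := ltn_ord k; rewrite -e ltnn.
    by rewrite andbF scale_scalar_mx mulr0 raddf0.
- have := h2 ord_max; rewrite Wm mulmxA => ->; rewrite last_ mxE !eqxx.
  by apply/matrixP => i j; rewrite !mxE !ord1.
Qed.

End LowerBound.

Theorem theorem1p4 (R : realType) (n : nat) (M : smoothManifold R n)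
    (S : subRiemannian M)
    (M_nonempty : [set: M] !=set0) (M_connected : connected [set: M])
    (M_degree : generic_degree_ge (sr_distribution S) 2)
    (V : completeNormedModType R) (V_RNP : radon_nikodym_property V) :
  ~ exists (L : R) (f : M -> V),
      1 <= L /\ bilipschitz_embedding (cc_dist S) L f.
Proof.
move=> [L [f [L1 hf]]].
have L_gt0 : 0 < L by lra.
have L0 : 0 <= L by exact: ltW.
have hfU x y : (`|f x - f y|%:E <= L%:E * cc_dist S x y)%E by have [_] := hf x y.
have [z [Om [X [Y [oOm Oz dimO [sX sY] nZ]]]]] := noninvolutive_point S M_nonempty M_degree.
pose c := chart_at z; have ac : atlas c by exact: chart_at_atlas.
have cz : chart_dom c z by exact: chart_at_dom.
have sZ := smooth_field_bracket Om X Y oOm sX.1 sY.1.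
have [r1 [C1 [th [r10 C10 img1 hth]]]] := transverse_covector S c z Om _ ac cz oOm Oz dimO sZ nZ.
have [U [m [G [oU Uz gG]]]] := locally_generated S z.
have [r2 [C0 [Lp [r20 C00 Lp0 img2 [hC0 hLp]]]]] := generator_bounds S c z U m G ac cz oU Uz gG.
have [Q Q0 hQ] := cc_dist_lower S c z U m G r2 C0 Lp C1 ac cz r20 gG img2 C00 Lp0 hC0 hLp C10.
have [r3 r30 [KX KX0 hKX]] := section_lipschitz S f L L0 hfU c Om _ ac oOm dimO Om X z oOm sX Oz Oz cz.
have [r4 r40 [KY KY0 hKY]] := section_lipschitz S f L L0 hfU c Om _ ac oOm dimO Om Y z oOm sY Oz Oz cz.
(* The covector at a nearby point gives 1 on the bracket at that point. Within this distance, the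
   bracket at z differs from it by at most 1/2 after pairing, so the pairing with the fixed vector
   at z stays at least 1/2. *)
have e1 : 0 < (2 * (C1 + 1))^-1 by rewrite invr_gt0 mulr_gt0// ltr_wpDl.
have [r5 r50 hr5] := (continuous_eps _ _ _ _).1 (smooth_field_continuous Om _ c z sZ ac Oz cz) _ e1.
(* The quarter of r2 is the range of [cc_dist_lower]; the halves place the closed ball inside open
   ones. *)
have [rho rho0 /= /and5P[h1 h2 h3 h4 /andP[h5 _]]] := @positive_lower_bound R [:: r1 / 2; r2 / 4; r3; r4; r5 / 2]
  ltac:(by rewrite /= r30 r40 !divr_gt0).
have pt y : `|y - c z| <= rho -> exists q, [/\ Om q, chart_dom c q & c q = y].
  by move=> yr; have [|q [Oq cq] e] := img1 y; [apply: le_lt_trans yr _; lra|exists q].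
have inr1 q : `|c q - c z| <= rho -> `|c q - c z| < r1.
  by move=> h; apply: le_lt_trans h _; lra.
have mono r (T : R) (W : 'rV[R]_n -> 'rV[R]_n) sg : rho <= r -> ltraj W (c z) rho sg T -> ltraj W (c z) r sg T.
  by move=> hr tr t tT; have [a b] := tr t tT; split=> //; exact: le_trans a hr.
pose F (y : 'rV[R]_n) : V := f (chart_inv c y).
have cc0 : 0 < L^-1 * (Num.sqrt Q)^-1 by rewrite mulr_gt0 ?invr_gt0// sqrtr_gt0.
apply: (no_transverse_embedding (local_rep c X) (local_rep c Y) (c z)
  (lin1_mx ('d (local_rep c X) (c z))) (lin1_mx ('d (local_rep c Y) (c z)))
  rho (KX + KY) (L^-1 * (Num.sqrt Q)^-1) C1 F th V_RNP rho0 _ cc0 C10).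
- exact: addr_ge0.
- exact: smooth_sdiff oOm sX.1 Oz cz.
- exact: smooth_sdiff oOm sY.1 Oz cz.
- move=> sg T T0 tr; apply: le_trans (hKX sg T T0 (mono _ _ _ _ h3 tr)) _.
  by apply: ler_wpM2r => //; rewrite lerDl.
- move=> sg T T0 tr; apply: le_trans (hKY sg T T0 (mono _ _ _ _ h4 tr)) _.
  by apply: ler_wpM2r => //; rewrite lerDr.
- apply: closed_ball_unif_cont => y /pt[q [Oq cq <-]] e e0.
  exact: (embedding_continuous S f L L0 hfU c Om _ ac oOm dimO q Oq cq e e0).
- move=> y yr; have [q [Oq cq e]] := pt y yr; move: yr; rewrite -{y}e => qr.
  have [t1 t2 t3] := hth q cq (inr1 q qr).
  split=> //; first by rewrite local_repE//; exact: t2 _ (sY.2 q Oq).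
  have zE := local_rep_bracket Om X Y c z oOm sX.1 sY.1 ac Oz cz.
  rewrite !mul_rV_lin1 -opprB -[_ - _]zE mulNmx normrN.
  have qE := local_repE c (lie_bracket X Y) q cq.
  rewrite -qE in t3.
  have d1 : `|local_rep c (lie_bracket X Y) (c q) - local_rep c (lie_bracket X Y) (c z)|
      < (2 * (C1 + 1))^-1.
    by apply: hr5; apply: le_lt_trans qr _; lra.
  have d2 := t1 (local_rep c (lie_bracket X Y) (c q) - local_rep c (lie_bracket X Y) (c z)).
  rewrite mulmxBl t3 in d2.
  have d3 : C1 * (2 * (C1 + 1))^-1 <= 2^-1.
    by rewrite ler_pdivrMr ?mulr_gt0 ?ltr_wpDl//; lra.
  have d4 := le_trans d2 (le_trans (ler_wpM2l C10 (ltW d1)) d3).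
  have n1 : `|1 : 'M[R]_1| = 1 by rewrite mx11_norm mxE eqxx normr1.
  move: d4; move: (_ *m th _) => w d4.
  have : `|1 : 'M[R]_1| <= `|1 - w| + `|w| by rewrite -{1}(subrK w 1); exact: ler_normD.
  by rewrite n1; move: d4; lra.
move=> y y' yr y'r; have [q [Oq cq e]] := pt y yr; have [q' [Oq' cq' e']] := pt y' y'r.
rewrite -{}e -{}e' in yr y'r *.
have [t1 t2 t3] := hth q cq (inr1 q yr).
have Uq : U q.
  have [|p [Up cp] e] := img2 (c q); first by apply: le_lt_trans yr _; lra.
  by rewrite -(chart_funK cq) -e (chart_funK cp).
have low := hQ q q' (th (c q)) cq cq' (le_trans yr h2) (le_trans y'r h2) t1.
have {}low : ((Num.sqrt (`|(c q' - c q) *m th (c q)| / Q))%:E <= cc_dist S q q')%E.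
  apply: low => i; rewrite local_repE//; apply: t2.
  have [_ /(_ q Uq)[-> _]] := gG.
  by apply: (subvP (sumv_sup i _ (subvv _))) => //; exact: memv_line.
have Li0 : (0%:E <= (L^-1)%:E)%E by rewrite lee_fin invr_ge0.
have [+ _] := hf q q'; move=> /(le_trans (lee_wpmul2l Li0 low)).
rewrite -EFinM lee_fin sqrtrM// sqrtrV ?(ltW Q0)// /F !chart_funK// distrC.
by rewrite -mulrA [_^-1 * Num.sqrt _]mulrC.
Qed.
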